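(* Let $G$ be a connected reductive group over $\mathbb C$, $\theta\in\mathrm{Aut}(G)$ an involution with $K=G^\theta$ connected, $P\subset G$ and $Q\subset K$ parabolic subgroups, and let $\mathcal Y$ and $\phi_{\mathfrak s}:\mathcal Y\to\mathfrak s$ be the conormal variety of $\mathfrak X=K/Q\times G/P$ and the map defined in the context. Then $\phi_{\mathfrak s}(\mathcal Y)\subset\mathcal N_{\mathfrak s}$ in each of the following situations: (1) $G=\mathrm{GL}_n$ and $P\subset G$ is a maximal parabolic subgroup; (2) $G=\mathrm{Sp}_{2n}$ and $P\subset G$ is the stabilizer of a Lagrangian subspace or of a line; (3) $G=\mathrm{SO}_n$ and $P\subset G$ is the stabilizer of an isotropic line, or of a Lagrangian subspace (if $n$ is even), or of a maximal isotropic subspace if $n=5$. In particular, $\phi_{\mathfrak s}(\mathcal Y)\subset\mathcal N_{\mathfrak s}$ holds whenever $G$ is classical (one of $\mathrm{GL}_n,\mathrm{Sp}_{2n},\mathrm{SO}_n$) and $P$ has an abelian unipotent radical.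
   Context: $\mathfrak g,\mathfrak k$ denote the Lie algebras of $G,K$; $\theta$ also denotes the differential of $\theta$; $\mathfrak g=\mathfrak k\oplus\mathfrak s$ with $\mathfrak s=\{x\in\mathfrak g:\theta(x)=-x\}$. For $y\in\mathfrak g$ write $y=y^\theta+y^{-\theta}$ with $y^\theta\in\mathfrak k$, $y^{-\theta}\in\mathfrak s$. $\mathcal N_{\mathfrak s}$ is the set of nilpotent elements of $\mathfrak g$ lying in $\mathfrak s$. $G/P$ (resp. $K/Q$) is identified with the set of parabolic subalgebras $\mathfrak p_1\subset\mathfrak g$ conjugate to $\mathrm{Lie}(P)$ (resp. $\mathfrak q_1\subset\mathfrak k$ conjugate to $\mathrm{Lie}(Q)$), and $\mathfrak n_{\mathfrak p_1}$, $\mathfrak n_{\mathfrak q_1}$ denote the nilradicals. The conormal variety is $$\mathcal Y=\{(y,\mathfrak q_1,\mathfrak p_1)\in\mathfrak g\times K/Q\times G/P:\ y\in\mathfrak n_{\mathfrak p_1},\ y^\theta\in\mathfrak n_{\mathfrak q_1}\},$$ and $\phi_{\mathfrak s}(y,\mathfrak q_1,\mathfrak p_1)=y^{-\theta}$. *)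

(* Defs.v *)
From mathcomp Require Import all_boot all_order all_algebra.
From mathcomp Require Import classical_sets reals complex.
From mathcomp Require Import mpoly.

Set Implicit Arguments.
Unset Strict Implicit.
Unset Printing Implicit Defensive.

Import Order.TTheory GRing.Theory Num.Theory.
Local Open Scope ring_scope.
Local Open Scope classical_set_scope.

(* Linear algebraic groups are Zariski closed subgroups of GL_N(C), given as  *)
(* sets of matrices; matrices act on row vectors by right multiplication, and *)
(* a subspace of C^N is given as the row space of a square matrix.            *)

Section LinearAlgebraicGroups.

Variables (C : numClosedFieldType) (N : nat).
Implicit Types (g h x y W : 'M[C]_N) (G H P Q U Z : set 'M[C]_N).

Definition GL : set 'M[C]_N := [set g | g \in unitmx].

Definition nilpotent_mx x := exists k : nat, x ^+ k = 0.

Definition unipotent_mx g := nilpotent_mx (g - 1%:M).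

(* The coordinate ring C[x_ij, 1/det] of GL_N: the first N * N variables are  *)
(* the matrix entries, the last one is the inverse of the determinant.        *)
Definition regular_fun : Type := {mpoly C[(N * N + 1)%N]}.

Definition eval_regular (f : regular_fun) g : C :=
  f.@[row_mx (mxvec g) (\det g)^-1%:M 0].

(* The derivative at the identity in the direction x; the derivative of       *)
(* 1/det at the identity is - \tr x.                                          *)
Definition diff_regular (f : regular_fun) x : C :=
  \sum_i f^`M(i).@[row_mx (mxvec 1%:M) 1%:M 0]
         * row_mx (mxvec x) (- \tr x)%:M 0 i.

Definition zariski_closed Z :=
  exists I : set regular_fun,
    Z = [set g | GL g /\ forall f, I f -> eval_regular f g = 0].

Definition zariski_connected Z :=
  forall A B : set 'M[C]_N, zariski_closed A -> zariski_closed B ->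
    Z `<=` A `|` B -> Z `&` A `&` B = set0 -> Z `<=` A \/ Z `<=` B.

Definition is_subgroup H :=
  [/\ H `<=` GL, H 1%:M, forall g h, H g -> H h -> H (g *m h)
    & forall g, H g -> H (invmx g)].

Definition closed_subgroup H G :=
  [/\ is_subgroup H, zariski_closed H & H `<=` G].

Definition normal_in U G := forall g u, G g -> U u -> U (g *m u *m invmx g).

Definition abelian_group H := forall g h, H g -> H h -> g *m h = h *m g.

Definition derived_subgroup H : set 'M[C]_N :=
  [set x | forall D, is_subgroup D ->
     (forall g h, H g -> H h -> D (g *m h *m invmx g *m invmx h)) -> D x].

Definition solvable_group H :=
  exists k : nat, iter k derived_subgroup H `<=` [set 1%:M].

Definition connected_solvable_subgroup (B G : set 'M[C]_N) :=
  [/\ closed_subgroup B G, zariski_connected B & solvable_group B].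

Definition borel_subgroup (B G : set 'M[C]_N) :=
  connected_solvable_subgroup B G /\
  forall B', connected_solvable_subgroup B' G -> B `<=` B' -> B' = B.

Definition parabolic_subgroup P G :=
  closed_subgroup P G /\ exists2 B, borel_subgroup B G & B `<=` P.

Definition maximal_parabolic_subgroup P G :=
  [/\ parabolic_subgroup P G, P <> G &
      forall P', parabolic_subgroup P' G -> P `<=` P' -> P' = P \/ P' = G].

(* The union of all connected closed normal unipotent subgroups, which is the *)
(* largest such subgroup.                                                     *)
Definition unipotent_radical G : set 'M[C]_N :=
  [set g | exists U, [/\ closed_subgroup U G, zariski_connected U,
     normal_in U G, (forall u, U u -> unipotent_mx u) & U g]].

Definition connected_reductive G :=
  [/\ closed_subgroup G GL, zariski_connected G
    & unipotent_radical G = [set 1%:M]].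

Definition Lie G : set 'M[C]_N :=
  [set x | forall f, (forall g, G g -> eval_regular f g = 0) ->
     diff_regular f x = 0].

Definition lie_ideal (I p : set 'M[C]_N) :=
  [/\ I `<=` p, I 0, forall (a : C) x y, I x -> I y -> I (a *: x + y)
    & forall x y, p x -> I y -> I (x *m y - y *m x)].

(* The largest ideal of p consisting of nilpotent elements. For a parabolic   *)
(* subalgebra this is the nilradical in the sense of parabolic subalgebras of *)
(* a reductive Lie algebra (the Lie algebra of the unipotent radical), which  *)
(* does not contain the center of the reductive Lie algebra.                  *)
Definition nilradical (p : set 'M[C]_N) : set 'M[C]_N :=
  [set x | exists I, [/\ lie_ideal I p, (forall y, I y -> nilpotent_mx y)
     & I x]].

Definition conjugates G (p : set 'M[C]_N) : set (set 'M[C]_N) :=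
  [set p1 | exists2 g, G g & p1 = [set g *m x *m invmx g | x in p]].

(* A morphism G -> GL_N of varieties is given by regular functions.           *)
Definition regular_map : Type := 'M[regular_fun]_N.

Definition eval_map (theta : regular_map) g : 'M[C]_N :=
  map_mx (fun f => eval_regular f g) theta.

(* On Lie G this does not depend on the regular functions that represent the  *)
(* restriction of theta to G.                                                 *)
Definition differential (theta : regular_map) x : 'M[C]_N :=
  map_mx (fun f => diff_regular f x) theta.

Definition involution G (theta : regular_map) :=
  [/\ forall g, G g -> G (eval_map theta g),
      forall g h, G g -> G h ->
        eval_map theta (g *m h) = eval_map theta g *m eval_map theta h
    & forall g, G g -> eval_map theta (eval_map theta g) = g].

Definition fixed_subgroup G (theta : regular_map) : set 'M[C]_N :=
  [set g | G g /\ eval_map theta g = g].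

(* y = y^theta + y^(-theta), the decomposition along Lie K + s.               *)
Definition theta_part (theta : regular_map) y : 'M[C]_N :=
  2^-1 *: (y + differential theta y).

Definition antitheta_part (theta : regular_map) y : 'M[C]_N :=
  2^-1 *: (y - differential theta y).

Definition antifixed G (theta : regular_map) : set 'M[C]_N :=
  [set x | Lie G x /\ differential theta x = - x].

Definition nilpotent_antifixed G (theta : regular_map) : set 'M[C]_N :=
  [set x | antifixed G theta x /\ nilpotent_mx x].

Definition conormal_variety G (theta : regular_map) P Q :
    set ('M[C]_N * set 'M[C]_N * set 'M[C]_N) :=
  [set t | let: (y, q1, p1) := t in
     [/\ Lie G y, conjugates (fixed_subgroup G theta) (Lie Q) q1,
         conjugates G (Lie P) p1, nilradical p1 y
       & nilradical q1 (theta_part theta y)]].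

Definition phi_s (theta : regular_map)
    (t : 'M[C]_N * set 'M[C]_N * set 'M[C]_N) : 'M[C]_N :=
  antitheta_part theta t.1.1.

(* A nondegenerate alternating form; its existence forces N to be even.       *)
Definition nondegenerate_alternating (B : 'M[C]_N) := B^T = - B /\ B \in unitmx.

Definition nondegenerate_symmetric (B : 'M[C]_N) := B^T = B /\ B \in unitmx.

Definition Sp (B : 'M[C]_N) : set 'M[C]_N :=
  [set g | g \in unitmx /\ g *m B *m g^T = B].

Definition SO (B : 'M[C]_N) : set 'M[C]_N :=
  [set g | g *m B *m g^T = B /\ \det g = 1].

Definition classical_group G :=
  [\/ G = GL, exists2 B, nondegenerate_alternating B & G = Sp B
    | exists2 B, nondegenerate_symmetric B & G = SO B].

Definition isotropic (B W : 'M[C]_N) := W *m B *m W^T = 0.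

Definition lagrangian (B W : 'M[C]_N) := isotropic B W /\ (2 * \rank W)%N = N.

Definition maximal_isotropic (B W : 'M[C]_N) :=
  isotropic B W /\
  forall W', isotropic B W' -> (W <= W')%MS -> (W' <= W)%MS.

Definition is_line W := \rank W = 1%N.

Definition stabilizer G W : set 'M[C]_N := [set g | G g /\ stablemx W g].

End LinearAlgebraicGroups.

Arguments GL : clear implicits.

(* Main.v *)
(* For y in n(P), the nilradical of Lie P, put z = theta(y); then y + z is       *)
(* nilpotent because y^theta is, and one has to show that y - z is. In all the   *)
(* cases of the statement every element x of n(P), and of n(theta(P)), satisfies *)
(* x^2 = 0 or, in the orthogonal case, x = e ^ u with e isotropic and orthogonal *)
(* to u. If y^2 = z^2 = 0 then (y - z)^2 = -(y + z)^2. In the other cases the    *)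
(* vanishing of the traces of (y + z)^2 and (y + z)^4 kills all long enough      *)
(* words in y and z.                                                             *)
(* The shape of n(P) is invariant under theta because it is forced by the        *)
(* commutators in n(P): these vanish, or span at most a line in Sp_2n and SO_5.  *)
(* To exploit this, let K be the null space of n(P). Unipotent subgroups of G    *)
(* that are connected and normalized by P lie in every Borel subgroup B of P     *)
(* (the closure of B U is connected and solvable), so n(P) contains the          *)
(* subalgebras defined by flags of P-stable subspaces. Applied to K meet K^perp  *)
(* this makes K isotropic, and the commutator condition bounds the dimension     *)
(* of K.                                                                         *)

Require Import Defs.
From mathcomp Require Import all_boot all_order all_algebra fingroup perm.
From mathcomp Require Import classical_sets boolp reals complex mpoly.
From mathcomp Require Import ring.

Set Implicit Arguments.
Unset Strict Implicit.
Unset Printing Implicit Defensive.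

Import Order.TTheory GRing.Theory Num.Theory.
Local Open Scope ring_scope.
Local Open Scope classical_set_scope.

(** Let y lie in the nilradical of a conjugate of Lie P, and let z = dtheta(y). In the conormal
    variety y + z = 2 y^theta is nilpotent, and [phi_s] returns (y - z) / 2; so nilpotency has to be
    carried from y + z to y - z. [conormal_nilpotent] isolates what is needed: a
    conjugation-invariant property [good], shared by the nilradical n of Lie P and by that of Lie
    theta(P), such that for good x, z the nilpotency of x + z implies that of x - z. The second
    nilradical is where dtheta sends the first ([dtheta_nilradical]).

    For GL and Sp the property is x^2 = 0, and (x - z)^2 = - (x + z)^2. For SO it also admits x = e
    ^ u with e isotropic and orthogonal to u. Such x obey sandwich identities, x M x being a
    multiple tr(x M) / 2 of x for skew M; the vanishing traces of (x + z)^2 and (x + z)^4 then kill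
    so many words in x and z that all words of length 7 vanish ([good_difference], [nil_sum7]).

    The shape of n must be deduced from something theta transports. This is the commutator
    structure: elements of n commute, or their commutators lie on one line ([comm_line_theta],
    [abelian_theta]). [GL_nilradical] and [form_nilradical] recover the shape from it. The key
    object is the common kernel K of n. Each P-stable flag gives explicit elements of n
    ([chain_algebra_nilradical]), because the unipotent group of the flag lies in every Borel
    subgroup contained in P ([borel_contains]). Testing K against these elements makes it isotropic,
    and the relation [k ^ v, k' ^ v'] = - eps (v, v') k ^ k' ([comm_wedge]) bounds it.

    It remains to find the commutators for the given P: [maximal_nilradical_abelian],
    [line_comm_line], [lagrangian_nilradical], [plane_comm_line], and [nilradical_abelian] when the
    unipotent radical is abelian. Derivatives are algebraic throughout; the Cayley transform
    supplies curves in classical groups, and the exponential shows that dtheta preserves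
    nilpotency. *)

(** * Algebraic derivatives at 0 of functions of one variable *)

Section Germs.

Variable C : numFieldType.
Implicit Types (f g : C -> C) (p q : {poly C}).

Let hE := (hornerXn, hornerD, hornerN, hornerZ, hornerM, hornerX, hornerC).

(** The product p q vanishes everywhere, and in characteristic 0 the points 0, 1, 2, ... are too
    many roots for a nonzero polynomial. *)
Lemma poly_vanish q p :
  q != 0 -> (forall t, q.[t] != 0 -> p.[t] = 0) -> p = 0.
Proof.
move=> q0 qp; have pq0 : forall t, (p * q).[t] = 0.
  move=> t; rewrite hornerM; case: (eqVneq q.[t] 0) => [->|/qp ->].
    by rewrite mulr0.
  by rewrite mul0r.
have /eqP : p * q = 0.
  apply/eqP/negPn/negP => pq_neq0.
  have := @max_poly_roots _ (p * q) (mkseq (fun i => i%:R) (size (p * q))) pq_neq0.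
  rewrite size_mkseq ltnn => /(_ _ _)/negP; case => //.
    by apply/allP => t _; rewrite rootE pq0.
  by rewrite mkseq_uniq// => i j /eqP; rewrite eqr_nat => /eqP.
by rewrite mulf_eq0 (negPf q0) orbF => /eqP.
Qed.

Lemma poly_neq0_at p t : p.[t] != 0 -> p != 0.
Proof. by apply: contraNneq => ->; rewrite horner0. Qed.

(* [f] agrees near 0 with a rational function whose value and derivative at 0 *)
(* are [v] and [d].                                                           *)
Definition germ f (v d : C) := exists q p,
  q.[0] != 0 /\ forall t, q.[t] != 0 -> q.[t] * (f t - v - d * t) = t ^+ 2 * p.[t].

(** Subtracting two presentations gives a polynomial identity off finitely many points, hence
    everywhere; its coefficients of degree 0 and 1 compare values and slopes. Agreement of f and g
    off the zeros of r suffices. *)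
Lemma germ_uniq f g v d w e r : r.[0] != 0 ->
  (forall t, r.[t] != 0 -> f t = g t) ->
  germ f v d -> germ g w e -> v = w /\ d = e.
Proof.
move=> r0 fg [q1 [p1 [q10 H1]]] [q2 [p2 [q20 H2]]].
have E : (v - w)%:P * (q1 * q2) + 'X * ((d - e)%:P * (q1 * q2) +
    'X * (p1 * q2 - p2 * q1)) = 0.
  apply: (@poly_vanish (r * (q1 * q2))).
    by apply: (@poly_neq0_at _ 0); rewrite !hornerM !mulf_neq0.
  move=> t; rewrite !hornerM !mulf_eq0 !negb_or => /and3P[rt /H1 + /H2].
  rewrite !hE fg// => h1 h2.
  transitivity ((v - w) * (q1.[t] * q2.[t]) + t * ((d - e) * (q1.[t] * q2.[t]))
    + (t ^+ 2 * p1.[t] * q2.[t] - t ^+ 2 * p2.[t] * q1.[t])); first by ring.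
  by rewrite -h1 -h2; ring.
have vw : v = w.
  apply/subr0_eq/eqP; move/(congr1 (fun p => p.[0])): E; rewrite !hE.
  by rewrite mul0r addr0 => /eqP; rewrite !mulf_eq0 (negPf q10) (negPf q20) !orbF.
split=> //; move: E; rewrite vw subrr mul0r add0r => /eqP.
rewrite mulf_eq0 polyX_eq0 /= => /eqP /(congr1 (fun p => p.[0])); rewrite !hE.
rewrite mul0r addr0 => /eqP; rewrite !mulf_eq0 (negPf q10) (negPf q20) !orbF.
by rewrite subr_eq0 => /eqP.
Qed.

Lemma germ_ext f g v d r : r.[0] != 0 ->
  (forall t, r.[t] != 0 -> f t = g t) -> germ f v d -> germ g v d.
Proof.
move=> r0 fg [q [p [q0 H]]]; exists (q * r), (p * r); split.
  by rewrite hornerM mulf_neq0.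
move=> t; rewrite hornerM mulf_eq0 negb_or => /andP[qt rt].
by rewrite -fg// mulrAC H// hornerM mulrA.
Qed.

Lemma germ_lin v d : germ (fun t => v + d * t) v d.
Proof. by exists 1, 0; rewrite !hE oner_neq0; split=> // t _; rewrite !hE; ring. Qed.

Lemma germ_cst v : germ (fun=> v) v 0.
Proof. by exists 1, 0; rewrite !hE oner_neq0; split=> // t _; rewrite !hE; ring. Qed.

Lemma germD f g v d w e : germ f v d -> germ g w e ->
  germ (fun t => f t + g t) (v + w) (d + e).
Proof.
move=> [q1 [p1 [q10 H1]]] [q2 [p2 [q20 H2]]].
exists (q1 * q2), (p1 * q2 + p2 * q1); split; first by rewrite hornerM mulf_neq0.
move=> t; rewrite hornerM mulf_eq0 negb_or => /andP[/H1 h1 /H2 h2].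
rewrite !hE.
transitivity (t ^+ 2 * p1.[t] * q2.[t] + t ^+ 2 * p2.[t] * q1.[t]); last by ring.
by rewrite -h1 -h2; ring.
Qed.

Lemma germM f g v d w e : germ f v d -> germ g w e ->
  germ (fun t => f t * g t) (v * w) (d * w + v * e).
Proof.
move=> [q1 [p1 [q10 H1]]] [q2 [p2 [q20 H2]]].
exists (q1 * q2), (p1 * (w%:P + e *: 'X) * q2 + p2 * (v%:P + d *: 'X) * q1
   + 'X^2 * p1 * p2 + (d * e) *: (q1 * q2)).
split; first by rewrite hornerM mulf_neq0.
move=> t; rewrite hornerM mulf_eq0 negb_or => /andP[/H1 h1 /H2 h2].
rewrite !hE.
transitivity ((q1.[t] * (f t - v - d * t) + q1.[t] * (v + d * t)) *
   (q2.[t] * (g t - w - e * t) + q2.[t] * (w + e * t))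
   - q1.[t] * q2.[t] * (v * w + (d * w + v * e) * t)); first by ring.
by rewrite h1 h2; ring.
Qed.

Lemma germ_sum I (s : seq I) (f : I -> C -> C) v d :
  (forall i, germ (f i) (v i) (d i)) ->
  germ (fun t => \sum_(i <- s) f i t) (\sum_(i <- s) v i) (\sum_(i <- s) d i).
Proof.
move=> H; elim: s => [|i s IH].
  by under [X in germ X]funext do rewrite big_nil; rewrite !big_nil; apply: germ_cst.
under [X in germ X]funext do rewrite big_cons.
by rewrite !big_cons; apply: germD.
Qed.

Lemma germV f v d : v != 0 -> germ f v d -> germ (fun t => (f t)^-1) v^-1 (- d / v ^+ 2).
Proof.
move=> v0 [q [p [q0 H]]].
(* [num] equals q f wherever q is nonzero, so a common denominator containing it also guarantees f t
   != 0. *)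
pose num := q * (v%:P + d *: 'X) + 'X^2 * p.
exists (v ^+ 2 *: (q * num)), (q * (d ^+ 2 *: q + (d%:P * 'X - v%:P) * p)); split.
  rewrite /num !hE; rewrite expr0n/= mul0r mulr0 !addr0 !mulf_neq0// expf_neq0.
move=> t; rewrite !hornerZ !hornerM => H0.
have qt : q.[t] != 0 by apply: contraNneq H0 => ->; rewrite !(mulr0, mul0r).
have numE : num.[t] = q.[t] * f t by rewrite !hE -H//; ring.
have ft : f t != 0 by apply: contraNneq H0 => ft0; rewrite numE ft0 !mulr0.
rewrite numE !hE.
have -> : v ^+ 2 * (q.[t] * (q.[t] * f t)) * ((f t)^-1 - v^-1 - - d / v ^+ 2 * t) =
   q.[t] * (q.[t] * v^+2 - q.[t] * v * f t + d * t * (q.[t] * f t)).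
  by field; rewrite ft v0.
have -> : q.[t] * f t = q.[t] * (v + d * t) + t ^+ 2 * p.[t] by rewrite -H//; ring.
have -> : q.[t] * v * f t = v * (q.[t] * (v + d * t) + t ^+ 2 * p.[t]).
  by rewrite -H//; ring.
by ring.
Qed.

End Germs.

(** * Regular functions and the Zariski topology on GL_N *)

Section RegularFunctions.

Variables (C : numClosedFieldType) (N : nat).
Implicit Types (g h x : 'M[C]_N) (A B G H Z : set 'M[C]_N).

(** Applied both to regular functions on GL_N and to polynomial functions of t, so that closure
    under determinants, matrix products and substitution is proved once. *)
Definition subring_of_functions T (S : set (T -> C)) :=
  [/\ forall c, S (fun=> c), forall f1 f2, S f1 -> S f2 -> S (fun t => f1 t + f2 t)
    & forall f1 f2, S f1 -> S f2 -> S (fun t => f1 t * f2 t)].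

Lemma subring_sum T (S : set (T -> C)) I (s : seq I) (P : pred I) (f : I -> T -> C) :
  subring_of_functions S -> (forall i, S (f i)) ->
  S (fun t => \sum_(i <- s | P i) f i t).
Proof.
move=> [S0 SD _] Sf; elim: s => [|i s IH].
  by under [X in S X]funext do rewrite big_nil.
by under [X in S X]funext do rewrite big_cons; case: (P i) => //; apply: (SD).
Qed.

Lemma subring_prod T (S : set (T -> C)) I (s : seq I) (P : pred I) (f : I -> T -> C) :
  subring_of_functions S -> (forall i, S (f i)) ->
  S (fun t => \prod_(i <- s | P i) f i t).
Proof.
move=> [S0 _ SM] Sf; elim: s => [|i s IH].
  by under [X in S X]funext do rewrite big_nil.
by under [X in S X]funext do rewrite big_cons; case: (P i) => //; apply: (SM).
Qed.

Lemma subring_meval T (S : set (T -> C)) n (f : {mpoly C[n]}) (v : T -> 'I_n -> C) :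
  subring_of_functions S -> (forall i, S (fun t => v t i)) -> S (fun t => f.@[v t]).
Proof.
move=> SS Sv; under [X in S X]funext do rewrite mevalE.
have [S0 _ SM] := SS.
apply: subring_sum => // m; apply: (SM) => //.
apply: subring_prod => // i; elim: (m i) => [|k IH].
  by under [X in S X]funext do rewrite expr0.
under [X in S X]funext do rewrite exprS.
exact: SM.
Qed.

Lemma subring_det T (S : set (T -> C)) n (F : T -> 'M[C]_n) :
  subring_of_functions S -> (forall i j, S (fun t => F t i j)) ->
  S (fun t => \det (F t)).
Proof.
move=> SS SF; have [S0 SD SM] := SS.
by apply: subring_sum => // s; apply: (SM) => //; apply: subring_prod.
Qed.

Lemma subring_mul T (S : set (T -> C)) m n p (E : T -> 'M[C]_(m, n))
    (F : T -> 'M[C]_(n, p)) : subring_of_functions S ->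
  (forall i j, S (fun t => E t i j)) -> (forall i j, S (fun t => F t i j)) ->
  forall i j, S (fun t => (E t *m F t) i j).
Proof.
move=> SS SE SF i j; have [_ _ SM] := SS.
by under [X in S X]funext do rewrite mxE; apply: subring_sum => // k; apply: (SM).
Qed.

Lemma subring_regular T (S : set (T -> C)) (f : regular_fun C N) (F : T -> 'M[C]_N)
    (D : T -> C) :
  subring_of_functions S -> (forall i j, S (fun t => F t i j)) -> S D ->
  S (fun t => f.@[row_mx (mxvec (F t)) (D t)%:M 0]).
Proof.
move=> SS SF SD; apply: subring_meval => // i.
case: (split_ordP i) => j ->{i}; last first.
  by under [X in S X]funext do rewrite row_mxEr ord1 mxE eqxx mulr1n.
case/mxvec_indexP: j => i j.
by under [X in S X]funext do rewrite row_mxEl mxvecE.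
Qed.

Definition regular_function (f : 'M[C]_N -> C) :=
  exists p : regular_fun C N, forall g, GL C N g -> eval_regular p g = f g.

Lemma regular_subring : subring_of_functions [set f | regular_function f].
Proof.
split=> /= [c|f g [p fp] [q gq]|f g [p fp] [q gq]].
- by exists c%:MP => g _; rewrite /eval_regular mevalC.
- by exists (p + q) => h Gh; rewrite -fp// -gq// /eval_regular mevalD.
- by exists (p * q) => h Gh; rewrite -fp// -gq// /eval_regular mevalM.
Qed.

Lemma regular_ext f1 f2 : (forall g, GL C N g -> f1 g = f2 g) ->
  regular_function f1 -> regular_function f2.
Proof. by move=> f12 [p fp]; exists p => g Gg; rewrite fp ?f12. Qed.

Lemma regular_entry i j : regular_function (fun g => g i j).
Proof.
exists 'X_(lshift 1 (mxvec_index i j)) => g _.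
by rewrite /eval_regular mevalXU row_mxEl mxvecE.
Qed.

Lemma regular_detV : regular_function (fun g => (\det g)^-1).
Proof.
exists 'X_(rshift (N * N) ord0) => g _.
by rewrite /eval_regular mevalXU row_mxEr mxE eqxx mulr1n.
Qed.

Lemma regular_eval p : regular_function (eval_regular p).
Proof. by exists p. Qed.

Definition regular_mx (F : 'M[C]_N -> 'M[C]_N) :=
  forall i j, regular_function (fun g => F g i j).

Lemma regular_mx_id : regular_mx id.
Proof. by move=> i j; apply: regular_entry. Qed.

Lemma regular_mx_cst g : regular_mx (fun=> g).
Proof. by move=> i j; have [R0 _ _] := regular_subring; apply: (R0). Qed.

Lemma regular_mxM E F : regular_mx E -> regular_mx F -> regular_mx (fun g => E g *m F g).
Proof. by move=> RE RF; apply: subring_mul => //; apply: regular_subring. Qed.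

Lemma regular_mxV : regular_mx (@invmx C N).
Proof.
move=> i j; have [R0 _ RM] := regular_subring.
apply: (@regular_ext (fun g => (\det g)^-1 * \adj g i j)).
  by move=> g Gg; rewrite /invmx [g \in unitmx]Gg !mxE.
apply: (RM); first exact: regular_detV.
under [X in [set f | _] X]funext do rewrite mxE.
apply: (RM); first exact: R0.
by apply: (subring_det regular_subring) => k l;
  under [X in [set f | _] X]funext do rewrite !mxE; apply: regular_entry.
Qed.

(** A regular function may involve 1/det, so a regular expression D for the inverse of det F is
    supplied separately; it has to be correct only at the points where the composite is
    evaluated. *)
Lemma regular_comp f F D : regular_function f -> regular_mx F -> regular_function D ->
  exists2 h, regular_function h &
    forall g, GL C N (F g) -> D g = (\det (F g))^-1 -> h g = f (F g).
Proof.
move=> [p fp] RF RD.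
exists (fun g => p.@[row_mx (mxvec (F g)) (D g)%:M 0]).
  by apply: (subring_regular (S := [set f | regular_function f])) => //; apply: regular_subring.
by move=> g GF ->; rewrite -fp.
Qed.

Lemma zariski_closed_zeros (S : set ('M[C]_N -> C)) :
  (forall f, S f -> regular_function f) ->
  zariski_closed [set g | GL C N g /\ forall f, S f -> f g = 0].
Proof.
move=> SR; exists [set p | exists2 f, S f & forall g, GL C N g -> eval_regular p g = f g].
apply/seteqP; split=> g /= [Gg H]; split=> //.
  by move=> p [f /H + E]; rewrite E.
by move=> f Sf; have [p pf] := SR _ Sf; rewrite -pf//; apply: H; exists f.
Qed.

Lemma zariski_closedP Z : zariski_closed Z -> Z `<=` GL C N /\
  forall g, GL C N g ->
    (forall f, regular_function f -> (forall h, Z h -> f h = 0) -> f g = 0) -> Z g.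
Proof.
move=> [I ->]; split=> [g []//|g Gg H]; split=> // p Ip.
by apply: H; [apply: regular_eval|move=> h [_]; apply].
Qed.

Lemma zariski_closedT : zariski_closed (GL C N).
Proof. by exists set0; apply/seteqP; split=> [g Gg|g []]. Qed.

Lemma zariski_closedI A B : zariski_closed A -> zariski_closed B -> zariski_closed (A `&` B).
Proof.
move=> [I ->] [J ->]; exists (I `|` J); apply/seteqP; split=> g /=.
  by move=> [[Gg HI] [_ HJ]]; split=> // f [/HI|/HJ].
by move=> [Gg H]; split; split=> // f If; apply: H; [left|right].
Qed.

(** F is only controlled on G. The equations of the preimage are the regular functions that agree on
    G with the pullback of a function vanishing on Z. *)
Lemma zariski_closed_preimage G F D Z : zariski_closed G -> regular_mx F ->
  regular_function D -> (forall g, G g -> GL C N (F g) /\ D g = (\det (F g))^-1) ->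
  zariski_closed Z -> zariski_closed [set g | G g /\ Z (F g)].
Proof.
move=> cG RF RD GF cZ; have [GGL GP] := zariski_closedP cG.
have [ZGL ZP] := zariski_closedP cZ.
rewrite (_ : mkset _ = G `&` [set g | GL C N g /\
   forall f1, (regular_function f1 /\ exists f2, [/\ regular_function f2,
     (forall z, Z z -> f2 z = 0) & forall g, G g -> f1 g = f2 (F g)]) -> f1 g = 0]).
  apply: zariski_closedI => //.
  by apply: (zariski_closed_zeros (S := [set f1 | regular_function f1 /\
    exists f2, [/\ regular_function f2, (forall z, Z z -> f2 z = 0) &
    forall g, G g -> f1 g = f2 (F g)]])) => f [].
apply/seteqP; split=> g /= [Gg H]; split=> //.
  by split; [apply: GGL|move=> h [_ [f [_ fZ ->//]]]; apply: fZ].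
have [GFg DE] := GF _ Gg; apply: ZP => // f Rf fZ.
have [h Rh hE] := regular_comp Rf RF RD.
rewrite -hE//; apply: (H.2); split=> //; exists f; split=> // k Gk.
by have [? ?] := GF _ Gk; rewrite hE.
Qed.

Lemma connected_image G F D Z : zariski_closed G -> regular_mx F ->
  regular_function D -> (forall g, G g -> GL C N (F g) /\ D g = (\det (F g))^-1) ->
  Z `<=` G -> zariski_connected Z -> zariski_connected (F @` Z).
Proof.
move=> cG RF RD GF ZG conZ A B cA cB sAB dAB.
have cp W := zariski_closed_preimage cG RF RD GF (Z := W).
case: (conZ _ _ (cp A cA) (cp B cB)).
- by move=> z Zz; case: (sAB (F z)) => [|Az|Bz]; [by exists z|left|right]; split=> //; apply: ZG.
- apply/seteqP; split=> // z [[Zz [_ Az]] [_ Bz]].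
  suff : set0 (F z) by [].
  by rewrite -dAB; split=> //; split=> //; exists z.
- by move=> H; left=> _ [z Zz <-]; case: (H _ Zz).
- by move=> H; right=> _ [z Zz <-]; case: (H _ Zz).
Qed.

Definition zariski_closure Z : set 'M[C]_N :=
  [set g | GL C N g /\
     forall f, regular_function f /\ (forall z, Z z -> f z = 0) -> f g = 0].

Lemma closure_closed Z : zariski_closed (zariski_closure Z).
Proof.
by apply: (zariski_closed_zeros
  (S := [set f | regular_function f /\ forall z, Z z -> f z = 0])) => f [].
Qed.

Lemma sub_closure Z : Z `<=` GL C N -> Z `<=` zariski_closure Z.
Proof. by move=> ZGL z Zz; split; [apply: ZGL|move=> f [_]; apply]. Qed.

Lemma closure_min Z A : zariski_closed A -> Z `<=` A -> zariski_closure Z `<=` A.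
Proof.
move=> /zariski_closedP[AGL AP] ZA g [Gg H]; apply: AP => // f Rf fA.
by apply: H; split=> // z /ZA/fA.
Qed.

Lemma closure_connected Z : Z `<=` GL C N -> zariski_connected Z ->
  zariski_connected (zariski_closure Z).
Proof.
move=> ZGL conZ A B cA cB sAB dAB.
have sZ := sub_closure ZGL.
case: (conZ A B cA cB).
- exact: subset_trans sAB.
- by apply/seteqP; split=> // z [[/sZ Zz Az] Bz]; rewrite -dAB.
- by move=> H; left; apply: closure_min.
- by move=> H; right; apply: closure_min.
Qed.

Lemma GL_mul g h : GL C N g -> GL C N h -> GL C N (g *m h).
Proof. by move=> Gg Gh; rewrite /GL /= unitmx_mul; apply/andP. Qed.

Lemma GL_inv g : GL C N g -> GL C N (invmx g).
Proof. by move=> Gg; rewrite /GL /= unitmx_inv. Qed.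

Lemma preimage_mul_closed a b Z : GL C N a -> GL C N b -> zariski_closed Z ->
  zariski_closed [set g | GL C N g /\ Z (a *m g *m b)].
Proof.
move=> Ga Gb; have [R0 _ RM] := regular_subring.
apply: (zariski_closed_preimage (D := fun g => (\det a)^-1 * (\det g)^-1 * (\det b)^-1)).
- exact: zariski_closedT.
- by do !apply: regular_mxM; rewrite ?[GRing.one _]/1; try exact: regular_mx_cst; exact: regular_mx_id.
- by apply: (RM); [apply: (RM)|]; [apply: (R0)|apply: regular_detV|apply: (R0)].
- by move=> g Gg; split; [do 2?apply: GL_mul|rewrite !det_mulmx !invfM].
Qed.

Lemma preimage_inv_closed Z : zariski_closed Z ->
  zariski_closed [set g | GL C N g /\ Z (invmx g)].
Proof.
apply: (zariski_closed_preimage (D := fun g => \det g)).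
- exact: zariski_closedT.
- exact: regular_mxV.
- by apply: (subring_det regular_subring) => i j; apply: regular_entry.
- by move=> g Gg; split; [apply: GL_inv|rewrite det_inv invrK].
Qed.

Lemma preimage_conj_closed a b c Z : GL C N a -> GL C N b -> GL C N c ->
  zariski_closed Z ->
  zariski_closed [set g | GL C N g /\ Z (b *m (g *m a *m invmx g) *m c)].
Proof.
move=> Ga Gb Gc; have [R0 _ RM] := regular_subring.
apply: (zariski_closed_preimage (D := fun g => (\det b * \det a * \det c)^-1)).
- exact: zariski_closedT.
- apply: regular_mxM; last exact: regular_mx_cst.
  apply: regular_mxM; first exact: regular_mx_cst.
  apply: regular_mxM; last exact: regular_mxV.
  by apply: regular_mxM; [apply: regular_mx_id|apply: regular_mx_cst].
- exact: (R0).
- move=> g Gg; split; first by do 4?apply: GL_mul => //; apply: GL_inv.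
  have dg : \det g != 0 by rewrite -unitfE; move: Gg; rewrite /GL /= unitmxE.
  by rewrite !det_mulmx det_inv (mulrC (\det g)) mulfK.
Qed.

End RegularFunctions.

(** * Closures, solvability and connectedness; subgroups normalized by a Borel subgroup *)

Section Subgroups.

Variables (C : numClosedFieldType) (N : nat).
Implicit Types (g h x : 'M[C]_N) (A B D G H U Z : set 'M[C]_N).

Lemma invmxM g h : GL C N g -> GL C N h -> invmx (g *m h) = invmx h *m invmx g.
Proof.
move=> Gg Gh; have Ggh := GL_mul Gg Gh.
by rewrite -[RHS]mulmx1 -(mulmxV Ggh) !mulmxA mulmxKV ?mulVmx ?mul1mx //.
Qed.

Lemma GL1 : GL C N 1%:M.
Proof. exact: unitmx1. Qed.

Lemma GL_subgroup : is_subgroup (GL C N).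
Proof. by split=> //; [apply: GL1|apply: GL_mul|apply: GL_inv]. Qed.

(** Density in two steps: for h in H, the g with g h in the closure form a closed set containing H;
    then g is fixed in the closure and h varies. *)
Lemma closure_subgroup H : is_subgroup H -> is_subgroup (zariski_closure H).
Proof.
move=> [HGL H1 HM HV]; have sH := sub_closure HGL.
have cGL : zariski_closure H `<=` GL C N by move=> g [].
have cH := closure_closed H.
have cMr g h : zariski_closure H g -> H h -> zariski_closure H (g *m h).
  move=> Hg Hh; have := closure_min (preimage_mul_closed GL1 (HGL _ Hh) cH) _ Hg.
  rewrite /= mul1mx; case=> // k Hk; split; first exact: HGL.
  by rewrite mul1mx; apply/sH/HM.
split=> //; first exact: sH.
- move=> g h Hg Hh; have := closure_min (preimage_mul_closed (cGL _ Hg) GL1 cH) _ Hh.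
  rewrite /= mulmx1; case=> // k Hk; split; first exact: HGL.
  by rewrite mulmx1; apply: cMr.
- move=> g Hg; have := closure_min (preimage_inv_closed cH) _ Hg.
  by case=> // k Hk; split; [apply: HGL|apply/sH/HV].
Qed.

Lemma derived_comm H g h : H g -> H h ->
  derived_subgroup H (g *m h *m invmx g *m invmx h).
Proof. by move=> Hg Hh D _; apply. Qed.

Lemma derived_min H D : is_subgroup D ->
  (forall g h, H g -> H h -> D (g *m h *m invmx g *m invmx h)) ->
  derived_subgroup H `<=` D.
Proof. by move=> sD HD x; apply. Qed.

Lemma subgroup_comm H g h : is_subgroup H -> H g -> H h ->
  H (g *m h *m invmx g *m invmx h).
Proof. by move=> [_ _ HM HV] Hg Hh; apply: (HM); [apply: (HM); [apply: (HM)|]|]; do ?exact: HV. Qed.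

Lemma derived_sub H : is_subgroup H -> derived_subgroup H `<=` H.
Proof. by move=> sH; apply: derived_min => // g h; apply: subgroup_comm. Qed.

Lemma derived_is_subgroup H : is_subgroup H -> is_subgroup (derived_subgroup H).
Proof.
move=> sH; have [HGL _ _ _] := sH.
split=> [|D [] //|g h Dg Dh D sD HD|g Dg D sD HD].
- exact: subset_trans (derived_sub sH) HGL.
- by have [_ _ + _] := sD; apply; [apply: Dg|apply: Dh].
- by have [_ _ _ +] := sD; apply; apply: Dg.
Qed.

Lemma derived_mono A B : A `<=` B -> derived_subgroup A `<=` derived_subgroup B.
Proof. by move=> AB x Ax D sD BD; apply: Ax => // g h /AB + /AB; apply: BD. Qed.

Lemma iter_derived_subgroup k H : is_subgroup H ->
  is_subgroup (iter k (@derived_subgroup C N) H).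
Proof. by move=> sH; elim: k => //= k; apply: derived_is_subgroup. Qed.

Lemma iter_derived_sub k H : is_subgroup H ->
  iter k (@derived_subgroup C N) H `<=` H.
Proof.
move=> sH; elim: k => //= k IH; apply: subset_trans IH.
exact: derived_sub (iter_derived_subgroup _ sH).
Qed.

Lemma iter_derived_mono k A B : A `<=` B ->
  iter k (@derived_subgroup C N) A `<=` iter k (@derived_subgroup C N) B.
Proof. by move=> AB; elim: k => //= k; apply: derived_mono. Qed.

(** The same two-step density argument, applied in turn to each argument of the commutator. *)
Lemma closure_derived H : is_subgroup H ->
  derived_subgroup (zariski_closure H) `<=` zariski_closure (derived_subgroup H).
Proof.
move=> sH; have [HGL _ _ _] := sH; have sD := derived_is_subgroup sH.
have [DGL _ _ _] := sD; have cD := closure_closed (derived_subgroup H).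
apply: derived_min; first exact: closure_subgroup.
have comm1 g h : zariski_closure H g -> H h ->
    zariski_closure (derived_subgroup H) (g *m h *m invmx g *m invmx h).
  move=> Hg Hh.
  have := closure_min (preimage_conj_closed (HGL _ Hh) GL1 (GL_inv (HGL _ Hh)) cD) _ Hg.
  rewrite /= mul1mx; case=> // k Hk; split; first exact: HGL.
  by rewrite mul1mx; apply: sub_closure => //; apply: derived_comm.
move=> g h Hg Hh; have [GLg _] := Hg.
have := closure_min (preimage_conj_closed (GL_inv GLg) GLg GL1 cD) _ Hh.
rewrite /= mulmx1 !mulmxA.
case=> // k Hk; split; first exact: HGL.
by rewrite mulmx1 !mulmxA; apply: comm1.
Qed.

Lemma closure_solvable H : is_subgroup H -> solvable_group H ->
  solvable_group (zariski_closure H).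
Proof.
move=> sH [k Hk]; exists k.
have sHk n := iter_derived_subgroup n sH.
have : iter k (@derived_subgroup C N) (zariski_closure H) `<=`
       zariski_closure (iter k (@derived_subgroup C N) H).
  elim: {Hk} k => //= k IH.
  by apply: subset_trans (derived_mono IH) _; apply: closure_derived.
move=> /subset_trans; apply.
apply: subset_trans (closure_min (closure_closed [set 1%:M]) _) _.
  apply: subset_trans Hk _; apply: sub_closure => _ ->; exact: GL1.
move=> g [_ Hg] /=; apply/matrixP => i j; apply/eqP; rewrite -subr_eq0; apply/eqP.
have [R0 RD _] := regular_subring C N.
apply: (Hg (fun g => g i j - 1%:M i j)); split; last by move=> _ ->; rewrite subrr.
by apply: (RD (fun g => g i j)); [apply: regular_entry|apply: R0].
Qed.

Definition normalizes B U := forall b u, B b -> U u -> U (b *m u *m invmx b).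

Definition set_mul B U : set 'M[C]_N := [set g | exists b u, [/\ B b, U u & g = b *m u]].

Lemma set_mul_subgroup B U : is_subgroup B -> is_subgroup U -> normalizes B U ->
  is_subgroup (set_mul B U).
Proof.
move=> [BGL B1 BM BV] [UGL U1 UM UV] nBU; split.
- by move=> _ [b [u [/BGL Gb /UGL Gu ->]]]; apply: GL_mul.
- by exists 1%:M, 1%:M; rewrite mulmx1.
- move=> _ _ [b [u [Bb Uu ->]]] [b' [u' [Bb' Uu' ->]]].
  exists (b *m b'), (invmx b' *m u *m invmx (invmx b') *m u').
  rewrite invmxK; split; first exact: BM.
    by apply: (UM) => //; rewrite -{2}[b']invmxK; apply: nBU => //; apply: BV.
  by rewrite !mulmxA mulmxK//; apply: BGL.
- move=> _ [b [u [Bb Uu ->]]]; exists (invmx b), (b *m invmx u *m invmx b).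
  split; [exact: BV|by apply: nBU => //; apply: UV|].
  have [Gb Gu] := (BGL _ Bb, UGL _ Uu).
  by rewrite !mulmxA mulVmx ?mul1mx ?invmxM.
Qed.

(** Modulo U, a commutator of elements of Y U is a commutator of their Y-parts; the second witness
    collects the U-parts. *)
Lemma derived_set_mul Y U X : is_subgroup Y -> is_subgroup U -> normalizes Y U ->
  X `<=` set_mul Y U -> derived_subgroup X `<=` set_mul (derived_subgroup Y) U.
Proof.
move=> sY sU nYU XYU; have [YGL _ YM YV] := sY; have [UGL _ UM UV] := sU.
apply: derived_min.
  apply: set_mul_subgroup => //; first exact: derived_is_subgroup.
  by move=> b u /(derived_sub sY); apply: nYU.
move=> _ _ /XYU[b [u [Yb Uu ->]]] /XYU[b' [u' [Yb' Uu' ->]]].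
exists (b *m b' *m invmx b *m invmx b'),
  (b' *m (b *m (invmx b' *m u *m invmx (invmx b') *m u' *m invmx u) *m invmx b
    *m invmx u') *m invmx b').
have [[[Gb Gb'] Gu] Gu'] := (YGL _ Yb, YGL _ Yb', UGL _ Uu, UGL _ Uu').
split; first exact: derived_comm.
  apply: (nYU) => //; apply: (UM); last exact: UV.
  apply: (nYU) => //; apply: (UM); last exact: UV.
  by apply: (UM) => //; apply: nYU => //; apply: YV.
rewrite !invmxM// invmxK !mulmxA.
by rewrite (mulmxKV Gb') (mulmxKV Gb) (mulmxK Gb').
Qed.

(** k derived steps exhaust B and leave a subset of U, which l further steps exhaust. *)
Lemma set_mul_solvable B U : is_subgroup B -> is_subgroup U -> normalizes B U ->
  solvable_group B -> solvable_group U -> solvable_group (set_mul B U).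
Proof.
move=> sB sU nBU [k Bk] [l Ul]; exists (l + k)%N.
have [UGL U1 UM UV] := sU.
have kP : forall n, iter n (@derived_subgroup C N) (set_mul B U) `<=`
    set_mul (iter n (@derived_subgroup C N) B) U.
  elim=> // n IH; apply: derived_set_mul => //; first exact: iter_derived_subgroup.
  by move=> b u /(iter_derived_sub sB); apply: nBU.
rewrite iterD; apply: subset_trans Ul; apply: iter_derived_mono.
apply: subset_trans (kP k) _ => _ [b [u [/Bk -> Uu ->]]].
by rewrite mul1mx.
Qed.

(** B U is the union of the connected translates B u, each of which meets the connected set U in
    u. *)
Lemma set_mul_connected B U : B `<=` GL C N -> B 1%:M -> U `<=` GL C N ->
  zariski_connected B -> zariski_connected U -> zariski_connected (set_mul B U).
Proof.
move=> BGL B1 UGL conB conU A1 A2 cA1 cA2 sA dA.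
have UM : U `<=` set_mul B U by move=> u Uu; exists 1%:M, u; rewrite mul1mx.
have key E1 E2 : zariski_closed E1 -> zariski_closed E2 -> set_mul B U `<=` E1 `|` E2 ->
    set_mul B U `&` E1 `&` E2 = set0 -> U `<=` E1 -> set_mul B U `<=` E1.
  move=> cE1 cE2 sE dE UE _ [b [u [Bb Uu ->]]].
  have Gu := UGL _ Uu.
  have E0 g : set_mul B U g -> E1 g -> E2 g -> False.
    by move=> h1 h2 h3; suff : set0 g by []; rewrite -dE.
  case: (conB _ _ (preimage_mul_closed GL1 Gu cE1)
                  (preimage_mul_closed GL1 Gu cE2)).
  - move=> c Bc; case: (sE (c *m u)); first by exists c, u.
      by move=> h; left; split; [apply: BGL|rewrite mul1mx].
    by move=> h; right; split; [apply: BGL|rewrite mul1mx].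
  - apply/seteqP; split=> // c [[Bc [_ h1]] [_ h2]].
    by apply: (E0 (1%:M *m c *m u)) => //; exists c, u; rewrite mul1mx.
  - by move=> /(_ _ Bb)[_]; rewrite mul1mx.
  - move=> /(_ _ B1)[_]; rewrite !mul1mx => h2.
    by case: (E0 u) => //; [apply: UM|apply: UE].
case: (conU _ _ cA1 cA2); first exact: subset_trans sA.
- apply/seteqP; split=> // u [[/UM Mu h1] h2].
  by rewrite -dA.
- by move=> UA; left; apply: key dA UA.
- by move=> UA; right; apply: (key A2 A1) => //; [rewrite setUC|rewrite -setIA (setIC A2) setIA].
Qed.

(** The closure of B U is a closed connected solvable subgroup of G containing B, so it equals B by
    maximality. *)
Lemma borel_contains B U G : closed_subgroup G (GL C N) -> borel_subgroup B G ->
  is_subgroup U -> U `<=` G -> zariski_connected U -> solvable_group U ->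
  normalizes B U -> U `<=` B.
Proof.
move=> [sG cG _] [[[sB cB BG] conB solB] maxB] sU UG conU solU nBU.
have [GGL _ GM _] := sG; have [BGL B1 _ _] := sB; have [UGL U1 _ _] := sU.
have sM := set_mul_subgroup sB sU nBU; have [MGL _ _ _] := sM.
have MM := sub_closure MGL.
have UM : U `<=` set_mul B U by move=> u Uu; exists 1%:M, u; rewrite mul1mx.
have BM : B `<=` set_mul B U by move=> b Bb; exists b, 1%:M; rewrite mulmx1.
rewrite -(maxB (zariski_closure (set_mul B U))).
- by apply: subset_trans UM MM.
- split; last by apply: closure_solvable => //; apply: set_mul_solvable.
  + split; [exact: closure_subgroup|exact: closure_closed|].
    by apply: closure_min => // _ [b [u [/BG Gb /UG Gu ->]]]; apply: GM.
  + by apply: closure_connected => //; apply: set_mul_connected.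
- exact: subset_trans MM.
Qed.

End Subgroups.

(** * Polynomial curves and derivatives of matrix-valued functions *)

Section PolynomialFunctions.

Variable C : numFieldType.

Definition poly_function (f : C -> C) := exists p : {poly C}, forall t, f t = p.[t].

End PolynomialFunctions.

Section Derivatives.

Variables (C : numClosedFieldType) (N : nat).
Implicit Types (g h x y : 'M[C]_N) (G H P Z : set 'M[C]_N).

Lemma poly_function_subring : subring_of_functions [set f | @poly_function C f].
Proof.
split=> /= [c|f g [p fp] [q gq]|f g [p fp] [q gq]].
- by exists c%:P => t; rewrite hornerC.
- by exists (p + q) => t; rewrite hornerD fp gq.
- by exists (p * q) => t; rewrite hornerM fp gq.
Qed.

Lemma poly_function_aff a b : @poly_function C (fun t => a + t * b).
Proof. by exists (a%:P + 'X * b%:P) => t; rewrite hornerD hornerM hornerX !hornerC. Qed.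

Lemma germ_meval n (f : {mpoly C[n]}) (v : C -> 'I_n -> C) (a d : 'I_n -> C) :
  (forall i, germ (fun t => v t i) (a i) (d i)) ->
  germ (fun t => f.@[v t]) f.@[a] (\sum_i f^`M(i).@[a] * d i).
Proof.
move=> vad; pose good (h : {mpoly C[n]}) :=
  germ (fun t => h.@[v t]) h.@[a] (\sum_i h^`M(i).@[a] * d i).
have goodC c : good c%:MP.
  rewrite /good mevalC big1; last by move=> i _; rewrite mderivC meval0 mul0r.
  by under [X in germ X]funext do rewrite mevalC; apply: germ_cst.
have goodX i : good 'X_i.
  rewrite /good mevalXU (bigD1 i)//= big1 ?addr0; last first.
    by move=> j ji; rewrite mderivX mnm1E eq_sym (negPf ji) scale0r meval0 mul0r.
  rewrite mderivX mnm1E eqxx scale1r -[d i]mul1r.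
  rewrite (_ : (U_(i) - U_(i))%MM = 0%MM) ?mpolyX0 ?meval1; last first.
    by apply/mnmP => j; rewrite mnmBE mnm0E subnn.
  by under [X in germ X]funext do rewrite mevalXU; rewrite !mul1r; apply: vad.
have goodD f1 f2 : good f1 -> good f2 -> good (f1 + f2).
  move=> gh gk; rewrite /good mevalD.
  under eq_bigr do rewrite mderivD mevalD mulrDl.
  by rewrite big_split /=; under [X in germ X]funext do rewrite mevalD; apply: germD.
have goodM f1 f2 : good f1 -> good f2 -> good (f1 * f2).
  move=> gh gk; rewrite /good mevalM.
  under eq_bigr do rewrite mderivM mevalD !mevalM mulrDl mulrAC -[f1.@[a] * _ * _]mulrA.
  rewrite big_split /= -mulr_suml -mulr_sumr.
  by under [X in germ X]funext do rewrite mevalM; apply: germM.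
have goodXn m : good 'X_[m].
  rewrite mpolyXE_id; apply: (big_ind good) => //; first by rewrite -mpolyC1; apply: goodC.
  move=> i _; elim: (m i) => [|k IH]; first by rewrite expr0 -mpolyC1; apply: goodC.
  by rewrite exprS; apply: goodM.
have : good f.
  rewrite (mpolyE f); apply: (big_ind good) => //; first by rewrite -mpolyC0; apply: goodC.
  by move=> m _; rewrite -mul_mpolyC; apply: goodM.
by [].
Qed.

Definition germ_mx m n (F : C -> 'M[C]_(m, n)) (V D : 'M[C]_(m, n)) :=
  forall i j, germ (fun t => F t i j) (V i j) (D i j).

Lemma germ_mxM m n p (E : C -> 'M[C]_(m, n)) (F : C -> 'M[C]_(n, p)) V D W X :
  germ_mx E V D -> germ_mx F W X -> germ_mx (fun t => E t *m F t) (V *m W) (D *m W + V *m X).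
Proof.
move=> gE gF i j; rewrite !mxE -big_split /=.
under [Y in germ Y]funext do rewrite mxE.
by apply: germ_sum => k; apply: germM.
Qed.

Lemma germ_mx_cst m n (A : 'M[C]_(m, n)) : germ_mx (fun=> A) A 0.
Proof. by move=> i j; rewrite mxE; apply: germ_cst. Qed.

Lemma germ_mxT m n (E : C -> 'M[C]_(m, n)) V D :
  germ_mx E V D -> germ_mx (fun t => (E t)^T) V^T D^T.
Proof. by move=> gE i j; rewrite !mxE; under [Y in germ Y]funext do rewrite mxE. Qed.

Lemma germ_mx_line m n (A B : 'M[C]_(m, n)) : germ_mx (fun t => A + t *: B) A B.
Proof.
by move=> i j; under [Y in germ Y]funext do rewrite !mxE [_ * B i j]mulrC; apply: germ_lin.
Qed.

Lemma det_line_poly x : exists2 q : {poly C}, q.[0] != 0 &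
  forall t, q.[t] = \det (1%:M + t *: x).
Proof.
have : poly_function (fun t => \det (1%:M + t *: x)).
  apply: (subring_det poly_function_subring) => i j.
  rewrite [X in mkset _ X](_ : _ = fun t => (1%:M : 'M[C]_N) i j + t * x i j).
    exact: poly_function_aff.
  by apply/funext => t; rewrite !mxE.
move=> [q qE]; exists q => [|t]; last by rewrite qE.
by rewrite -qE scale0r addr0 det1 oner_neq0.
Qed.

Lemma unitmx_det x : (x \in unitmx) = (\det x != 0).
Proof. by rewrite unitmxE unitfE. Qed.

Lemma poly_adj_line x y i j : poly_function (fun t => (y *m \adj (1%:M + t *: x)) i j).
Proof.
have SS := poly_function_subring; have [S0 _ SM] := SS.
apply: (subring_mul (S := [set f | poly_function f]) (E := fun=> y)) => [//|k l|k l] /=; first exact: S0.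
rewrite [X in poly_function X](_ : _ = fun t => (-1) ^+ (l + k) *
    \det (row' l (col' k (1%:M + t *: x)))); last first.
  by apply/funext => t; rewrite mxE.
apply: (SM (fun=> _)) => //; apply: (subring_det SS) => i' j' /=.
rewrite [X in poly_function X](_ : _ = fun t => (1%:M : 'M[C]_N) (lift l i') (lift k j')
   + t * x (lift l i') (lift k j')); last by apply/funext => t; rewrite !mxE.
exact: poly_function_aff.
Qed.

Lemma germ_mx_inv x : germ_mx (fun t => invmx (1%:M + t *: x)) 1%:M (- x).
Proof.
move=> i j; have [q q0 qE] := det_line_poly x.
have [p pE] := poly_adj_line x (x *m x) i j.
exists q, p; split=> // t qt; have ut : (1%:M + t *: x) \in unitmx by rewrite unitmx_det -qE.
rewrite -pE [(- x) i j]mxE mulNr opprK.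
(* The geometric series to second order with exact remainder; times the determinant, the remainder
   is polynomial by the adjugate formula. *)
have E : invmx (1%:M + t *: x) = 1%:M - t *: x + t ^+ 2 *: (x *m x *m invmx (1%:M + t *: x)).
  apply: (can_inj (mulmxK ut)); rewrite mulVmx// !mulmxDl -scalemxAl mulmxKV// mulNmx.
  rewrite !mul1mx mulmxDr mulmx1 -scalemxAl -scalemxAr scalerA expr2 opprD addrA.
  by rewrite addrK subrK.
have Y z (Y : 'M[C]_N) : invmx (1%:M + t *: x) = 1%:M - t *: x + t ^+ 2 *: Y ->
    Y i j = q.[t]^-1 * z ->
    q.[t] * (invmx (1%:M + t *: x) i j - 1%:M i j + x i j * t) = t ^+ 2 * z.
  by move=> ->; rewrite !mxE => ->; field.
by apply: Y E _; rewrite /invmx ut -scalemxAr mxE -qE.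
Qed.

Lemma germ_prod (I : eqType) (s : seq I) (f : I -> C -> C) (v d : I -> C) : uniq s ->
  (forall i, germ (f i) (v i) (d i)) ->
  germ (fun t => \prod_(i <- s) f i t) (\prod_(i <- s) v i)
    (\sum_(j <- s) d j * \prod_(i <- s | i != j) v i).
Proof.
move=> us fvd; elim: s us => [_|a s IH /= /andP[as_ us]].
  by under [X in germ X]funext do rewrite big_nil; rewrite !big_nil; apply: germ_cst.
under [X in germ X]funext do rewrite big_cons.
rewrite !big_cons eqxx /=; rewrite (_ : \prod_(i <- s | i != a) v i = \prod_(i <- s) v i).
  rewrite (_ : \sum_(j <- s) _ = v a * \sum_(j <- s) d j * \prod_(i <- s | i != j) v i).
    by apply: germM => //; apply: IH.
  rewrite mulr_sumr big_seq [RHS]big_seq; apply: eq_bigr => j js.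
  by rewrite big_cons ifT; [ring|apply: contraNneq as_ => ->].
rewrite big_seq_cond [RHS]big_seq; apply: eq_bigl => i.
by case: (boolP (i \in s)) => //= is_; apply: contraNneq as_ => <-.
Qed.

Lemma germ_det F x : germ_mx F 1%:M x -> germ (fun t => \det (F t)) 1 (\tr x).
Proof.
move=> gF.
have H (s : {perm 'I_N}) : germ (fun t => (-1) ^+ s * \prod_i F t i (s i))
    ((-1) ^+ s * \prod_i (1%:M : 'M[C]_N) i (s i))
    ((s == 1%g)%:R * \tr x).
  have := germM (germ_cst ((-1) ^+ s)) (germ_prod (index_enum_uniq _) (fun i => gF i (s i))).
  rewrite mul0r add0r; congr (germ _ _ _).
  case: eqVneq => [->|s1].
    rewrite odd_perm1 expr0 !mul1r; apply: eq_bigr => i _.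
    by rewrite perm1 big1 ?mulr1// => j _; rewrite perm1 mxE eqxx.
  rewrite mul0r big1 ?mulr0// => j _.
  (* A permutation other than 1 moves some point besides j, so an undifferentiated off-diagonal
     factor survives, and it is 0 at the identity. *)
  have /existsP[i /andP[ij si]] : [exists i, (i != j) && (s i != i)].
    apply: contraNT s1 => /existsPn s1; apply/eqP/permP => i; rewrite perm1.
    have fix_ k : k != j -> s k = k by move=> kj; have := s1 k; rewrite kj /= negbK => /eqP.
    case: (eqVneq i j) => [ij|/fix_//].
    apply/eqP; apply/negPn/negP => sii.
    have := fix_ (s i); rewrite {1}ij -ij => /(_ sii) /perm_inj sii'.
    by rewrite sii' eqxx in sii.
  by rewrite (bigD1 i)//= mxE eq_sym (negPf si) mul0r mulr0.
have := germ_sum (index_enum _) H.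
rewrite -mulr_suml -[X in germ _ X]/(\det 1%:M) det1.
rewrite (_ : \sum_i _ = 1); first by rewrite mul1r; congr germ.
by rewrite (bigD1 1%g)//= eqxx big1 ?addr0// => s /negPf ->.
Qed.

Lemma germ_regular_pair (f : regular_fun C N) F D x : germ_mx F 1%:M x ->
  germ D 1 (- \tr x) ->
  germ (fun t => f.@[row_mx (mxvec (F t)) (D t)%:M 0]) (eval_regular f 1%:M)
    (diff_regular f x).
Proof.
move=> gF gD; rewrite /eval_regular det1 invr1.
apply: germ_meval => i; case: (split_ordP i) => j ->{i}; last first.
  under [X in germ X]funext do rewrite row_mxEr ord1 mxE eqxx mulr1n.
  by rewrite !row_mxEr ord1 !mxE eqxx !mulr1n.
case/mxvec_indexP: j => i j.
under [X in germ X]funext do rewrite row_mxEl mxvecE.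
by rewrite !row_mxEl !mxvecE; apply: gF.
Qed.

Lemma germ_regular (f : regular_fun C N) F x : germ_mx F 1%:M x ->
  germ (fun t => eval_regular f (F t)) (eval_regular f 1%:M) (diff_regular f x).
Proof.
move=> gF; apply: germ_regular_pair => //.
have := germV (oner_neq0 _) (germ_det gF).
by rewrite expr1n divr1 invr1.
Qed.

End Derivatives.

(** * Lie algebras of sets of matrices *)

Section LieAlgebras.

Variables (C : numClosedFieldType) (N : nat).
Implicit Types (g h x y : 'M[C]_N) (G H P Z : set 'M[C]_N).

Lemma diff_regular_lin (f : regular_fun C N) a x y :
  diff_regular f (a *: x + y) = a * diff_regular f x + diff_regular f y.
Proof.
rewrite /diff_regular mulr_sumr -big_split /=; apply: eq_bigr => i _.
rewrite mulrCA -mulrDr; congr (_ * _).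
case: (split_ordP i) => j ->{i}; first by rewrite !row_mxEl linearP /= 2!mxE.
by rewrite !row_mxEr !mxE mxtraceD mxtraceZ opprD mulrnDl; ring.
Qed.

Lemma Lie_lin G a x y : Lie G x -> Lie G y -> Lie G (a *: x + y).
Proof. by move=> Gx Gy f fG; rewrite diff_regular_lin Gx ?Gy// mulr0 addr0. Qed.

Lemma Lie0 G : Lie G 0.
Proof.
move=> f _; rewrite /diff_regular big1// => i _.
case: (split_ordP i) => j ->{i}; first by rewrite row_mxEl linear0 mxE mulr0.
by rewrite row_mxEr mxtrace0 oppr0 mxE mul0rn mulr0.
Qed.

Lemma Lie_sub P G : P `<=` G -> Lie P `<=` Lie G.
Proof. by move=> PG x Px f fG; apply: Px => g /PG; apply: fG. Qed.

(** [Lie] is defined through polynomial representatives, while f is known by its values on GL_N;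
    uniqueness of germs along 1 + t x makes the derivative independent of the representative. *)
Lemma Lie_zero P f x v d : P `<=` GL C N -> regular_function f ->
  (forall g, P g -> f g = 0) -> germ (fun t => f (1%:M + t *: x)) v d ->
  Lie P x -> d = 0.
Proof.
move=> PGL [p pf] fP gf Px; have [q q0 qE] := det_line_poly x.
have <- : diff_regular p x = 0 by apply: Px => g Pg; rewrite pf ?fP//; apply: PGL.
have gp := germ_regular p (germ_mx_line 1%:M x).
have [] // := germ_uniq q0 _ gf gp.
by move=> t qt; rewrite pf// /GL /= unitmx_det -qE.
Qed.

Lemma Lie_curve P (F : C -> 'M[C]_N) x (q : {poly C}) : q.[0] != 0 ->
  (forall t, q.[t] != 0 -> P (F t)) -> germ_mx F 1%:M x -> Lie P x.
Proof.
move=> q0 PF gF f fP.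
have [] // := germ_uniq q0 _ (germ_regular f gF) (germ_cst 0).
by move=> t qt; rewrite fP//; apply: PF.
Qed.

Lemma Lie_conj P P' g x : GL C N g -> P `<=` GL C N ->
  (forall h, P h -> P' (g *m h *m invmx g)) -> Lie P x -> Lie P' (g *m x *m invmx g).
Proof.
move=> Gg PGL PP' Px f fP'.
have RF : regular_mx (fun h => g *m h *m invmx g).
  by do 2?apply: regular_mxM; rewrite //; do ?exact: regular_mx_cst; exact: regular_mx_id.
have [f' Rf' f'E] := regular_comp (regular_eval f) RF (regular_detV C N).
have detE h : (\det h)^-1 = (\det (g *m h *m invmx g))^-1.
  by rewrite !det_mulmx det_inv mulrC mulrA mulVf ?mul1r// -unitmx_det.
have Gc h : GL C N h -> GL C N (g *m h *m invmx g).
  by move=> Gh; do 2?apply: GL_mul => //; apply: GL_inv.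
have gF : germ_mx (fun t => g *m (1%:M + t *: x) *m invmx g) 1%:M (g *m x *m invmx g).
  have := germ_mxM (germ_mxM (germ_mx_cst g) (germ_mx_line 1%:M x)) (germ_mx_cst (invmx g)).
  by rewrite mulmx1 mulmxV// mul0mx add0r mulmx0 addr0.
have [q q0 qE] := det_line_poly x.
apply: (Lie_zero PGL Rf' _ _ Px).
  by move=> h Ph; rewrite f'E//; [apply/fP'/PP'|apply/Gc/PGL].
apply: (germ_ext q0 _ (germ_regular f gF)) => t qt.
by rewrite f'E//; apply: Gc; rewrite /GL /= unitmx_det -qE.
Qed.

Lemma regular_mul3 m p (A : 'M[C]_(m, N)) (B : 'M[C]_(N, p)) i j :
  regular_function (fun g => (A *m g *m B) i j).
Proof.
have RS := regular_subring C N; have [R0 _ _] := RS.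
apply: (subring_mul (S := [set f | regular_function f]) RS) => k l; last exact: R0.
apply: (subring_mul (S := [set f | regular_function f]) RS (E := fun=> A) (F := id)) => k' l'.
  exact: R0.
exact: regular_entry.
Qed.

Lemma Lie_mul3 P m p (A : 'M[C]_(m, N)) (B : 'M[C]_(N, p)) x : P `<=` GL C N ->
  (forall g, P g -> A *m g *m B = 0) -> Lie P x -> A *m x *m B = 0.
Proof.
move=> PGL PAB Px; apply/matrixP => i j; rewrite [RHS]mxE.
apply: (Lie_zero PGL (regular_mul3 A B i j) _ _ Px).
  by move=> g /PAB ->; rewrite mxE.
have := germ_mxM (germ_mxM (germ_mx_cst A) (germ_mx_line 1%:M x)) (germ_mx_cst B).
by rewrite mul0mx add0r mulmx0 addr0; apply.
Qed.

Lemma Lie_stable P m (W : 'M[C]_(m, N)) x : P `<=` GL C N ->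
  (forall g, P g -> stablemx W g) -> Lie P x -> stablemx W x.
Proof.
move=> PGL PW Px; rewrite submxE; apply/eqP; apply: Lie_mul3 Px => // g /PW.
by rewrite submxE => /eqP.
Qed.

Lemma diff_regular_coeff (f : regular_fun C N) : exists L : 'I_N -> 'I_N -> C,
  forall x, diff_regular f x = \sum_k \sum_l L k l * x k l.
Proof.
exists (fun k l => diff_regular f (delta_mx k l)) => x.
have D0 : diff_regular f 0 = 0.
  by have := diff_regular_lin f (-1) 0 0; rewrite scaleN1r oppr0 addr0 mulN1r addNr.
have DD u v : diff_regular f (u + v) = diff_regular f u + diff_regular f v.
  by rewrite -[u]scale1r diff_regular_lin mul1r scale1r.
rewrite {1}[x]matrix_sum_delta (big_morph _ DD D0); apply: eq_bigr => k _.
rewrite (big_morph _ DD D0); apply: eq_bigr => l _.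
by rewrite -[_ *: _]addr0 diff_regular_lin D0 addr0 mulrC.
Qed.

Lemma regular_diff_conj f x : regular_function (fun g => diff_regular f (g *m x *m invmx g)).
Proof.
have [L LE] := diff_regular_coeff f; have RS := regular_subring C N.
have [R0 _ RM] := RS.
rewrite [X in regular_function X](_ : _ =
   fun g => \sum_k \sum_l L k l * (g *m x *m invmx g) k l); last first.
  by apply/funext => g; rewrite LE.
apply: (subring_sum _ _ RS) => k; apply: (subring_sum _ _ RS) => l.
apply: (RM (fun=> L k l)); first exact: R0.
apply: regular_mxM; last exact: regular_mxV.
by apply: regular_mxM; [exact: regular_mx_id|exact: regular_mx_cst].
Qed.

Lemma germ_diff_conj f x y :
  germ (fun t => diff_regular f ((1%:M + t *: y) *m x *m invmx (1%:M + t *: y)))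
    (diff_regular f x) (diff_regular f (y *m x - x *m y)).
Proof.
have [L LE] := diff_regular_coeff f.
have gc : germ_mx (fun t => (1%:M + t *: y) *m x *m invmx (1%:M + t *: y)) x (y *m x - x *m y).
  have := germ_mxM (germ_mxM (germ_mx_line 1%:M y) (germ_mx_cst x)) (germ_mx_inv y).
  by rewrite mul1mx !mulmx1 mulmx0 addr0 mulmxN.
rewrite [X in germ X](_ : _ = fun t => \sum_k \sum_l
   L k l * ((1%:M + t *: y) *m x *m invmx (1%:M + t *: y)) k l); last first.
  by apply/funext => t; rewrite LE.
rewrite !LE; apply: germ_sum => k; apply: germ_sum => l.
by have := germM (germ_cst (L k l)) (gc k l); rewrite mul0r add0r; apply.
Qed.

(** For f vanishing on G, the regular function g -> df(g x g^-1) vanishes on G because Ad g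
    preserves Lie G; its derivative at 1 in the direction y is df([y, x]). *)
Lemma Lie_bracket G x y : is_subgroup G -> Lie G x -> Lie G y -> Lie G (y *m x - x *m y).
Proof.
move=> [GGL _ GM GV] Gx Gy f fG.
apply: (Lie_zero GGL (regular_diff_conj f x) _ (germ_diff_conj f x y) Gy) => g Gg.
apply: Lie_conj Gx f fG => //; first exact: GGL.
by move=> h Gh; apply: (GM); [apply: (GM)|apply: GV].
Qed.

End LieAlgebras.

(** * The involution on subgroups and its differential *)

Section Involutions.

Variables (C : numClosedFieldType) (N : nat).
Implicit Types (g h x y : 'M[C]_N) (P Z : set 'M[C]_N).
Variables (G : set 'M[C]_N) (theta : regular_map C N).
Hypotheses (GG : closed_subgroup G (GL C N)) (inv_theta : involution G theta).

Local Notation th := (eval_map theta).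
Local Notation dth := (differential theta).

Let GGL : G `<=` GL C N. Proof. by case: GG. Qed.
Let cG : zariski_closed G. Proof. by case: GG. Qed.
Let G1 : G 1%:M. Proof. by case: GG => -[]. Qed.
Let GM g h : G g -> G h -> G (g *m h).
Proof. by move: g h; case: GG => -[_ _ + _] _ _. Qed.
Let GV g : G g -> G (invmx g). Proof. by move: g; case: GG => -[_ _ _ +] _ _. Qed.
Let thG g : G g -> G (th g). Proof. by move: g; case: inv_theta. Qed.
Let thM g h : G g -> G h -> th (g *m h) = th g *m th h.
Proof. by move: g h; case: inv_theta. Qed.
Let thK g : G g -> th (th g) = g. Proof. by move: g; case: inv_theta. Qed.

Lemma theta1 : th 1%:M = 1%:M.
Proof.
have U : th 1%:M \in unitmx by apply/GGL/thG.
by apply: (can_inj (mulKmx U)); rewrite mulmx1 -thM// mulmx1.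
Qed.

Lemma thetaV g : G g -> th (invmx g) = invmx (th g).
Proof.
move=> Gg; have U : th g \in unitmx by apply/GGL/thG.
by apply: (can_inj (mulKmx U)); rewrite -thM ?mulmxV ?theta1//; [exact: GGL|exact: GV].
Qed.

Lemma regular_theta : regular_mx th.
Proof. by move=> i j; exists (theta i j) => g _; rewrite mxE. Qed.

(** On G this is the inverse of det theta(g), written so as to be regular on all of GL_N, where
    theta(g) may be singular. *)
Definition theta_detV g := \det (th (invmx g)).

Lemma regular_theta_detV : regular_function theta_detV.
Proof.
apply: (subring_det (regular_subring C N)) => i j /=.
have [f Rf fE] := regular_comp (regular_theta i j) (@regular_mxV C N)
  (subring_det (regular_subring C N) (@regular_entry C N)).
by apply: (regular_ext _ Rf) => g Gg; rewrite fE ?det_inv ?invrK//; apply: GL_inv.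
Qed.

Lemma theta_detVE g : G g -> GL C N (th g) /\ theta_detV g = (\det (th g))^-1.
Proof. by move=> Gg; split; [apply/GGL/thG|rewrite /theta_detV thetaV// det_inv]. Qed.

Lemma preimage_theta_closed Z : zariski_closed Z ->
  zariski_closed [set g | G g /\ Z (th g)].
Proof.
exact: (zariski_closed_preimage cG regular_theta regular_theta_detV theta_detVE).
Qed.

Lemma image_theta Z : Z `<=` G -> th @` Z = [set g | G g /\ Z (th g)].
Proof.
move=> ZG; apply/seteqP; split=> [_ [g Zg <-]|g [Gg Zg]]; last by exists (th g); rewrite ?thK.
by split; [apply/thG/ZG|rewrite thK//; apply: ZG].
Qed.

Lemma image_theta_closed Z : Z `<=` G -> zariski_closed Z -> zariski_closed (th @` Z).
Proof. by move=> ZG cZ; rewrite image_theta//; apply: preimage_theta_closed. Qed.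

Lemma image_theta_connected Z : Z `<=` G -> zariski_connected Z ->
  zariski_connected (th @` Z).
Proof.
exact: (connected_image cG regular_theta regular_theta_detV theta_detVE).
Qed.

Lemma image_theta_sub Z : Z `<=` G -> th @` Z `<=` G.
Proof. by move=> ZG _ [z /ZG Gz <-]; apply: thG. Qed.

Lemma image_thetaK Z : Z `<=` G -> th @` (th @` Z) = Z.
Proof.
move=> ZG; apply/seteqP; split=> [_ [_ [z Zz <-] <-]|z Zz].
  by rewrite thK//; apply: ZG.
by exists (th z); [exists z|rewrite thK//; apply: ZG].
Qed.

Lemma image_theta_subgroup H : H `<=` G -> is_subgroup H -> is_subgroup (th @` H).
Proof.
move=> HG [HGL H1 HM HV]; split.
- by move=> _ [h /HG Gh <-]; apply/GGL/thG.
- by exists 1%:M; rewrite ?theta1.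
- move=> _ _ [g Hg <-] [h Hh <-]; exists (g *m h); first exact: HM.
  by rewrite thM//; apply: HG.
- by move=> _ [g Hg <-]; exists (invmx g); [apply: HV|rewrite thetaV//; apply: HG].
Qed.

Lemma image_theta_derived H : H `<=` G -> is_subgroup H ->
  derived_subgroup (th @` H) `<=` th @` derived_subgroup H.
Proof.
move=> HG sH; have sD := derived_is_subgroup sH.
have DG : derived_subgroup H `<=` G by apply: subset_trans (derived_sub sH) HG.
apply: derived_min; first exact: image_theta_subgroup.
move=> _ _ [g Hg <-] [h Hh <-]; exists (g *m h *m invmx g *m invmx h).
  exact: derived_comm.
have [Gg Gh] := (HG _ Hg, HG _ Hh); have [Gg' Gh'] := (GV Gg, GV Gh).
by rewrite !thM ?thetaV//; do ?apply: GM => //; do ?exact: GM.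
Qed.

Lemma image_theta_solvable H : H `<=` G -> is_subgroup H -> solvable_group H ->
  solvable_group (th @` H).
Proof.
move=> HG sH [k Hk]; exists k.
suff E n : iter n (@derived_subgroup C N) (th @` H) `<=`
    th @` iter n (@derived_subgroup C N) H.
  by apply: subset_trans (E k) _ => _ [g /Hk -> <-]; rewrite theta1.
elim: n => //= n IH; apply: subset_trans (derived_mono IH) _.
apply: image_theta_derived; last exact: iter_derived_subgroup.
exact: subset_trans (iter_derived_sub sH) HG.
Qed.

Lemma image_theta_closed_subgroup H : closed_subgroup H G -> closed_subgroup (th @` H) G.
Proof.
move=> [sH cH HG]; split; first exact: image_theta_subgroup.
  exact: image_theta_closed.
exact: image_theta_sub.
Qed.

Lemma image_theta_connected_solvable H : connected_solvable_subgroup H G ->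
  connected_solvable_subgroup (th @` H) G.
Proof.
move=> [cH conH solH]; have [sH _ HG] := cH; split.
- exact: image_theta_closed_subgroup.
- exact: image_theta_connected.
- exact: image_theta_solvable.
Qed.

Lemma image_theta_parabolic P : parabolic_subgroup P G -> parabolic_subgroup (th @` P) G.
Proof.
move=> [cP [B [solB maxB] BP]]; split; first exact: image_theta_closed_subgroup.
have [[sB cB BG] _ _] := solB.
exists (th @` B); last by move=> _ [b /BP Pb <-]; exists b.
split=> [|B' solB' BB']; first exact: image_theta_connected_solvable.
have [[_ _ B'G] _ _] := solB'.
rewrite -(image_thetaK B'G) (maxB (th @` B'))//; first exact: image_theta_connected_solvable.
by rewrite -(image_thetaK BG) => _ [b /BB' B'b <-]; exists b.
Qed.

Lemma germ_theta F x : germ_mx F 1%:M x ->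
  germ_mx (fun t => th (F t)) 1%:M (dth x).
Proof.
move=> gF i j; rewrite -theta1 !mxE; under [X in germ X]funext do rewrite mxE.
exact: germ_regular.
Qed.

Lemma dtheta_lin a x y : dth (a *: x + y) = a *: dth x + dth y.
Proof. by apply/matrixP => i j; rewrite !mxE diff_regular_lin. Qed.

Lemma dtheta0 : dth 0 = 0.
Proof.
by have := dtheta_lin (-1) 0 0; rewrite scaleN1r oppr0 addr0 scaleN1r addNr.
Qed.

Lemma dthetaZ a x : dth (a *: x) = a *: dth x.
Proof. by rewrite -[a *: x]addr0 dtheta_lin dtheta0 addr0. Qed.

Lemma dthetaD x y : dth (x + y) = dth x + dth y.
Proof. by rewrite -[x]scale1r dtheta_lin !scale1r. Qed.

Lemma dthetaN x : dth (- x) = - dth x.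
Proof. by rewrite -!scaleN1r dthetaZ. Qed.

Lemma dthetaB x y : dth (x - y) = dth x - dth y.
Proof. by rewrite dthetaD dthetaN. Qed.

Lemma Lie_theta_eval f P x : P `<=` G -> Lie P x ->
  (forall g, P g -> eval_regular f (th g) = 0) -> diff_regular f (dth x) = 0.
Proof.
move=> PG Px fP; pose f' g := f.@[row_mx (mxvec (th g)) (theta_detV g)%:M 0].
have Rf' : regular_function f'.
  apply: (subring_regular (S := [set f | regular_function f])).
  - exact: regular_subring.
  - exact: regular_theta.
  - exact: regular_theta_detV.
apply: (Lie_zero (subset_trans PG GGL) Rf' _ _ Px).
  by move=> g Pg; rewrite -(fP g Pg) /f'; have [_ ->] := theta_detVE (PG _ Pg).
apply: germ_regular_pair.
  by apply: germ_theta; apply: germ_mx_line.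
have := germ_det (germ_theta (germ_mx_inv x)).
by rewrite dthetaN raddfN.
Qed.

Lemma Lie_theta P x : P `<=` G -> Lie P x -> Lie (th @` P) (dth x).
Proof.
by move=> PG Px f fP; apply: Lie_theta_eval Px _ => // g Pg; apply: fP; exists g.
Qed.

Lemma Lie_thetaG x : Lie G x -> Lie G (dth x).
Proof. by move=> Gx; apply: Lie_sub (Lie_theta _ Gx) => //; apply: image_theta_sub. Qed.

(** The entries of theta(theta(g)) - g, with [theta_detV] in place of 1/det, are regular functions
    vanishing on G, so their derivatives vanish on Lie G. *)
Lemma dthetaK x : Lie G x -> dth (dth x) = x.
Proof.
move=> Gx; apply/matrixP => i j.
pose f' g := (theta i j).@[row_mx (mxvec (th g)) (theta_detV g)%:M 0] - g i j.
have [R0 RD RM] := regular_subring C N.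
have Rf' : regular_function f'.
  apply: (RD (fun g => (theta i j).@[row_mx (mxvec (th g)) (theta_detV g)%:M 0])
             (fun g => - g i j)).
    apply: (subring_regular (S := [set f | regular_function f])).
    - exact: regular_subring.
    - exact: regular_theta.
    - exact: regular_theta_detV.
  rewrite [X in mkset _ X](_ : _ = fun g => -1 * g i j); last first.
    by apply/funext => g; rewrite mulN1r.
  by apply: (RM (fun=> -1) (fun g => g i j)); [apply: R0|apply: regular_entry].
have gf : germ (fun t => f' (1%:M + t *: x)) (eval_regular (theta i j) 1%:M + -1 * 1%:M i j)
    (diff_regular (theta i j) (dth x) + -1 * x i j).
  apply: germD.
    apply: germ_regular_pair; first exact: germ_theta (germ_mx_line _ _).
    by have := germ_det (germ_theta (germ_mx_inv x)); rewrite dthetaN raddfN.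
  rewrite [X in germ X](_ : _ = fun t => -1 * (1%:M + t *: x) i j); last first.
    by apply/funext => t; rewrite mulN1r.
  by have := germM (germ_cst (-1)) (germ_mx_line 1%:M x i j); rewrite mul0r add0r; apply.
suff /Lie_zero H : forall g, G g -> f' g = 0.
  by have := H x _ _ GGL Rf' gf Gx; rewrite mulN1r => /subr0_eq <-; rewrite mxE.
move=> g Gg; rewrite /f'; have [_ ->] := theta_detVE Gg.
have := thK Gg; move=> /(congr1 (fun h : 'M_N => h i j)) /eqP.
by rewrite mxE -subr_eq0 => /eqP.
Qed.

Lemma dtheta_conj g x : G g -> Lie G x ->
  dth (g *m x *m invmx g) = th g *m dth x *m invmx (th g).
Proof.
move=> Gg Gx; apply/subr0_eq/matrixP => i j; rewrite [RHS]mxE.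
suff : dth (g *m x *m invmx g) i j + -1 * (th g *m dth x *m invmx (th g)) i j = 0.
  by rewrite mulN1r => H; rewrite mxE [X in _ + X = _]mxE.
have RF : regular_mx (fun h => g *m h *m invmx g).
  by do 2?apply: regular_mxM; rewrite //; do ?exact: regular_mx_cst; exact: regular_mx_id.
have [f1 Rf1 f1E] := regular_comp (regular_theta i j) RF (regular_detV C N).
have detE h : (\det h)^-1 = (\det (g *m h *m invmx g))^-1.
  by rewrite !det_mulmx det_inv mulrC mulrA mulVf ?mul1r// -unitmx_det; apply: GGL.
have Gc h : GL C N h -> GL C N (g *m h *m invmx g).
  by move=> Gh; do 2?apply: GL_mul => //; do ?apply: GL_inv; apply: GGL.
have {}f1E h : GL C N h -> f1 h = th (g *m h *m invmx g) i j by move=> Gh; apply: f1E; auto.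
pose F h := th g *m th h *m invmx (th g).
have RF2 : regular_mx F.
  by apply: regular_mxM; [apply: regular_mxM;[exact: regular_mx_cst|exact: regular_theta]|exact: regular_mx_cst].
have [R0 RD RM] := regular_subring C N.
have R2 : regular_function (fun h => f1 h + -1 * F h i j).
  by apply: (RD f1) => //; apply: (RM (fun=> -1) (fun h => F h i j)); [apply: R0|apply: RF2].
apply: (Lie_zero GGL R2 _ _ Gx).
  move=> h Gh; rewrite f1E; last exact: GGL.
  have [Gg' Ggh] := (GV Gg, GM Gg Gh).
  by rewrite thM// thM// thetaV// mulN1r subrr.
have [q q0 qE] := det_line_poly x.
have UG := GGL Gg.
have gF : germ_mx (fun t => g *m (1%:M + t *: x) *m invmx g) 1%:M (g *m x *m invmx g).
  have := germ_mxM (germ_mxM (germ_mx_cst g) (germ_mx_line 1%:M x)) (germ_mx_cst (invmx g)).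
  by rewrite mulmx1 mulmxV// mul0mx add0r mulmx0 addr0.
have gF2 : germ_mx (fun t => F (1%:M + t *: x)) 1%:M (th g *m dth x *m invmx (th g)).
  have := germ_mxM (germ_mxM (germ_mx_cst (th g)) (germ_theta (germ_mx_line 1%:M x)))
    (germ_mx_cst (invmx (th g))).
  by rewrite mulmx1 mulmxV ?mul0mx ?add0r ?mulmx0 ?addr0//; apply/GGL/thG.
apply: (@germ_ext _ (fun t => th (g *m (1%:M + t *: x) *m invmx g) i j +
   -1 * F (1%:M + t *: x) i j) _ _ _ q) => //.
  by move=> t qt; rewrite f1E// /GL /= unitmx_det -qE.
have := germD (germ_theta gF i j) (germM (germ_cst (-1)) (gF2 i j)).
by rewrite mul0r add0r; apply.
Qed.

(** Differentiating the equivariance [dtheta_conj] of dtheta at g = 1 in the direction y. *)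
Lemma dtheta_bracket x y : Lie G x -> Lie G y ->
  dth (y *m x - x *m y) = dth y *m dth x - dth x *m dth y.
Proof.
move=> Gx Gy; apply/subr0_eq/matrixP => i j; rewrite [RHS]mxE.
suff : dth (y *m x - x *m y) i j + -1 * (dth y *m dth x - dth x *m dth y) i j = 0.
  by rewrite mulN1r => H; rewrite mxE [X in _ + X = _]mxE.
pose F1 g := diff_regular (theta i j) (g *m x *m invmx g); pose F2 g := th g *m dth x *m th (invmx g).
have [R0 RD RM] := regular_subring C N.
have RthV : regular_mx (fun g => th (invmx g)).
  move=> k l; have [f Rf fE] := regular_comp (regular_theta k l) (@regular_mxV C N)
    (subring_det (regular_subring C N) (@regular_entry C N)).
  by apply: (regular_ext _ Rf) => g Gg; rewrite fE ?det_inv ?invrK//; apply: GL_inv.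
have R2 : regular_function (fun g => F2 g i j).
  apply: regular_mxM => //; apply: regular_mxM; [exact: regular_theta|exact: regular_mx_cst].
have R12 : regular_function (fun g => F1 g + -1 * F2 g i j).
  by apply: (RD F1); [exact: regular_diff_conj|]; apply: (RM (fun=> -1) (fun g => F2 g i j)); [apply: R0|].
apply: (Lie_zero GGL R12 _ _ Gy).
  move=> g Gg; rewrite /F2 thetaV// -dtheta_conj// [dth _ i j]mxE.
  by rewrite mulN1r subrr.
have gy := germ_mx_line 1%:M y; have gyV := germ_mx_inv y.
have g1 : germ (fun t => F1 (1%:M + t *: y)) (dth x i j) (dth (y *m x - x *m y) i j).
  by rewrite !mxE; apply: germ_diff_conj.
have g2 : germ (fun t => F2 (1%:M + t *: y) i j) (dth x i j)
    ((dth y *m dth x - dth x *m dth y) i j).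
  have := germ_mxM (germ_mxM (germ_theta gy) (germ_mx_cst (dth x))) (germ_theta gyV).
  by rewrite mul1mx !mulmx1 mulmx0 addr0 dthetaN mulmxN; apply.
have := germD g1 (germM (germ_cst (-1)) g2).
by rewrite mul0r add0r; apply.
Qed.

End Involutions.

(** * Engel's theorem for linear sets of nilpotent matrices *)

Section Engel.

Variable F : fieldType.

Definition linear_set (V : lmodType F) (S : set V) :=
  S 0 /\ forall a x y, S x -> S y -> S (a *: x + y).

Lemma linear_setD (V : lmodType F) (S : set V) x y :
  linear_set S -> S x -> S y -> S (x + y).
Proof. by move=> [_ SL] Sx Sy; rewrite -[x]scale1r; apply: SL. Qed.

Lemma linear_setZ (V : lmodType F) (S : set V) a x : linear_set S -> S x -> S (a *: x).
Proof. by move=> [S0 SL] Sx; rewrite -[_ *: x]addr0; apply: SL. Qed.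

Lemma linear_setN (V : lmodType F) (S : set V) x : linear_set S -> S x -> S (- x).
Proof. by move=> SL Sx; rewrite -scaleN1r; apply: linear_setZ. Qed.

Lemma linear_setB (V : lmodType F) (S : set V) x y :
  linear_set S -> S x -> S y -> S (x - y).
Proof. by move=> SL Sx Sy; apply: linear_setD => //; apply: linear_setN. Qed.

Lemma sub_add_rV n m (W : 'M[F]_(n, m)) (v u : 'rV_m) :
  (u <= W + v)%MS -> exists a w, (w <= W)%MS /\ u = a *: v + w.
Proof.
move=> /sub_addsmxP[[w1 w2] ->] /=; exists (w2 0 0), (w1 *m W); split.
  exact: submxMl.
by rewrite addrC; congr (_ + _); rewrite {1}[w2]mx11_scalar mul_scalar_mx.
Qed.

Lemma rank_add_rV n m (W : 'M[F]_(n, m)) (v : 'rV_m) :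
  ~~ (v <= W)%MS -> (\rank W < \rank (W + v)%MS)%N.
Proof.
move=> vW; have /mxrank_leqif_sup : (W <= W + v)%MS by apply: addsmxSl.
move=> /ltn_leqif ->; apply: contra vW; apply: submx_trans; exact: addsmxSr.
Qed.

Lemma linear_set_mx m (S : set 'rV[F]_m) : linear_set S ->
  exists W : 'M[F]_m, forall v, S v <-> (v <= W)%MS.
Proof.
move=> SL; have [S0 _] := SL.
have H k : exists W : 'M[F]_m, (forall v : 'rV_m, (v <= W)%MS -> S v) /\
    ((k <= \rank W)%N \/ forall v, S v -> (v <= W)%MS).
  elim: k => [|k [W [WS [kW|SW]]]]; last by exists W; split; [|right].
    by exists 0; split=> [v|]; [rewrite submx0 => /eqP ->|left].
  case: (pselect (forall v, S v -> (v <= W)%MS)) => [SW|].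
    by exists W; split; [|right].
  move=> /existsNP[v] /not_implyP[Sv /negP vW]; exists (W + v)%MS; split.
    move=> u /sub_add_rV[a [w [/WS Sw ->]]]; apply: linear_setD => //.
    exact: linear_setZ.
  by left; apply: leq_ltn_trans kW (rank_add_rV vW).
have [W [WS [mW|SW]]] := H m.+1; last by exists W => v; split; auto.
by have := rank_leq_row W; rewrite leqNgt mW.
Qed.

Variable N : nat.
Implicit Types (x y j : 'M[F]_N) (I J : set 'M[F]_N) (W : 'M[F]_N) (u v : 'rV[F]_N).

(** The conclusion of Engel's theorem for every invariant subquotient W / W' at once; allowing all
    subquotients makes inductions on I possible. *)
Definition engel I := forall W' W, (forall y, I y -> stablemx W' y) ->
  (forall y, I y -> stablemx W y) -> (W' < W)%MS ->
  exists v, [/\ (v <= W)%MS, ~~ (v <= W')%MS & forall y, I y -> (v *m y <= W')%MS].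

Lemma engel0 : engel [set 0].
Proof.
move=> W' W _ _; rewrite ltmxE => /andP[_ /row_subPn[i iW]].
by exists (row i W); split=> // [|_ ->]; rewrite ?row_sub// mulmx0 sub0mx.
Qed.

(** As x normalizes J, it preserves the vectors of W that J sends into W'. The last v x^n outside W'
    is then sent into W' by x as well. *)
Lemma engel_extend J x : J 0 -> engel J -> (exists k : nat, x ^+ k = 0) ->
  (forall j, J j -> J (x *m j - j *m x)) ->
  engel [set y | exists a j, J j /\ y = a *: x + j].
Proof.
move=> J0 eJ [k xk] xJ W' W sW' sW ltW.
have Jj j : J j -> exists a j', J j' /\ j = a *: x + j'.
  by move=> ?; exists 0, j; rewrite scale0r add0r.
have xx : exists a j, J j /\ x = a *: x + j by exists 1, 0; rewrite scale1r addr0.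
have [v [vW vW' vJ]] := eJ _ _ (fun j Jj' => sW' j (Jj j Jj')) (fun j Jj' => sW j (Jj j Jj')) ltW.
have E n : (v *m x ^+ n <= W)%MS /\ forall j, J j -> (v *m x ^+ n *m j <= W')%MS.
  elim: n => [|n [IH1 IH2]]; first by rewrite expr0 mulmx1.
  have -> : v *m x ^+ n.+1 = v *m x ^+ n *m x by rewrite exprSr mulmxA.
  split=> [|j Jj'].
    by apply: submx_trans (submxMr _ IH1) _; apply: sW.
  have -> : v *m x ^+ n *m x *m j =
      v *m x ^+ n *m (x *m j - j *m x) + v *m x ^+ n *m j *m x.
    by rewrite mulmxBr !mulmxA subrK.
  apply: addmx_sub; first exact/IH2/xJ.
  by apply: submx_trans (submxMr _ (IH2 _ Jj')) _; apply: sW'.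
have exn : exists n, (v *m x ^+ n <= W')%MS by exists k; rewrite xk mulmx0 sub0mx.
case: (ex_minnP exn) => -[|n] nW' minn; first by rewrite expr0 mulmx1 (negPf vW') in nW'.
exists (v *m x ^+ n); split; first by case: (E n).
  by apply/negP => /minn; rewrite ltnn.
move=> _ [a [j [Jj' ->]]]; rewrite mulmxDr -scalemxAr addmx_sub//; last by apply: (E n).2.
by rewrite scalemx_sub// -mulmxA [x ^+ n *m x](_ : _ = x ^+ n.+1)// exprSr.
Qed.

(** The largest subspace that I maps into W. The long term only proves that these vectors form a
    linear set. *)
Definition engel_next I W : 'M[F]_N :=
  sval (cid (@linear_set_mx N [set v | forall y, I y -> (v *m y <= W)%MS] (conj
    (fun y _ => etrans (congr1 (fun M => M <= W)%MS (mul0mx _ y)) (sub0mx _ W))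
    (fun a u v Iu Iv y Iy => etrans (congr1 (fun M => M <= W)%MS
       (etrans (mulmxDl _ _ y) (congr1 (+%R^~ _) (esym (scalemxAl a u y)))))
       (addmx_sub (scalemx_sub a (Iu y Iy)) (Iv y Iy)))))).

Lemma engel_nextP I W v : (v <= engel_next I W)%MS <-> forall y, I y -> (v *m y <= W)%MS.
Proof. by rewrite /engel_next; case: cid => /= X <-. Qed.

(** [engel] makes each step of the ascending flag strict until the whole space is reached, so N
    steps suffice. *)
Lemma engel_chain I : engel I -> exists W : nat -> 'M[F]_N,
  [/\ W 0%N = 0, (1%:M <= W N)%MS, forall i, (W i <= W i.+1)%MS,
      forall y i, I y -> (W i.+1 *m y <= W i)%MS
    & forall i, W i.+1 = engel_next I (W i)].
Proof.
move=> eI; pose W i := iter i (engel_next I) 0.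
have WI y i : I y -> (W i.+1 *m y <= W i)%MS.
  move=> Iy; apply/row_subP => r; rewrite row_mul.
  by apply: (engel_nextP I (W i) _).1 => //; apply: row_sub.
have WW i : (W i <= W i.+1)%MS.
  elim: i => [|i IH]; first exact: sub0mx.
  apply/row_subP => r; apply/engel_nextP => y Iy.
  apply: submx_trans IH; apply: submx_trans (WI y i Iy).
  by apply: submxMr; apply: row_sub.
have rW i : (minn i N <= \rank (W i))%N.
  elim: i => [|i IH]; first by rewrite min0n.
  case: (boolP (W i.+1 <= W i)%MS) => [sW|nsW]; last first.
    have lt_rank : (\rank (W i) < \rank (W i.+1))%N.
      by rewrite (ltn_leqif (mxrank_leqif_sup (WW i))).
    apply: leq_trans lt_rank; apply: leq_trans (_ : (minn i N).+1 <= _)%N; last by rewrite ltnS.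
    by rewrite -minnSS leq_min geq_minl (leq_trans (geq_minr _ _)).
  have full : (1%:M <= W i)%MS.
    apply/negPn/negP => nf.
    have [|||v [_ vW vI]] := eI (W i) 1%:M.
    - move=> y Iy; apply: submx_trans (submxMr _ (WW i)) (WI _ _ Iy).
    - by move=> y Iy; rewrite submx1.
    - by rewrite ltmxE submx1.
    by move/negP: vW; apply; apply: submx_trans sW; apply/engel_nextP.
  have : (\rank (1%:M : 'M[F]_N) <= \rank (W i.+1))%N.
    by apply: mxrankS; apply: submx_trans full (WW i).
  by rewrite mxrank1; apply: leq_trans; apply: geq_minr.
exists W; split=> //.
by have := rW N; rewrite minnn => rN; rewrite sub1mx /row_full eqn_leq rank_leq_col.
Qed.

Lemma engel_nilpotent I y : engel I -> I y -> y ^+ N = 0.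
Proof.
move=> /engel_chain[W [W0 W1 _ WI _]] Iy.
have H i : W i *m y ^+ i = 0.
  elim: i => [|i IH]; first by rewrite W0 mul0mx.
  apply/eqP; rewrite exprS -[X in W _ *m X]/(y *m y ^+ i) mulmxA -submx0.
  by apply: submx_trans (submxMr _ (WI _ _ Iy)) _; rewrite IH sub0mx.
apply/eqP; rewrite -[y ^+ N]mul1mx -submx0.
by apply: submx_trans (submxMr _ W1) _; rewrite H.
Qed.

(** Measure y by E d y: it sends W_i into W_(i + N - d) in the flag of J. A bracket with J raises d
    by one. If no y outside J normalized J, brackets could be chosen outside J until d = 2N; then y
    sends W_N, the whole space, into W_0 = 0, so y = 0 lies in J. *)
Lemma engel_normalizer J I x : engel J -> J `<=` I ->
  (forall y z, I y -> I z -> I (y *m z - z *m y)) -> I x -> ~ J x -> J 0 ->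
  exists y, [/\ I y, ~ J y & forall j, J j -> J (y *m j - j *m y)].
Proof.
move=> /engel_chain[W [W0 W1 WW WJ _]] JI II Ix Jx J0.
apply: contrapT => nex.
have WM i k : (i <= k)%N -> (W i <= W k)%MS.
  by move=> /subnK <-; elim: (k - i)%N => // n IH; apply: submx_trans IH (WW _).
pose E d y := forall i, (W i *m y <= W (i + N - d)%N)%MS.
have H d : exists y, [/\ I y, ~ J y & E d y].
  elim: d => [|d [y [Iy Jy Ey]]].
    exists x; split=> // i; rewrite subn0.
    by apply: submx_trans (submx1 _) _; apply: submx_trans W1 _; apply: WM; rewrite leq_addl.
  apply: contrapT => nz; apply: nex; exists y; split=> // j Jj.
  apply: contrapT => Jyj; apply: nz; exists (y *m j - j *m y); split=> //.
    by apply: II => //; apply: JI.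
  have WJ' k : (W k *m j <= W k.-1)%MS.
    by case: k => [|k]; [rewrite W0 mul0mx sub0mx|apply: WJ].
  move=> i; rewrite mulmxBr addmx_sub// ?eqmx_opp !mulmxA.
    rewrite subnS; apply: submx_trans (submxMr _ (Ey i)) _; exact: WJ'.
  apply: submx_trans (submxMr _ (WJ' i)) _.
  case: i => [|i]; first by rewrite W0 mul0mx sub0mx.
  by apply: submx_trans (Ey i) _; rewrite addSn subSS.
have [y [_ Jy Ey]] := H (N + N)%N; apply: Jy.
have := Ey N; rewrite subnn W0 submx0 => /eqP WN.
suff -> : y = 0 by [].
apply/eqP; rewrite -[y]mul1mx -submx0.
by apply: submx_trans (submxMr _ W1) _; rewrite WN.
Qed.

Theorem engel_thm I : linear_set I -> (forall y, I y -> exists k : nat, y ^+ k = 0) ->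
  (forall y z, I y -> I z -> I (y *m z - z *m y)) -> engel I.
Proof.
move=> IL Inil II.
(* Spaces of matrices are encoded as row spaces via [mxvec], so that their dimension bounds the
   number of enlargements of J inside I. *)
pose S (J : 'M[F]_(N * N)) := [set x | (mxvec x <= J)%MS].
have SL (J : 'M[F]_(N * N)) : linear_set (S J).
  split=> [|a x y] /=; first by rewrite /S /= linear0 sub0mx.
  by rewrite /S /= linearP => Jx Jy; apply: addmx_sub => //; apply: scalemx_sub.
have H k : exists J : 'M[F]_(N * N), [/\ S J `<=` I, engel (S J),
    forall y z, S J y -> S J z -> S J (y *m z - z *m y)
  & (k <= \rank J)%N \/ I `<=` S J].
  elim: k => [|k [J [JI eJ JJ [kJ|IJ]]]]; last by exists J; split=> //; right.
    have S0 x : S 0 x -> x = 0.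
      by rewrite /S /= submx0 => /eqP/(congr1 vec_mx); rewrite mxvecK linear0.
    exists 0; split; [|have -> : S 0 = [set 0]| |by left].
    - by move=> x /S0 ->; case: IL.
    - by apply/seteqP; split=> x; [exact: S0|move=> ->; case: (SL 0)].
    - exact: engel0.
    - by move=> y z /S0 -> _; rewrite mul0mx mulmx0 subrr; case: (SL 0).
  case: (pselect (I `<=` S J)) => [IJ|]; first by exists J; split=> //; right.
  move=> /existsNP[x0] /not_implyP[Ix0 Jx0].
  have [J0 _] := SL J.
  have [x [Ix Jx xJ]] := engel_normalizer eJ JI II Ix0 Jx0 J0.
  have xJE : S (J + mxvec x)%MS = [set y | exists a j, S J j /\ y = a *: x + j].
    apply/seteqP; split=> [y /sub_add_rV[a [w [wJ /(congr1 vec_mx)]]]|_ [a [j [Jj ->]]]].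
      rewrite mxvecK linearP /= mxvecK => ->; exists a, (vec_mx w).
      by rewrite /S /= vec_mxK.
    rewrite /S /= linearP addmx_sub//; first by rewrite scalemx_sub// addsmxSr.
    exact: submx_trans Jj (addsmxSl _ _).
  exists (J + mxvec x)%MS; rewrite xJE; split.
  - move=> _ [a [j [/JI Ij ->]]]; apply: linear_setD => //; exact: linear_setZ.
  - by apply: engel_extend => //; apply: Inil.
  - move=> _ _ [a [j [Jj ->]]] [b [k' [Jk ->]]]; exists 0.
    exists (a *: (x *m k' - k' *m x) - b *: (x *m j - j *m x) + (j *m k' - k' *m j)).
    split.
      apply: linear_setD (JJ _ _ Jj Jk) => //; apply: linear_setB => //;
      by apply: linear_setZ => //; apply: xJ.
    rewrite scale0r add0r !mulmxDl !mulmxDr -!scalemxAl -!scalemxAr.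
    move: (x *m x) (x *m k') (k' *m x) (x *m j) (j *m x) (j *m k') (k' *m j).
    by move=> *; apply/matrixP => r s; rewrite !mxE; ring.
  - by left; apply: leq_ltn_trans kJ _; apply: rank_add_rV; apply/negP.
have [J [JI eJ _ [kJ|IJ]]] := H (N * N).+1.
  by have := rank_leq_row J; rewrite leqNgt kJ.
by have -> : I = S J by apply/seteqP.
Qed.

End Engel.

(** * The nilradical is an ideal *)

Section Nilradical.

Variables (C : numClosedFieldType) (N : nat).
Implicit Types (x y : 'M[C]_N) (I J p : set 'M[C]_N).

Lemma lie_ideal_linear I p : lie_ideal I p -> linear_set I.
Proof. by move=> [_ I0 IL _]; split. Qed.

Lemma nil_ideal_engel I p : lie_ideal I p -> (forall y, I y -> nilpotent_mx y) -> engel I.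
Proof.
move=> iI nI; apply: engel_thm => //; first exact: lie_ideal_linear iI.
by have [Ip _ _ pI] := iI; move=> y z Iy Iz; apply: pI => //; apply: Ip.
Qed.

Definition set_add I J : set 'M[C]_N := [set x | exists a b, [/\ I a, J b & x = a + b]].

(** The vectors of W sent into W' by I form a J-stable space Z strictly containing W', because I is
    an ideal; Engel for J applies between W' and Z. *)
Lemma engel_add I J p : lie_ideal I p -> lie_ideal J p -> engel I -> engel J ->
  engel (set_add I J).
Proof.
move=> iI iJ eI eJ W' W sW' sW ltW.
have [Ip I0 IL pI] := iI; have [Jp J0 JL pJ] := iJ.
have sI y : I y -> set_add I J y by exists y, 0; rewrite addr0.
have sJ y : J y -> set_add I J y by exists 0, y; rewrite add0r.
have [|Z ZP] := @linear_set_mx C N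
   [set v | (v <= W)%MS /\ forall y, I y -> (v *m y <= W')%MS].
  split=> [|a u v [uW uI] [vW vI]] /=; first by split=> [|y _]; rewrite ?mul0mx sub0mx.
  split=> [|y Iy]; first by rewrite addmx_sub// scalemx_sub.
  by rewrite mulmxDl -scalemxAl addmx_sub ?scalemx_sub ?uI ?vI.
have [W'W _] := andP ltW.
have [v [vW vW' vI]] := eI _ _ (fun y Iy => sW' _ (sI _ Iy)) (fun y Iy => sW _ (sI _ Iy)) ltW.
case: (eJ W' Z).
- by move=> y /sJ; apply: sW'.
- move=> y Jy; apply/row_subP => i; rewrite row_mul; apply/ZP => /=.
  have [rW rI] := (ZP (row i Z)).2 (row_sub _ _).
  split=> [|z Iz]; first by apply: submx_trans (submxMr _ rW) _; apply/sW/sJ.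
  rewrite -mulmxA -[y *m z](subrK (z *m y)) mulmxDr addmx_sub ?mulmxA//.
    by apply: rI; apply: pI => //; apply: Jp.
  by apply: submx_trans (submxMr _ (rI _ Iz)) _; apply/sW'/sJ.
- rewrite ltmxE; apply/andP; split.
    apply/row_subP => i; apply/ZP => /=; split; first exact: submx_trans (row_sub _ _) W'W.
    move=> y Iy; apply: submx_trans (sW' _ (sI _ Iy)).
    by apply: submxMr; apply: row_sub.
  by apply: contra vW'; apply: submx_trans; apply/ZP.
move=> u [uZ uW' uJ]; have [uW uI] := (ZP u).2 uZ.
exists u; split=> // _ [a [b [Ia Jb ->]]].
by rewrite mulmxDr addmx_sub//; [exact: uI|exact: uJ].
Qed.

Lemma nilradical_max I p : lie_ideal I p -> (forall y, I y -> nilpotent_mx y) ->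
  I `<=` nilradical p.
Proof. by move=> iI nI x Ix; exists I; split. Qed.

Lemma nilradical_nilpotent p x : nilradical p x -> nilpotent_mx x.
Proof. by move=> [I [_ + Ix]]; apply. Qed.

(** The union of all ideals of nilpotent elements is closed under addition because, by Engel, the
    sum of two of them is again one. *)
Lemma nilradical_ideal p : linear_set p -> lie_ideal (nilradical p) p.
Proof.
move=> pL; have [p0 _] := pL; split.
- by move=> x [I [[Ip _ _ _] _ /Ip]].
- exists [set 0]; split=> //; last by move=> _ ->; exists 1%N.
  split=> // [_ -> //|a _ _ -> ->|x _ _ ->]; first by rewrite scaler0 addr0.
  by rewrite mulmx0 mul0mx subrr.
- move=> a x y [I [iI nI Ix]] [J [iJ nJ Jy]].
  have [Ip I0 IL pI] := iI; have [Jp J0 JL pJ] := iJ.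
  have eIJ := engel_add iI iJ (nil_ideal_engel iI nI) (nil_ideal_engel iJ nJ).
  exists (set_add I J); split; last first.
  + by exists (a *: x), y; split=> //; apply: linear_setZ => //; apply: lie_ideal_linear iI.
  + by move=> z IJz; exists N; apply: engel_nilpotent IJz.
  split.
  + by move=> _ [b [c [/Ip pb /Jp pc ->]]]; apply: linear_setD.
  + by exists 0, 0; rewrite addr0.
  + move=> b _ _ [u [v [Iu Jv ->]]] [u' [v' [Iu' Jv' ->]]].
    exists (b *: u + u'), (b *: v + v'); split; [exact: IL|exact: JL|].
    by rewrite scalerDr addrACA.
  + move=> z _ pz [u [v [Iu Jv ->]]]; exists (z *m u - u *m z), (z *m v - v *m z).
    split; [exact: pI|exact: pJ|].
    by rewrite mulmxDr mulmxDl opprD addrACA.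
- move=> x y px [I [iI nI Iy]]; exists I; split=> //.
  by case: iI => _ _ _; apply.
Qed.

Lemma nilradical_engel p : linear_set p -> engel (nilradical p).
Proof.
move=> pL; apply: nil_ideal_engel (nilradical_ideal pL) _.
exact: nilradical_nilpotent.
Qed.

Lemma nilradical_conj p p' g : g \in unitmx ->
  (forall x, p x -> p' (g *m x *m invmx g)) ->
  (forall x, p' x -> p (invmx g *m x *m g)) ->
  forall x, nilradical p x -> nilradical p' (g *m x *m invmx g).
Proof.
move=> Ug pp' p'p x [I [[Ip I0 IL pI] nI Ix]].
have cK y : g *m (invmx g *m y *m g) *m invmx g = y.
  by rewrite !mulmxA mulmxV// mul1mx mulmxK.
have cM y z : g *m (y *m z) *m invmx g = (g *m y *m invmx g) *m (g *m z *m invmx g).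
  by rewrite !mulmxA mulmxKV.
exists [set g *m y *m invmx g | y in I]; split; last by exists x.
  split.
  - by move=> _ [y /Ip py <-]; apply: pp'.
  - by exists 0; rewrite // mulmx0 mul0mx.
  - move=> a _ _ [y Iy <-] [z Iz <-]; exists (a *: y + z); first exact: IL.
    by rewrite mulmxDr mulmxDl -scalemxAr -scalemxAl.
  - move=> y _ /p'p py [z Iz <-]; exists (invmx g *m y *m g *m z - z *m (invmx g *m y *m g)).
      exact: pI.
    by rewrite mulmxBr mulmxBl (cM (invmx g *m y *m g)) (cM z) cK.
move=> _ [y Iy <-]; have [k yk] := nI _ Iy; exists k.
have -> : (g *m y *m invmx g) ^+ k = g *m y ^+ k *m invmx g.
  elim: k {yk} => [|k IH]; first by rewrite !expr0 mulmx1 mulmxV.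
  by rewrite !exprS IH -!mulmxE cM.
by rewrite yk mulmx0 mul0mx.
Qed.

End Nilradical.

(** * The Cayley transform and polynomial curves *)

Section Cayley.

Variables (C : numClosedFieldType) (N : nat).
Implicit Types (g h x y : 'M[C]_N) (G P : set 'M[C]_N).

Definition cayley x := (1%:M + x) *m invmx (1%:M - x).

(* For nilpotent [x], the exponential; the bound N + 2 makes the terms of degree *)
(* 0 and 1 present for every N.                                                  *)
Definition expmx x := \sum_(k < N.+2) (k`!%:R)^-1 *: x ^+ k.

(* Classical groups are closed under the Cayley transform and its inverse, and *)
(* under the exponential of nilpotent elements; this replaces the general      *)
(* correspondence between algebraic groups and Lie algebras.                   *)
Definition cayley_group G :=
  [/\ closed_subgroup G (GL C N),
      forall x, Lie G x -> 1%:M - x \in unitmx -> 1%:M + x \in unitmx -> G (cayley x),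
      forall g, G g -> 1%:M + g \in unitmx -> Lie G ((g - 1%:M) *m invmx (1%:M + g))
    & forall x, Lie G x -> nilpotent_mx x -> G (expmx x)].

Lemma exprZmx a x k : (a *: x) ^+ k = a ^+ k *: x ^+ k.
Proof.
elim: k => [|n IH]; first by rewrite !expr0 scale1r.
by rewrite !exprS IH -!mulmxE -scalemxAl -scalemxAr scalerA.
Qed.

Lemma nilpotent_unitB x : nilpotent_mx x -> 1%:M - x \in unitmx.
Proof.
move=> [k xk]; have := subrX1 x k; rewrite xk sub0r -mulmxE => /(congr1 -%R).
by rewrite opprK -mulNmx opprB => /esym/mulmx1_unit[].
Qed.

Lemma nilpotentZ a x : nilpotent_mx x -> nilpotent_mx (a *: x).
Proof.
by move=> [k xk]; exists k; rewrite exprZmx xk scaler0.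
Qed.

Lemma nilpotentN x : nilpotent_mx x -> nilpotent_mx (- x).
Proof. by move=> nx; rewrite -scaleN1r; apply: nilpotentZ. Qed.

Lemma nilpotent_unitD x : nilpotent_mx x -> 1%:M + x \in unitmx.
Proof. by move=> nx; rewrite -[x]opprK; apply/nilpotent_unitB/nilpotentN. Qed.

Lemma poly_function_inv x i j : nilpotent_mx x ->
  poly_function (fun t => invmx (1%:M - t *: x) i j).
Proof.
move=> [k xk].
have E t : invmx (1%:M - t *: x) = \sum_(l < k) t ^+ l *: x ^+ l.
  have U : 1%:M - t *: x \in unitmx by apply/nilpotent_unitB/nilpotentZ; exists k.
  apply: (can_inj (mulKmx U)); rewrite mulmxV//.
  have := subrX1 (t *: x) k; rewrite exprZmx xk scaler0 sub0r -mulmxE => /(congr1 -%R).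
  rewrite opprK -mulNmx opprB => E1; apply: (etrans E1); congr (_ *m _).
  by apply: eq_bigr => l _; rewrite exprZmx.
have [S0 SD SM] := poly_function_subring C.
rewrite [X in poly_function X](_ : _ = fun t => \sum_(l < k) t ^+ l * (x ^+ l) i j); last first.
  by apply/funext => t; rewrite E summxE; apply: eq_bigr => l _; rewrite mxE.
apply: (subring_sum _ _ (poly_function_subring C)) => l.
apply: (SM (fun t => t ^+ l) (fun=> _)); last exact: S0.
by exists 'X^l => t; rewrite hornerXn.
Qed.

Lemma poly_function_cayley x i j : nilpotent_mx x ->
  poly_function (fun t => cayley (t *: x) i j).
Proof.
move=> nx; apply: (subring_mul (S := [set f | poly_function f])).
- exact: poly_function_subring.
- move=> k l /=.
  rewrite [X in poly_function X](_ : _ = fun t => (1%:M : 'M[C]_N) k l + t * x k l).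
    exact: poly_function_aff.
  by apply/funext => t; rewrite !mxE.
- by move=> k l; apply: poly_function_inv.
Qed.

Lemma cayleyV x : 1%:M - x \in unitmx -> 1%:M + x \in unitmx ->
  cayley x \in unitmx /\ \det (cayley (- x)) = (\det (cayley x))^-1.
Proof.
move=> U1 U2; split; first by rewrite unitmx_mul U2 unitmx_inv.
by rewrite /cayley opprK !det_mulmx !det_inv invfM invrK mulrC.
Qed.

Lemma cayley_sub1 x : 1%:M - x \in unitmx ->
  cayley x - 1%:M = 2 *: (x *m invmx (1%:M - x)).
Proof.
move=> U; apply: (can_inj (mulmxK U)).
rewrite /cayley mulmxBl mul1mx mulmxKV// -scalemxAl mulmxKV//.
by rewrite opprB addrC addrA subrK -mulr2n scaler_nat.
Qed.

Lemma germ_cayley x : germ_mx (fun t => cayley (t *: x)) 1%:M (2 *: x).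
Proof.
have := germ_mxM (germ_mx_line 1%:M x) (germ_mx_inv (- x)).
rewrite !mulmx1 mul1mx opprK -mulr2n -scaler_nat => H i j.
by have := H i j; under [X in germ X _ _ -> _]funext do rewrite scalerN.
Qed.

(** Irreducibility of the affine line: nonzero polynomials vanishing where the curve is in A1,
    respectively in A2, would have product 0. *)
Lemma zariski_curve (F : C -> 'M[C]_N) (D : C -> C) A1 A2 :
  (forall i j, poly_function (fun t => F t i j)) -> poly_function D ->
  (forall t, GL C N (F t) /\ D t = (\det (F t))^-1) ->
  zariski_closed A1 -> zariski_closed A2 -> (forall t, A1 (F t) \/ A2 (F t)) ->
  (forall t, A1 (F t)) \/ (forall t, A2 (F t)).
Proof.
move=> pF pD FD cA1 cA2 FA.
have key f : regular_function f -> poly_function (fun t => f (F t)).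
  move=> [p pf].
  rewrite [X in poly_function X](_ : _ = fun t => p.@[row_mx (mxvec (F t)) (D t)%:M 0]).
    apply: (subring_regular (S := [set f | poly_function f])) => //.
    exact: poly_function_subring.
  by apply/funext => t; have [Gt ->] := FD t; rewrite -pf.
have sep A : zariski_closed A -> ~ (forall t, A (F t)) ->
    exists2 p : {poly C}, p != 0 & forall t, A (F t) -> p.[t] = 0.
  move=> cA /existsNP[t nAt]; have [_ AP] := zariski_closedP cA.
  have [Gt _] := FD t.
  have /existsNP[f /not_implyP[Rf /not_implyP[fA ft]]] : ~ forall f, regular_function f ->
     (forall h, A h -> f h = 0) -> f (F t) = 0.
    by move=> H; apply: nAt; apply: AP.
  have [p pE] := key _ Rf; exists p.
    by apply: (@poly_neq0_at _ _ t); rewrite -pE; apply/eqP.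
  by move=> s /fA; rewrite pE.
apply: contrapT => /not_orP[/sep-/(_ cA1)[p p0 pA1] /sep-/(_ cA2)[q q0 qA2]].
suff E : p = 0 by rewrite E eqxx in p0.
apply: (poly_vanish q0) => t qt; case: (FA t) => [/pA1//|/qA2 qt0].
by rewrite qt0 eqxx in qt.
Qed.

End Cayley.

(** * Unipotent groups and nilpotent algebras attached to P-stable flags *)

Section Chains.

Variables (C : numClosedFieldType) (N : nat).
Implicit Types (g h x y : 'M[C]_N) (G P : set 'M[C]_N) (V : nat -> 'M[C]_N).

Lemma stablemx_inv m (W : 'M[C]_(m, N)) g : g \in unitmx -> stablemx W g -> stablemx W (invmx g).
Proof.
move=> Ug sW; have rWg : \rank (W *m g) = \rank W by rewrite mxrankMfree// row_free_unit.
have /eqmxP eW : (W *m g == W)%MS by rewrite -(mxrank_leqif_eq sW) rWg.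
by rewrite -(eqmxMr _ eW) mulmxK.
Qed.

Lemma comm_mx_inv x y : comm_mx x y -> y \in unitmx -> comm_mx x (invmx y).
Proof.
move=> xy Uy; apply: (can_inj (mulmxK Uy)).
by rewrite mulmxKV// -mulmxA [x *m y]xy mulKmx.
Qed.

(** V is meant to be a descending flag; d = 1 says that y is strictly block triangular for it. *)
Definition lowers V d y := forall i, (V i *m y <= V (i + d)%N)%MS.

Definition chain_group G V d : set 'M[C]_N := [set g | G g /\ lowers V d (g - 1%:M)].

Definition chain_algebra G V : set 'M[C]_N := [set x | Lie G x /\ lowers V 1 x].

Variables (V : nat -> 'M[C]_N) (r : nat).
Hypotheses (V0 : (1%:M <= V 0)%MS) (Vr : V r = 0) (VS : forall i, (V i.+1 <= V i)%MS).

Let VD i d : (V (i + d)%N <= V i)%MS.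
Proof.
elim: d => [|d IH]; first by rewrite addn0.
by rewrite addnS; apply: submx_trans (VS _) IH.
Qed.

Lemma lowers0 d : lowers V d 0.
Proof. by move=> i; rewrite mulmx0 sub0mx. Qed.

Lemma lowers_lin d a x y : lowers V d x -> lowers V d y -> lowers V d (a *: x + y).
Proof. by move=> lx ly i; rewrite mulmxDr -scalemxAr addmx_sub ?scalemx_sub. Qed.

Lemma lowersD d x y : lowers V d x -> lowers V d y -> lowers V d (x + y).
Proof. by move=> lx ly; rewrite -[x]scale1r; apply: lowers_lin. Qed.

Lemma lowersZ d a x : lowers V d x -> lowers V d (a *: x).
Proof. by move=> lx; rewrite -[_ *: x]addr0; apply: lowers_lin => //; apply: lowers0. Qed.

Lemma lowersN d x : lowers V d x -> lowers V d (- x).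
Proof. by move=> lx; rewrite -scaleN1r; apply: lowersZ. Qed.

Lemma lowersM d e x y : lowers V d x -> lowers V e y -> lowers V (d + e) (x *m y).
Proof.
by move=> lx ly i; rewrite mulmxA addnA; apply: submx_trans (submxMr _ (lx i)) (ly _).
Qed.

Lemma lowers_leq d e x : (e <= d)%N -> lowers V d x -> lowers V e x.
Proof. by move=> /subnKC <- lx i; apply: submx_trans (lx i) _; rewrite addnA VD. Qed.

Lemma lowers_stable d x y : lowers V d x -> (forall i, stablemx (V i) y) -> lowers V d (x *m y).
Proof. by move=> lx sy; rewrite -[d]addn0; apply: lowersM => // i; rewrite addn0. Qed.

Lemma stable_lowers d x y : lowers V d x -> (forall i, stablemx (V i) y) -> lowers V d (y *m x).
Proof. by move=> lx sy; rewrite -[d]add0n; apply: lowersM => // i; rewrite addn0. Qed.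

Lemma lowers_nilpotent x : lowers V 1 x -> nilpotent_mx x.
Proof.
move=> lx; exists r.
have H k : lowers V k (x ^+ k).
  elim: k => [|k IH]; first by move=> i; rewrite expr0 mulmx1 addn0.
  by rewrite exprS -addn1 addnC; apply: lowersM.
apply/eqP; rewrite -[x ^+ r]mul1mx -submx0.
by apply: submx_trans (submxMr _ V0) _; apply: submx_trans (H r 0%N) _; rewrite Vr.
Qed.

Lemma lowers_stable1 d g : lowers V d (g - 1%:M) -> forall i, stablemx (V i) g.
Proof.
move=> lg i; rewrite -[g](subrK 1%:M) mulmxDr mulmx1 addmx_sub//.
exact: submx_trans (lg i) (VD _ _).
Qed.

Lemma chain_group_subgroup G d : is_subgroup G -> is_subgroup (chain_group G V d).
Proof.
move=> [GGL G1 GM GV]; split.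
- by move=> g [/GGL].
- by split=> //; rewrite subrr; apply: lowers0.
- move=> g h [Gg lg] [Gh lh]; split; first exact: GM.
  have -> : g *m h - 1%:M = (g - 1%:M) *m h + (h - 1%:M).
    by rewrite mulmxBl mul1mx addrA subrK.
  by apply: lowersD => //; apply: lowers_stable => //; apply: lowers_stable1 lh.
- move=> g [Gg lg]; split; first exact: GV.
  have Ug : g \in unitmx by apply: GGL.
  have -> : invmx g - 1%:M = - ((g - 1%:M) *m invmx g) by rewrite mulmxBl mulmxV// mul1mx opprB.
  apply/lowersN/lowers_stable => // i; apply: stablemx_inv => //.
  exact: lowers_stable1 lg i.
Qed.

(** g h g^-1 h^-1 - 1 = [g - 1, h - 1] g^-1 h^-1 has level 2d, which is at least d + 1. *)
Lemma chain_group_derived G d : is_subgroup G -> (0 < d)%N ->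
  derived_subgroup (chain_group G V d) `<=` chain_group G V d.+1.
Proof.
move=> sG d0; have [GGL G1 GM GV] := sG.
apply: derived_min; first exact: chain_group_subgroup.
move=> g h [Gg lg] [Gh lh]; split.
  exact: (subgroup_comm sG Gg Gh).
have [Ug Uh] := (GGL _ Gg, GGL _ Gh).
have -> : g *m h *m invmx g *m invmx h - 1%:M =
   ((g - 1%:M) *m (h - 1%:M) - (h - 1%:M) *m (g - 1%:M)) *m invmx g *m invmx h.
  have -> : (g - 1%:M) *m (h - 1%:M) - (h - 1%:M) *m (g - 1%:M) = g *m h - h *m g.
    rewrite !mulmxBl !mulmxBr !mul1mx !mulmx1; move: (g *m h) (h *m g) => a b.
    by apply/matrixP => i j; rewrite !mxE; ring.
  by rewrite !mulmxBl mulmxK// mulmxV.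
apply: lowers_stable => [|i]; last exact: stablemx_inv (lowers_stable1 lh i).
apply: lowers_stable => [|i]; last exact: stablemx_inv (lowers_stable1 lg i).
have le : (d.+1 <= d + d)%N by rewrite -add1n leq_add2r.
by apply: lowersD; [|apply: lowersN]; apply: lowers_leq le _; apply: lowersM.
Qed.

Lemma chain_group_solvable G : is_subgroup G -> solvable_group (chain_group G V 1).
Proof.
move=> sG; exists r.
have H k : iter k (@derived_subgroup C N) (chain_group G V 1) `<=` chain_group G V k.+1.
  elim: k => //= k IH; apply: subset_trans (derived_mono IH) _.
  exact: chain_group_derived.
apply: subset_trans (H r) _ => g [_ lg] /=.
apply/eqP; rewrite -subr_eq0 -[_ - _]mul1mx -submx0.
apply: submx_trans (submxMr _ V0) _; apply: submx_trans (lg 0%N) _.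
by rewrite -Vr add0n; apply: VS.
Qed.

Lemma chain_group_closed G d : zariski_closed G -> zariski_closed (chain_group G V d).
Proof.
move=> cG; have [GGL _] := zariski_closedP cG.
pose S : set ('M[C]_N -> C) := [set f | exists i k l, f =
   fun g => (V i *m g *m cokermx (V (i + d)%N)) k l - (V i *m cokermx (V (i + d)%N)) k l].
rewrite (_ : chain_group G V d = G `&` [set g | GL C N g /\ forall f, S f -> f g = 0]).
  apply: zariski_closedI => //; apply: (zariski_closed_zeros (S := S)) => _ [i [k [l ->]]].
  have [R0 RD _] := regular_subring C N.
  apply: (RD (fun g => (V i *m g *m cokermx (V (i + d)%N)) k l) (fun=> _)).
    exact: regular_mul3.
  exact: R0.
have E i g : (V i *m (g - 1%:M) <= V (i + d)%N)%MS =
    (V i *m g *m cokermx (V (i + d)%N) == V i *m cokermx (V (i + d)%N)).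
  by rewrite submxE mulmxBr mulmxBl mulmx1 subr_eq0.
apply/seteqP; split=> g [Gg H]; split=> //.
  split; first exact: GGL.
  by move=> _ [i [k [l ->]]]; have := H i; rewrite E => /eqP ->; rewrite subrr.
move=> i; rewrite E; apply/eqP/matrixP => k l; apply/subr0_eq.
by apply: (H.2 (fun g => (V i *m g *m cokermx (V (i + d)%N)) k l -
  (V i *m cokermx (V (i + d)%N)) k l)); exists i, k, l.
Qed.

Variable G : set 'M[C]_N.
Hypothesis cG : cayley_group G.

Let sG : is_subgroup G. Proof. by case: cG => -[]. Qed.
Let GGL : G `<=` GL C N. Proof. by case: sG. Qed.

Lemma cayley_chain x : chain_algebra G V x -> chain_group G V 1 (cayley x).
Proof.
move=> [Gx lx]; have nx := lowers_nilpotent lx.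
have [U1 U2] := (nilpotent_unitB nx, nilpotent_unitD nx).
split; first by case: cG => _ + _ _; apply.
rewrite cayley_sub1//; apply/lowersZ/lowers_stable => // i.
apply: stablemx_inv => //; rewrite mulmxBr mulmx1 addmx_sub// eqmx_opp.
exact: submx_trans (lx i) (VD _ _).
Qed.

Lemma chain_algebraZ a x : chain_algebra G V x -> chain_algebra G V (a *: x).
Proof.
move=> [Gx lx]; split; last exact: lowersZ.
by rewrite -[_ *: x]addr0; apply: Lie_lin => //; apply: Lie0.
Qed.

(** The inverse Cayley transform is defined here: 1 + g = 2 (1 + (g - 1) / 2) is invertible since g
    - 1 is nilpotent. *)
Lemma cayley_chain_inv g : chain_group G V 1 g ->
  exists2 x, chain_algebra G V x & g = cayley x.
Proof.
move=> [Gg lg]; have ng := lowers_nilpotent lg.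
have two0 : (2 : C) != 0 by rewrite pnatr_eq0.
have Eg : 1%:M + g = 2 *: (1%:M + 2^-1 *: (g - 1%:M)).
  by rewrite scalerDr scalerA mulfV// scale1r scaler_nat mulr2n addrACA subrr addr0.
have U : 1%:M + g \in unitmx.
  by rewrite Eg unitmxZ ?unitfE//; apply/nilpotent_unitD/nilpotentZ.
exists ((g - 1%:M) *m invmx (1%:M + g)).
  split; first by case: cG => _ _ + _; apply.
  apply: lowers_stable => // i; apply: stablemx_inv => //.
  by rewrite mulmxDr mulmx1 addmx_sub//; apply: lowers_stable1 lg i.
rewrite /cayley; set x := _ *m invmx (1%:M + g).
have E1 : 1%:M - x = 2 *: invmx (1%:M + g).
  apply: (can_inj (mulmxK U)); rewrite mulmxBl mulmxKV// mul1mx -scalemxAl mulVmx//.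
  by rewrite opprB addrACA subrr addr0 scaler_nat.
have E2 : 1%:M + x = 2 *: (g *m invmx (1%:M + g)).
  apply: (can_inj (mulmxK U)); rewrite mulmxDl mulmxKV// mul1mx -scalemxAl mulmxKV//.
  by rewrite addrC addrA subrK scaler_nat.
rewrite E1 E2 invmxZ; last by rewrite -E1 E1 unitmxZ ?unitmx_inv// unitfE.
by rewrite invmxK -scalemxAl -scalemxAr scalerA mulfV// scale1r mulmxKV.
Qed.

(** Each element is joined to 1 inside the group by the polynomial curve t -> cayley(t x). Such a
    curve lies wholly in A1 or wholly in A2, and the point 1, common to all of them, decides
    which. *)
Lemma chain_group_connected : zariski_connected (chain_group G V 1).
Proof.
move=> A1 A2 cA1 cA2 sA dA.
have U1 : chain_group G V 1 1%:M by have [_ +] := chain_group_subgroup 1 sG.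
have E0 g : chain_group G V 1 g -> A1 g -> A2 g -> False.
  by move=> h1 h2 h3; suff : set0 g by []; rewrite -dA.
have key g : chain_group G V 1 g -> exists F : C -> 'M[C]_N, [/\ F 0 = 1%:M, F 1 = g,
    (forall t, chain_group G V 1 (F t)) &
    (forall t, A1 (F t)) \/ (forall t, A2 (F t))].
  move=> /cayley_chain_inv[x ux ->]; have [_ /lowers_nilpotent nx] := ux.
  have UF t : chain_group G V 1 (cayley (t *: x)) by apply/cayley_chain/chain_algebraZ.
  exists (fun t => cayley (t *: x)); split=> //.
  - by rewrite scale0r /cayley addr0 subr0 invmx1 mulmx1.
  - by rewrite scale1r.
  apply: (@zariski_curve _ _ _ (fun t => \det (cayley (- (t *: x))))) => //.
  - by move=> i j; apply: poly_function_cayley.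
  - apply: (subring_det (poly_function_subring C)) => i j /=.
    rewrite [X in poly_function X](_ : _ = fun t => cayley (t *: (- x)) i j); last first.
      by apply/funext => t; rewrite scalerN.
    by apply: poly_function_cayley; apply: nilpotentN.
  - by move=> t; apply: cayleyV; [apply/nilpotent_unitB/nilpotentZ|apply/nilpotent_unitD/nilpotentZ].
  - by move=> t; apply: sA.
case: (sA _ U1) => A1'; [left|right] => g /key[F [F0 F1 UF [AF|AF]]];
  rewrite -F1 //; exfalso; apply: (E0 1%:M) => //; rewrite -F0 //.
Qed.

Variable P : set 'M[C]_N.
Hypotheses (pP : parabolic_subgroup P G) (PV : forall g, P g -> forall i, stablemx (V i) g).

Let sP : is_subgroup P. Proof. by case: pP => -[]. Qed.
Let PGL : P `<=` GL C N. Proof. by case: sP. Qed.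
Let PG : P `<=` G. Proof. by case: pP => -[]. Qed.

Lemma normal_chain_group : normal_in (chain_group G V 1) P.
Proof.
move=> g u Pg [Gu lu]; have [_ _ GM GV] := sG; have Gg := PG Pg; have Ug := GGL Gg.
split; first by apply: (GM); [exact: GM|exact: GV].
have -> : g *m u *m invmx g - 1%:M = g *m (u - 1%:M) *m invmx g.
  by rewrite mulmxBr mulmxBl mulmx1 mulmxV.
apply: lowers_stable => [|i]; last by apply: stablemx_inv => //; apply: PV.
by apply: stable_lowers => // i; apply: PV.
Qed.

(** P stabilizes the flag, so a Borel subgroup inside P normalizes the chain group and contains it
    by [borel_contains]. *)
Lemma chain_group_parabolic : chain_group G V 1 `<=` P.
Proof.
have [_ [B bB BP]] := pP.
suff UB : chain_group G V 1 `<=` B by exact: subset_trans BP.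
apply: (borel_contains _ bB) => //.
- by case: cG.
- exact: chain_group_subgroup.
- by move=> g [].
- exact: chain_group_connected.
- exact: chain_group_solvable.
- by move=> b u /BP; apply: normal_chain_group.
Qed.

Lemma chain_group_radical : chain_group G V 1 `<=` unipotent_radical P.
Proof.
move=> g Ug; exists (chain_group G V 1); split=> //.
- split; first exact: chain_group_subgroup.
  + by apply: chain_group_closed; case: cG => -[].
  + exact: chain_group_parabolic.
- exact: chain_group_connected.
- exact: normal_chain_group.
- by move=> u [_ /lowers_nilpotent].
Qed.

Lemma chain_algebra_Lie : chain_algebra G V `<=` Lie P.
Proof.
move=> x ux; have two0 : (2 : C) != 0 by rewrite pnatr_eq0.
have -> : x = 2^-1 *: (2 *: x) + 0 by rewrite addr0 scalerA mulVf// scale1r.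
apply: Lie_lin; last exact: Lie0.
apply: (@Lie_curve _ _ _ (fun t => cayley (t *: x)) _ 1); last exact: germ_cayley.
  by rewrite hornerE oner_neq0.
by move=> t _; apply/chain_group_parabolic/cayley_chain/chain_algebraZ.
Qed.

(** The source of explicit elements of the nilradical: lowering a P-stable flag is preserved by
    brackets with Lie P and forces nilpotency. *)
Lemma chain_algebra_nilradical : chain_algebra G V `<=` nilradical (Lie P).
Proof.
apply: nilradical_max; last by move=> y [_ /lowers_nilpotent].
split; first exact: chain_algebra_Lie.
- by split; [exact: Lie0|exact: lowers0].
- by move=> a x y [Gx lx] [Gy ly]; split; [exact: Lie_lin|exact: lowers_lin].
- move=> x y Px [Gy ly]; split.
    by apply: Lie_bracket => //; apply: Lie_sub Px.
  have sx i : stablemx (V i) x by apply: Lie_stable Px => // g Pg; apply: PV.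
  by apply: lowersD; [apply: stable_lowers|apply/lowersN/lowers_stable].
Qed.

(** The Cayley transforms of x and y lie in the unipotent radical and commute; z is a rational
    expression in cayley z, so commuting passes back to the algebra. *)
Lemma chain_algebra_abelian x y : abelian_group (unipotent_radical P) ->
  chain_algebra G V x -> chain_algebra G V y -> x *m y = y *m x.
Proof.
move=> abP ux uy.
have := abP _ _ (chain_group_radical (cayley_chain ux)) (chain_group_radical (cayley_chain uy)).
have two0 : (2 : C) != 0 by rewrite pnatr_eq0.
have key z m : chain_algebra G V z -> comm_mx m (cayley z) -> comm_mx m z.
  move=> [_ /lowers_nilpotent nz] mz.
  have U := nilpotent_unitB nz.
  have E1 : 1%:M + cayley z = 2 *: invmx (1%:M - z).
    apply: (can_inj (mulmxK U)); rewrite mulmxDl mul1mx mulmxKV// -scalemxAl mulVmx//.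
    by rewrite addrACA addNr addr0 scaler_nat.
  have Uc : 1%:M + cayley z \in unitmx by rewrite E1 unitmxZ ?unitmx_inv// unitfE.
  have -> : z = (cayley z - 1%:M) *m invmx (1%:M + cayley z).
    rewrite cayley_sub1// E1 invmxZ ?unitmxZ ?unitmx_inv ?unitfE// invmxK.
    by rewrite -scalemxAl -scalemxAr scalerA mulfV// scale1r mulmxKV.
  apply: comm_mxM; first by apply: comm_mxB => //; apply: comm_mx1.
  by apply: comm_mx_inv => //; apply: comm_mxD => //; apply: comm_mx1.
by move=> cxy; apply: (key) => //; apply: comm_mx_sym; apply: (key).
Qed.

End Chains.

(** * The exponential of nilpotent matrices *)

Section Exponential.

Variables (C : numClosedFieldType) (N : nat).
Implicit Types (x y : 'M[C]_N).

Lemma nilpotent_exprN x : nilpotent_mx x -> x ^+ N = 0.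
Proof.
move=> nx; apply: (@engel_nilpotent _ _ [set y | exists a : C, y = a *: x]); last first.
  by exists 1; rewrite scale1r.
apply: engel_thm.
- split=> [|a _ _ [b ->] [c ->]]; first by exists 0; rewrite scale0r.
  by exists (a * b + c); rewrite scalerDl scalerA.
- by move=> _ [a ->]; apply: nilpotentZ.
- move=> _ _ [a ->] [b ->]; exists 0.
  by rewrite -!scalemxAl -!scalemxAr !scalerA mulrC subrr scale0r.
Qed.

(** Both sides are polynomials in x whose coefficients agree up to degree N + 1 by the binomial
    formula; the higher powers of x vanish. The case N = 0 is trivial. *)
Lemma expmxD x s t : nilpotent_mx x -> expmx ((s + t) *: x) = expmx (s *: x) *m expmx (t *: x).
Proof.
move=> /nilpotent_exprN; case: N x => [|n] x xN.
  by rewrite [LHS]flatmx0 [RHS]flatmx0.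
pose e u := \poly_(i < n.+3) (u ^+ i / i`!%:R) : {poly C}.
have evE p : horner_mx x p = \sum_(k < n.+3) p`_k *: x ^+ k.
  rewrite -{1}(poly_take_drop n.+3 p) rmorphD rmorphM /= rmorphXn /= horner_mx_X.
  have -> : x ^+ n.+3 = 0 by rewrite (_ : n.+3 = 2 + n.+1)%N// exprD xN mulr0.
  rewrite mulr0 addr0 /take_poly poly_def rmorph_sum /=; apply: eq_bigr => k _.
  by rewrite -mul_polyC rmorphM /= horner_mx_C rmorphXn /= horner_mx_X -mulmxE mul_scalar_mx.
have eE u : horner_mx x (e u) = expmx (u *: x).
  rewrite evE /expmx; apply: eq_bigr => k _ /=; rewrite coef_poly ltn_ord exprZmx scalerA.
  by rewrite mulrC.
rewrite -!eE mulmxE -rmorphM evE [RHS]evE; apply: eq_bigr => k _; congr (_ *: _).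
rewrite coef_poly ltn_ord coefM addrC exprDn mulr_suml; apply: eq_bigr => i _.
have ik : (i <= k)%N by rewrite -ltnS.
have lt_k m : (m <= k)%N -> (m < n.+3)%N by move=> mk; apply: leq_ltn_trans mk _.
rewrite !coef_poly !lt_k ?leq_subr// -mulr_natr.
have fact0 m : (m`!%:R : C) != 0 by rewrite pnatr_eq0 -lt0n fact_gt0.
have := bin_fact ik => /(congr1 (fun m => m%:R : C)); rewrite !natrM => <-.
have bin0 : ('C(k, i)%:R : C) != 0 by rewrite pnatr_eq0 -lt0n bin_gt0.
by field; rewrite !fact0 bin0.
Qed.

Lemma expmx0 : expmx (0 : 'M[C]_N) = 1%:M.
Proof.
rewrite /expmx big_ord_recl /= big1 ?addr0 ?expr0 ?fact0 ?invr1 ?scale1r// => i _.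
by rewrite exprS -mulmxE mul0mx scaler0.
Qed.

Lemma expmxN x t : nilpotent_mx x -> expmx (t *: x) *m expmx (- t *: x) = 1%:M.
Proof. by move=> nx; rewrite -expmxD// subrr scale0r expmx0. Qed.

Lemma poly_function_expmx x i j : exists p : {poly C},
  [/\ forall t, expmx (t *: x) i j = p.[t], p`_0 = 1%:M i j & p`_1 = x i j].
Proof.
exists (\poly_(k < N.+2) ((k`!%:R)^-1 * (x ^+ k) i j)); split.
- move=> t; rewrite horner_poly summxE; apply: eq_bigr => k _.
  by rewrite exprZmx 2!mxE; ring.
- by rewrite coef_poly /= fact0 invr1 mul1r expr0.
- by rewrite coef_poly /= invr1 mul1r expr1.
Qed.

Lemma germ_poly (p : {poly C}) t : germ (fun s => p.[s + t]) p.[t] p^`().[t].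
Proof.
elim/poly_ind: p => [|p c IH].
  by under [X in germ X]funext do rewrite horner0; rewrite deriv0 horner0; apply: germ_cst.
under [X in germ X]funext do rewrite hornerD hornerM hornerX hornerC.
rewrite derivD derivM derivX derivC mulr1 addr0 !hornerD !hornerM !hornerX hornerC.
have gX : germ (fun s => s + t) t 1.
  have := germ_lin t 1; congr (germ _ t 1).
  by apply/funext => s; rewrite mul1r addrC.
have := germD (germM IH gX) (germ_cst c); rewrite addr0 mulr1; apply.
Qed.

Lemma germ_expmx x : germ_mx (fun t => expmx (t *: x)) 1%:M x.
Proof.
move=> i j; have [p [pE <- <-]] := poly_function_expmx x i j.
have := germ_poly p 0; rewrite !horner_coef0 coef_deriv mulr1n.
by congr germ; apply/funext => s; rewrite addr0 pE.
Qed.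

End Exponential.

(** * The differential of the involution maps nilradicals to nilradicals *)

Section ThetaNilradical.

Variables (C : numClosedFieldType) (N : nat).
Implicit Types (g h x y : 'M[C]_N) (P Z : set 'M[C]_N).
Variables (G : set 'M[C]_N) (theta : regular_map C N).
Hypotheses (cG : cayley_group G) (inv_theta : involution G theta).

Local Notation th := (eval_map theta).
Local Notation dth := (differential theta).

Let GG : closed_subgroup G (GL C N). Proof. by case: cG. Qed.
Let GGL : G `<=` GL C N. Proof. by case: GG. Qed.

(* M(t) = theta(exp(t x)) is polynomial in t and satisfies M' = dtheta(x) M, so *)
(* high powers of dtheta(x) vanish.                                             *)
Lemma dtheta_nilpotent x : Lie G x -> nilpotent_mx x -> nilpotent_mx (dth x).
Proof.
move=> Gx nx; pose E t := expmx (t *: x); pose X := dth x.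
have GE t : G (E t).
  case: cG => _ _ _; apply; last exact: nilpotentZ.
  by rewrite -[_ *: x]addr0; apply: Lie_lin => //; apply: Lie0.
have thM g h : G g -> G h -> th (g *m h) = th g *m th h by case: inv_theta => _ + _; apply.
have polyE i j : poly_function (fun t => E t i j).
  by have [p [pE _ _]] := poly_function_expmx x i j; exists p.
have detE t : \det (E (- t)) = (\det (E t))^-1.
  have Ut : E t \in unitmx by apply: GGL.
  by rewrite -det_inv; congr (\det _); apply: (can_inj (mulKmx Ut)); rewrite expmxN// mulmxV.
(* The entries of theta(exp(t x)) are polynomial in t because 1 / det exp(t x) = det exp(- t x)
   is. *)
have /all_sig[M ME] : forall ij : 'I_N * 'I_N, {p : {poly C} |
    forall t, th (E t) ij.1 ij.2 = p.[t]}.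
  move=> [i j]; apply: cid => /=.
  suff [p pE] : poly_function (fun t =>
      (theta i j).@[row_mx (mxvec (E t)) (\det (E (- t)))%:M 0]).
    by exists p => t; rewrite -pE mxE /eval_regular detE.
  apply: (subring_regular (S := [set f | poly_function f])) => //.
    exact: poly_function_subring.
  apply: (subring_det (poly_function_subring C)) => k l /=.
  have [p pE] := polyE k l; exists (p \Po (- 'X)) => t.
  by rewrite horner_comp hornerN hornerX pE.
have dM i j : (M (i, j))^`() = \sum_k X i k *: M (k, j).
  apply/eqP; rewrite -subr_eq0; apply/eqP; apply: (poly_vanish (oner_neq0 _)) => t _.
  rewrite hornerD hornerN; apply/eqP; rewrite subr_eq0; apply/eqP.
  have g1 := germ_poly (M (i, j)) t.
  have g2 := germ_mxM (germ_theta GG inv_theta (germ_expmx x)) (germ_mx_cst (th (E t))) i j.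
  have one0 : (1 : {poly C}).[0] != 0 by rewrite hornerC oner_neq0.
  have [|_ ->] := germ_uniq one0 _ g1 g2.
    by move=> s _; rewrite -(ME (i, j)) /= -(thM (E s) (E t))// /E -expmxD.
  rewrite mulmx0 addr0 mxE horner_sum; apply: eq_bigr => k _.
  by rewrite hornerZ -(ME (k, j)).
have dnM n i j : (M (i, j))^`(n) = \sum_k (X ^+ n) i k *: M (k, j).
  elim: n i j => [|n IH] i j.
    rewrite expr0 (bigD1 i)//= mxE eqxx scale1r big1 ?addr0// => k ki.
    by rewrite mxE eq_sym (negPf ki) scale0r.
  rewrite derivnS IH raddf_sum /= (eq_bigr (fun k => \sum_l ((X ^+ n) i k * X k l) *: M (l, j))).
    rewrite exchange_big /=; apply: eq_bigr => l _.
    by rewrite exprSr -mulmxE mxE scaler_suml.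
  move=> k _; rewrite derivZ dM scaler_sumr; apply: eq_bigr => l _.
  by rewrite scalerA.
(* The D-th derivative of M is both 0, by degree, and X^D M; at t = 0 the matrix M is the
   identity. *)
pose D := \max_ij size (M ij); exists D; apply/matrixP => i j; rewrite [RHS]mxE.
have : (M (i, j))^`(D) = 0 by apply: derivn_poly0; apply: (leq_bigmax (i, j)).
rewrite dnM => /(congr1 (fun p => p.[0])); rewrite horner_sum horner0 => H; rewrite -[RHS]H.
rewrite (bigD1 j)//= big1 ?addr0 => [|k kj]; rewrite hornerZ -ME /= /E scale0r expmx0;
  rewrite (theta1 GG inv_theta) mxE ?eqxx ?mulr1// (negPf kj) mulr0//.
Qed.

Lemma Lie_linear H : linear_set (@Lie C N H).
Proof. by split; [exact: Lie0|move=> *; apply: Lie_lin]. Qed.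

Lemma nilradical_Lie H x : nilradical (Lie H) x -> Lie H x.
Proof. by have [+ _ _ _] := nilradical_ideal (Lie_linear H); apply. Qed.

(** dtheta is a bracket-preserving involution of Lie G exchanging Lie P and Lie theta(P), so it
    carries ideals to ideals; [dtheta_nilpotent] keeps their elements nilpotent. *)
Lemma dtheta_nilradical P x : P `<=` G -> nilradical (Lie P) x ->
  nilradical (Lie (th @` P)) (dth x).
Proof.
move=> PG [I [[Ip I0 IL pI] nI Ix]].
have IG y : I y -> Lie G y by move=> /Ip; apply: Lie_sub.
exists (dth @` I); split; last by exists x.
  split.
  - by move=> _ [y /Ip Py <-]; apply: (Lie_theta GG inv_theta PG).
  - by exists 0; rewrite // dtheta0.
  - move=> a _ _ [y Iy <-] [z Iz <-]; exists (a *: y + z); first exact: IL.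
    exact: dtheta_lin.
  - move=> y _ Py' [z Iz <-].
    have thPG : th @` P `<=` G by exact: (image_theta_sub inv_theta PG).
    have Gy := Lie_sub thPG Py'.
    have Py : Lie P (dth y).
      by rewrite -(image_thetaK inv_theta PG); apply: (Lie_theta GG inv_theta).
    exists (dth y *m z - z *m dth y); first exact: pI.
    have Gz := IG _ Iz.
    rewrite (dtheta_bracket GG inv_theta Gz (Lie_sub PG Py)).
    by rewrite (dthetaK GG inv_theta Gy).
by move=> _ [y Iy <-]; apply: dtheta_nilpotent; [apply: IG|apply: nI].
Qed.

End ThetaNilradical.

(** * GL, Sp and SO as groups closed under Cayley transform and exponential *)

Section ClassicalGroups.

Variables (C : numClosedFieldType) (N : nat).
Implicit Types (g h x y B : 'M[C]_N) (G P : set 'M[C]_N).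

Lemma stable_addmx m (W : 'M[C]_(m, N)) x y : stablemx W x -> stablemx W y -> stablemx W (x + y).
Proof. by move=> sx sy; rewrite mulmxDr addmx_sub. Qed.

Lemma stable_oppmx m (W : 'M[C]_(m, N)) x : stablemx W x -> stablemx W (- x).
Proof. by move=> sx; rewrite mulmxN eqmx_opp. Qed.

Lemma stable_scalemx m (W : 'M[C]_(m, N)) a x : stablemx W x -> stablemx W (a *: x).
Proof. by move=> sx; rewrite -scalemxAr scalemx_sub. Qed.

Lemma stable_mul m (W : 'M[C]_(m, N)) x y : stablemx W x -> stablemx W y -> stablemx W (x *m y).
Proof. by move=> sx sy; rewrite mulmxA; apply: submx_trans (submxMr _ sx) sy. Qed.

Lemma stable_cayley m (W : 'M[C]_(m, N)) x : 1%:M - x \in unitmx -> stablemx W x ->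
  stablemx W (cayley x).
Proof.
move=> U sx; apply: stable_mul; first by apply: stable_addmx => //; rewrite mulmx1.
apply: stablemx_inv => //; apply: stable_addmx; first by rewrite mulmx1.
exact: stable_oppmx.
Qed.

Lemma Lie_cayley_curve P x :
  (forall t, 1%:M - t *: x \in unitmx -> 1%:M + t *: x \in unitmx -> P (cayley (t *: x))) ->
  Lie P x.
Proof.
move=> Px; have two0 : (2 : C) != 0 by rewrite pnatr_eq0.
have -> : x = 2^-1 *: (2 *: x) + 0 by rewrite addr0 scalerA mulVf// scale1r.
apply: Lie_lin; last exact: Lie0.
have [q1 q10 q1E] := det_line_poly x; have [q2 q20 q2E] := det_line_poly (- x).
apply: (@Lie_curve _ _ _ (fun t => cayley (t *: x)) _ (q1 * q2)); last exact: germ_cayley.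
  by rewrite hornerM mulf_neq0.
move=> t; rewrite hornerM mulf_eq0 negb_or q1E q2E scalerN => /andP[h1 h2].
by apply: Px; rewrite unitmx_det.
Qed.

Lemma Lie_stabilizer G (W x : 'M[C]_N) : cayley_group G -> Lie G x -> stablemx W x ->
  Lie (stabilizer G W) x.
Proof.
move=> cG Gx sx; apply: Lie_cayley_curve => t U1 U2; split.
  case: cG => _ + _ _; apply=> //.
  by rewrite -[_ *: x]addr0; apply: Lie_lin => //; apply: Lie0.
by apply: stable_cayley => //; apply: stable_scalemx.
Qed.

Lemma Lie_GL x : Lie (GL C N) x.
Proof.
by apply: Lie_cayley_curve => t U1 U2; rewrite /GL /= unitmx_mul U2 unitmx_inv.
Qed.

Lemma expmx_unit x : nilpotent_mx x -> expmx x \in unitmx.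
Proof.
move=> nx; have := expmxN 1 nx; rewrite scale1r => /mulmx1_unit[].
by [].
Qed.

Lemma cayley_group_GL : cayley_group (GL C N).
Proof.
split.
- by split=> //; [apply: GL_subgroup|apply: zariski_closedT].
- by move=> x _ U1 U2; rewrite /GL /= unitmx_mul U2 unitmx_inv.
- by move=> g _ _; apply: Lie_GL.
- by move=> x _; apply: expmx_unit.
Qed.

Definition skew_mx B x := x *m B + B *m x^T = 0.

Lemma skew_mxE B x : skew_mx B x -> x *m B = - (B *m x^T).
Proof. by move=> /eqP; rewrite addr_eq0 => /eqP. Qed.

(* This covers both SO B and Sp B, whose elements all have determinant 1. *)
Definition form_group B G :=
  [/\ closed_subgroup G (GL C N), B \in unitmx, (forall g, G g -> g *m B *m g^T = B)
    & forall g, g *m B *m g^T = B -> \det g = 1 -> G g].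

Lemma form_group_skew B G P x : form_group B G -> P `<=` G -> Lie P x -> skew_mx B x.
Proof.
move=> [[[GGL _ _ _] _ _] _ GB _] PG Px; apply/matrixP => i j; rewrite [RHS]mxE.
have [R0 RD RM] := regular_subring C N.
pose f g := (g *m B *m g^T) i j + -1 * B i j.
have Rf : regular_function f.
  apply: (RD (fun g => (g *m B *m g^T) i j) (fun=> -1 * B i j)); last exact: R0.
  apply: (subring_mul (regular_subring C N) (E := fun g => g *m B)) => k l /=.
    by apply: regular_mxM; [apply: regular_mx_id|apply: regular_mx_cst].
  rewrite [X in regular_function X](_ : _ = fun g => g l k); last by apply/funext => g; rewrite mxE.
  exact: regular_entry.
have gl := germ_mx_line 1%:M x.
have g1 := germ_mxM (germ_mxM gl (germ_mx_cst B)) (germ_mxT gl) i j.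
have gf : germ (fun t => f (1%:M + t *: x)) (B i j + -1 * B i j) ((x *m B + B *m x^T) i j).
  have := germD g1 (germ_cst (-1 * B i j)).
  by rewrite trmx1 !mulmx1 mul1mx mulmx0 !addr0; apply.
apply: (Lie_zero (subset_trans PG GGL) Rf _ gf Px) => g /PG/GB E.
by rewrite /f E mulN1r subrr.
Qed.

(** Moving B to the left past 1 + x and 1 - x turns them into the transposes of 1 - x and 1 + x.
    This gives the isometry, and equality of the two determinants. *)
Lemma skew_cayley B x : B \in unitmx -> skew_mx B x -> 1%:M - x \in unitmx ->
  1%:M + x \in unitmx -> cayley x *m B *m (cayley x)^T = B /\ \det (cayley x) = 1.
Proof.
move=> UB /skew_mxE xB; rewrite /cayley; set a := 1%:M + x; set b := 1%:M - x => Ub Ua.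
have aB : a *m B = B *m b^T.
  by rewrite /a /b mulmxDl mul1mx xB linearB /= mulmxBr trmx1 mulmx1.
have bB : b *m B = B *m a^T.
  by rewrite /a /b mulmxBl mul1mx xB linearD /= mulmxDr trmx1 mulmx1 opprK.
have UaT : a^T \in unitmx by rewrite unitmx_tr.
have UbT : b^T \in unitmx by rewrite unitmx_tr.
have abC : a^T *m b^T = b^T *m a^T.
  rewrite -!trmx_mul; congr (_^T); apply: comm_mxD; first exact: comm_mx1.
  by apply/comm_mx_sym/comm_mxB => //; exact: comm_mx1.
split.
  have -> : a *m invmx b *m B = B *m b^T *m invmx a^T.
    apply: (can_inj (mulmxK UaT)); rewrite -aB mulmxKV//.
    by rewrite -[_ *m B *m a^T]mulmxA -bB !mulmxA mulmxKV.
  have ab : b^T *m invmx a^T = invmx a^T *m b^T.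
    by apply: (can_inj (mulKmx UaT)); rewrite !mulmxA abC mulmxK// mulmxV// mul1mx.
  by rewrite trmx_mul trmx_inv -[_ *m b^T *m _]mulmxA ab !mulmxA mulmxK// mulmxKV.
have := congr1 determinant aB; rewrite !det_mulmx det_tr [RHS]mulrC.
move: UB Ub; rewrite !unitmx_det => UB Ub /(mulIf UB) ->.
by rewrite det_inv mulfV.
Qed.

Lemma skew_Lie B G x : form_group B G -> skew_mx B x -> Lie G x.
Proof.
move=> [_ UB _ BG] sx; apply: Lie_cayley_curve => t U1 U2.
have [|? ?] := skew_cayley UB _ U1 U2; last exact: BG.
by rewrite /skew_mx linearZ /= -scalemxAl -scalemxAr -scalerDr sx scaler0.
Qed.

Lemma expmx_skew B x : skew_mx B x -> nilpotent_mx x -> expmx x *m B *m (expmx x)^T = B.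
Proof.
move=> /skew_mxE xB nx.
have powB k : x ^+ k *m B = B *m ((- x) ^+ k)^T.
  elim: k => [|k IH]; first by rewrite !expr0 trmx1 mul1mx mulmx1.
  rewrite exprS -mulmxE -mulmxA IH mulmxA xB exprSr -mulmxE trmx_mul linearN /=.
  by rewrite !mulNmx mulmxN mulmxA.
have -> : expmx x *m B = B *m (expmx (- x))^T.
  rewrite /expmx mulmx_suml linear_sum mulmx_sumr; apply: eq_bigr => k _.
  by rewrite -scalemxAl powB linearZ /= -scalemxAr.
rewrite -mulmxA -trmx_mul; have := expmxN 1 nx; rewrite scaleN1r scale1r => ->.
by rewrite trmx1 mulmx1.
Qed.

Lemma form_group_cayley B G : form_group B G -> cayley_group G.
Proof.
move=> fG; have [cG UB GB BG] := fG; split=> //.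
- move=> x Gx U1 U2; have [|h1 h2] := skew_cayley UB _ U1 U2; last exact: BG.
  exact: (form_group_skew fG (fun _ => id) Gx).
- move=> g Gg U; apply: skew_Lie fG _.
  have gU : (g - 1%:M) *m invmx (1%:M + g) = invmx (1%:M + g) *m (g - 1%:M).
    apply: comm_mx_inv => //; apply: comm_mxD; first exact: comm_mx1.
    by apply/comm_mx_sym/comm_mxB => //; exact: comm_mx1.
  rewrite /skew_mx gU; set x := invmx _ *m _.
  suff E : (1%:M + g) *m (x *m B + B *m x^T) *m (1%:M + g)^T = 0.
    apply: (can_inj (mulKmx U)); apply: (can_inj (mulmxK (_ : (1%:M + g)^T \in unitmx))).
      by rewrite unitmx_tr.
    by rewrite E mulmx0 mul0mx.
  have Ux : (1%:M + g) *m x = g - 1%:M by rewrite mulmxA mulmxV// mul1mx.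
  clearbody x; rewrite mulmxDr mulmxDl !mulmxA Ux -[_ *m x^T *m _]mulmxA -trmx_mul Ux.
  rewrite !linearD /= linearN /= trmx1.
  rewrite !(mulmxDl, mulmxDr, mulNmx, mulmxN, mul1mx, mulmx1).
  have := GB _ Gg; move: (g *m B *m g^T) (g *m B) (B *m g^T) => a b c ->.
  by apply/matrixP => i j; rewrite !mxE; ring.
- move=> x Gx nx; have sx := form_group_skew fG (fun _ => id) Gx.
  apply: BG; first exact: expmx_skew.
  have sx2 : skew_mx B (2^-1 *: x).
    by rewrite /skew_mx linearZ /= -scalemxAl -scalemxAr -scalerDr sx scaler0.
  (* exp x is the square of the isometry exp(x / 2), whose determinant squares to 1. *)
  have := congr1 determinant (expmx_skew sx2 (nilpotentZ 2^-1 nx)).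
  rewrite !det_mulmx det_tr mulrAC => E.
  have dB : \det B != 0 by rewrite -unitmx_det.
  have two0 : (2 : C) != 0 by rewrite pnatr_eq0.
  have half2 : 2^-1 + 2^-1 = 1 :> C by field.
  have -> : x = (2^-1 + 2^-1) *: x by rewrite half2 scale1r.
  by rewrite expmxD// det_mulmx; apply: (mulIf dB); rewrite mul1r.
Qed.

Lemma form_group_Sp B : nondegenerate_alternating B -> closed_subgroup (Sp B) (GL C N) ->
  form_group B (Sp B).
Proof.
move=> [_ UB] cS; split=> // [g []//|g gB dg].
by split=> //; rewrite unitmx_det dg oner_neq0.
Qed.

Lemma form_group_SO B : nondegenerate_symmetric B -> closed_subgroup (SO B) (GL C N) ->
  form_group B (SO B).
Proof. by move=> [_ UB] cS; split=> // g []. Qed.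

End ClassicalGroups.

(** * Linear algebra of a symmetric or alternating form *)

Section Forms.

Variables (C : numClosedFieldType) (N : nat) (B : 'M[C]_N) (eps : C).
Hypotheses (UB : B \in unitmx) (BT : B^T = eps *: B) (eps1 : eps = 1 \/ eps = -1).
Implicit Types (u v e k : 'rV[C]_N) (x y z : 'M[C]_N) (W : 'M[C]_N).

Definition form u v : C := (u *m B *m v^T) 0 0.

Let epsK : eps * eps = 1.
Proof. by case: eps1 => ->; rewrite ?mulrNN mulr1. Qed.

Let eps0 : eps != 0.
Proof. by apply/eqP => e0; move: epsK; rewrite e0 mul0r => /esym/eqP; rewrite oner_eq0. Qed.

Lemma formE u v : u *m B *m v^T = (form u v)%:M.
Proof. by rewrite {1}[u *m B *m v^T]mx11_scalar. Qed.

Lemma formDl u1 u2 v : form (u1 + u2) v = form u1 v + form u2 v.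
Proof. by rewrite /form !mulmxDl mxE. Qed.

Lemma formZl a u v : form (a *: u) v = a * form u v.
Proof. by rewrite /form -!scalemxAl mxE. Qed.

Lemma formC u v : form u v = eps * form v u.
Proof.
rewrite /form -[u *m B *m v^T]trmxK [LHS]mxE !trmx_mul trmxK BT.
by rewrite -scalemxAl -scalemxAr mxE mulmxA.
Qed.

Lemma formDr u v1 v2 : form u (v1 + v2) = form u v1 + form u v2.
Proof. by rewrite formC formDl mulrDr -!formC. Qed.

Lemma formZr a u v : form u (a *: v) = a * form u v.
Proof. by rewrite formC formZl mulrCA -formC. Qed.

Lemma form0l v : form 0 v = 0.
Proof. by rewrite -(scale0r 0) formZl mul0r. Qed.

Lemma form0r v : form v 0 = 0.
Proof. by rewrite formC form0l mulr0. Qed.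

Lemma formNl u v : form (- u) v = - form u v.
Proof. by rewrite -scaleN1r formZl mulN1r. Qed.

Lemma form_sym0 u v : form u v = 0 -> form v u = 0.
Proof. by move=> uv; rewrite formC uv mulr0. Qed.

Lemma form_skew x u v : skew_mx B x -> form (u *m x) v = - form u (v *m x).
Proof.
move=> /skew_mxE xB; rewrite /form -[u *m x *m B]mulmxA xB trmx_mul.
by rewrite mulmxN mulNmx mxE !mulmxA.
Qed.

Lemma form_isom g u v : g *m B *m g^T = B -> form (u *m g) (v *m g) = form u v.
Proof.
by move=> gB; rewrite /form trmx_mul -[in RHS]gB !mulmxA.
Qed.

Lemma form_alt0 u : eps = -1 -> form u u = 0.
Proof.
move=> eN; have := formC u u; rewrite eN mulN1r => /eqP.
by rewrite -addr_eq0 -mulr2n mulrn_eq0 /= => /eqP.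
Qed.

Lemma form_skew_diag x u : eps = 1 -> skew_mx B x -> form (u *m x) u = 0.
Proof.
move=> e1 sx; have := form_skew u u sx; rewrite [X in _ = - X]formC e1 mul1r => /eqP.
by rewrite -addr_eq0 -mulr2n mulrn_eq0 /= => /eqP.
Qed.

Definition perp W := kermx (B *m W^T).

Lemma perpP u W : reflect (forall v, (v <= W)%MS -> form u v = 0) (u <= perp W)%MS.
Proof.
rewrite /perp; apply: (iffP sub_kermxP) => [uW v /submxP[w ->]|uW].
  by rewrite /form trmx_mul !mulmxA -[u *m B *m W^T]mulmxA uW mul0mx mxE.
apply/rowP => i; rewrite [RHS]mxE mulmxA.
have := uW _ (row_sub i W); rewrite /form tr_row => <-.
by rewrite !mxE; apply: eq_bigr => j _; rewrite !mxE.
Qed.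

Lemma rank_perp W : (\rank (perp W) + \rank W)%N = N.
Proof.
have -> : \rank W = \rank (B *m W^T).
  by rewrite -mxrank_tr -[RHS]mxrank_tr trmx_mul trmxK mxrankMfree ?mxrank_tr// row_free_unit unitmx_tr.
by rewrite mxrank_ker subnK// rank_leq_row.
Qed.

Lemma perpK W : (perp (perp W) :=: W)%MS.
Proof.
apply: eqmx_sym; apply/eqmxP.
have sW : (W <= perp (perp W))%MS.
  apply/row_subP => i; apply/perpP => v /perpP vW.
  by apply/form_sym0/vW/row_sub.
rewrite -(mxrank_leqif_eq sW); apply/eqP.
by apply: (@addIn (\rank (perp W))); rewrite rank_perp addnC rank_perp.
Qed.

Lemma perp_sub W1 W2 : (W1 <= W2)%MS -> (perp W2 <= perp W1)%MS.
Proof.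
move=> W12; apply/row_subP => i; apply/perpP => v vW1.
have /perpP := row_sub i (perp W2); apply; exact: submx_trans W12.
Qed.

Lemma form_nondeg u W : ~~ (u <= W)%MS -> exists2 v, (v <= perp W)%MS & form v u = 1.
Proof.
rewrite -(perpK W) => /perpP uW; apply: contrapT => nv; apply: uW => v vW.
apply/eqP/negPn/negP => uv; apply: nv; exists ((form v u)^-1 *: v); first exact: scalemx_sub.
rewrite formZl mulVf//; apply: contraNneq uv => /form_sym0 ->.
by [].
Qed.

Lemma form_dual e : e != 0 -> exists v, form v e = 1.
Proof. by rewrite -submx0 => /form_nondeg[v _ ve]; exists v. Qed.

Lemma perp_stable_skew W x : skew_mx B x -> stablemx W x -> stablemx (perp W) x.
Proof.
move=> sx sW; apply/row_subP => i; rewrite row_mul; apply/perpP => v vW.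
rewrite form_skew//; have /perpP -> := row_sub i (perp W); first by rewrite oppr0.
exact: submx_trans (submxMr _ vW) sW.
Qed.

Lemma perp_stable_isom W g : g \in unitmx -> g *m B *m g^T = B -> stablemx W g ->
  stablemx (perp W) g.
Proof.
move=> Ug gB sW; apply/row_subP => i; rewrite row_mul; apply/perpP => v vW.
rewrite -[v](mulmxKV Ug) form_isom//; have /perpP -> // := row_sub i (perp W).
by apply: submx_trans (submxMr _ vW) _; apply: stablemx_inv.
Qed.

(** The map u -> (u, e) v - eps (u, v) e: the exterior product e ^ v for eps = 1, the symmetric
    product for eps = -1, viewed in the Lie algebra of the form. *)
Definition wedge e v : 'M[C]_N := B *m e^T *m v - eps *: (B *m v^T *m e).

Lemma mulmx_wedge u e v : u *m wedge e v = form u e *: v - (eps * (form u v)) *: e.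
Proof.
by rewrite mulmxBr -scalemxAr !mulmxA !formE !mul_scalar_mx scalerA.
Qed.

Lemma eq_mulrow x y : (forall u, u *m x = u *m y) -> x = y.
Proof. by move=> H; apply/row_matrixP => i; rewrite !rowE H. Qed.

Lemma wedge_skew e v : skew_mx B (wedge e v).
Proof.
have trE (x y : 'M[C]_N) : (x - eps *: y)^T = x^T - eps *: y^T by rewrite linearB linearZ.
rewrite /skew_mx /wedge trE !trmx_mul !trmxK BT.
rewrite mulmxBl mulmxBr -!scalemxAl -!scalemxAr !mulmxA scalerA epsK scale1r.
by rewrite addrA subrK subrr.
Qed.

(** For eps = 1 and e nonzero, these are the elements of the nilradical attached to the isotropic
    line of e. *)
Definition line_type y := exists e u, [/\ form e e = 0, form e u = 0 & y = wedge e u].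

Lemma wedge_multiple e u s c : form u e = 1 -> wedge e s = c *: wedge e e ->
  s = (c - c * eps * form u e + eps * form u s) *: e.
Proof.
move=> ue /(congr1 (mulmx u)); rewrite -scalemxAr !mulmx_wedge ue !scale1r mulr1 => E.
by rewrite -[LHS](subrK ((eps * form u s) *: e)) E scalerBr scalerA !scalerDl scaleNr mulr1.
Qed.

Lemma wedge_eq0 e u s : form u e = 1 -> wedge e s = 0 -> s = (eps * form u s) *: e.
Proof.
move=> ue /(congr1 (mulmx u)); rewrite mulmx0 mulmx_wedge ue scale1r => /eqP.
by rewrite subr_eq0 => /eqP.
Qed.

(** All pairings vanish except those of v with v', leaving a Heisenberg-type relation. *)
Lemma comm_wedge W k k' v v' : (W <= perp W)%MS -> (k <= W)%MS -> (k' <= W)%MS ->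
  (v <= perp W)%MS -> (v' <= perp W)%MS ->
  wedge k v *m wedge k' v' - wedge k' v' *m wedge k v = (- eps * form v v') *: wedge k k'.
Proof.
move=> iW kW k'W vW v'W.
have f0 a b : (a <= W)%MS -> (b <= perp W)%MS -> form b a = 0.
  by move=> aW /perpP; apply.
have [kp k'p] := (submx_trans kW iW, submx_trans k'W iW).
have s a b : (a <= W)%MS -> (b <= perp W)%MS -> form a b = 0.
  by move=> aW bW; apply/form_sym0/f0.
apply: eq_mulrow => u; rewrite mulmxBr !mulmxA -scalemxAr.
rewrite [u *m wedge k v]mulmx_wedge [u *m wedge k' v']mulmx_wedge.
rewrite !mulmxBl -!scalemxAl !mulmx_wedge.
rewrite (f0 k' v)// (f0 k v')// (s k v')// (s k' v)// (s k k')// (s k' k)//.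
rewrite !mulr0 !scale0r !subr0 !sub0r !scaler0 !subr0 [form v' v]formC.
move: (form u k) (form u k') (form v v') => a b c.
apply/rowP => j; rewrite !mxE.
ring.
Qed.

Lemma comm_wedge_skew e v y : skew_mx B y -> e *m y = 0 ->
  wedge e v *m y - y *m wedge e v = wedge e (v *m y).
Proof.
move=> sy ey; apply: eq_mulrow => u; rewrite mulmxBr !mulmxA !mulmx_wedge.
rewrite mulmxBl -!scalemxAl ey scaler0 subr0 !form_skew// ey form0r oppr0 scale0r.
by rewrite mulrN scaleNr sub0r opprK.
Qed.

(** With (u0, e) = 1, every u is (u, e) u0 plus a vector orthogonal to e, which y sends to a
    multiple of e. Pairing with u0 finds the multiple, and y = e ^ (u0 y). *)
Lemma line_typeP e y : eps = 1 -> skew_mx B y -> e != 0 -> form e e = 0 -> e *m y = 0 ->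
  (forall v, form v e = 0 -> exists c, v *m y = c *: e) -> line_type y.
Proof.
move=> e1 sy e0 ee ey H; have [u0 u0e] := form_dual e0.
exists e, (u0 *m y); split=> //.
  have := form_skew e u0 sy; rewrite ey form0l => /eqP.
  by rewrite eq_sym oppr_eq0 => /eqP.
apply: eq_mulrow => u; rewrite mulmx_wedge.
have [|c uc] := H (u - form u e *: u0).
  by rewrite formDl formNl formZl u0e mulr1 subrr.
have u0y := form_skew_diag u0 e1 sy.
have eu0 : form e u0 = 1 by rewrite formC e1 mul1r.
have cE : c = - form u (u0 *m y).
  have := form_skew (u - form u e *: u0) u0 sy.
  rewrite uc formZl eu0 mulr1 formDl formNl formZl => ->.
  by rewrite [form u0 _]formC u0y mulr0 mulr0 subr0.
move: uc; rewrite mulmxBl -scalemxAl => /eqP; rewrite subr_eq => /eqP ->.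
by rewrite cE e1 mul1r addrC scaleNr.
Qed.

End Forms.

(** * The common kernel of the nilradical *)

Section NullSpace.

Variables (C : numClosedFieldType) (N : nat).
Implicit Types (g x y : 'M[C]_N) (P I : set 'M[C]_N) (v : 'rV[C]_N).

Definition comm_line (S : set 'M[C]_N) :=
  exists z, forall x y, S x -> S y -> exists c : C, x *m y - y *m x = c *: z.

Definition null_space I : 'M[C]_N := engel_next I 0.

Lemma null_spaceP I v : (v <= null_space I)%MS <-> forall y, I y -> v *m y = 0.
Proof.
rewrite engel_nextP; split=> H y /H; first by rewrite submx0 => /eqP.
by move=> ->; rewrite sub0mx.
Qed.

Lemma null_space_mul I y : I y -> null_space I *m y = 0.
Proof.
move=> Iy; apply/row_matrixP => i; rewrite row_mul row0.
by apply: (null_spaceP I _).1 Iy; apply: row_sub.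
Qed.

Lemma nilradical_Ad P g x : is_subgroup P -> P g -> nilradical (Lie P) x ->
  nilradical (Lie P) (g *m x *m invmx g).
Proof.
move=> [PGL P1 PM PV] Pg; have Ug : g \in unitmx by apply: PGL.
apply: nilradical_conj => // y Py.
  by apply: Lie_conj Py => // h Ph; apply: (PM); [apply: (PM)|apply: PV].
rewrite -{2}[g]invmxK; apply: Lie_conj Py => //; first exact: GL_inv.
by move=> h Ph; rewrite invmxK; apply: (PM) => //; apply: (PM) => //; apply: PV.
Qed.

Lemma engel_next_stable P g W : is_subgroup P -> P g -> stablemx W g ->
  stablemx (engel_next (nilradical (Lie P)) W) g.
Proof.
move=> sP Pg sW; have [PGL _ _ _] := sP; have Ug : g \in unitmx by apply: PGL.
apply/row_subP => i; rewrite row_mul; apply/engel_nextP => y ny.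
have /engel_nextP/(_ _ (nilradical_Ad sP Pg ny)) H := row_sub i (engel_next (nilradical (Lie P)) W).
have -> : row i (engel_next (nilradical (Lie P)) W) *m g *m y =
   row i (engel_next (nilradical (Lie P)) W) *m (g *m y *m invmx g) *m g.
  by rewrite !mulmxA mulmxKV.
by apply: submx_trans (submxMr _ H) sW.
Qed.

Lemma null_space_stable P g : is_subgroup P -> P g ->
  stablemx (null_space (nilradical (Lie P))) g.
Proof. by move=> sP Pg; apply: engel_next_stable => //; rewrite mul0mx sub0mx. Qed.

Lemma null_space_Lie P x : is_subgroup P -> Lie P x ->
  stablemx (null_space (nilradical (Lie P))) x.
Proof.
move=> sP Px; apply: (Lie_stable _ _ Px); first by case: sP.
by move=> g; apply: null_space_stable.
Qed.

End NullSpace.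

(** * The shape of the nilradical in Sp and SO, read off from its commutators *)

Section FormGroups.

Variables (C : numClosedFieldType) (N : nat) (B : 'M[C]_N) (eps : C).
Hypotheses (BT : B^T = eps *: B) (eps1 : eps = 1 \/ eps = -1).
Variables (G P : set 'M[C]_N).
Hypotheses (fG : form_group B G) (pP : parabolic_subgroup P G).
Implicit Types (u v e k : 'rV[C]_N) (x y z : 'M[C]_N) (W T : 'M[C]_N).

Local Notation form := (form B).
Local Notation perp := (perp B).
Local Notation wedge := (wedge B eps).
Local Notation n := (nilradical (Lie P)).
Local Notation K := (null_space n).

Let UB : B \in unitmx. Proof. by case: fG. Qed.
Let sP : is_subgroup P. Proof. by case: pP => -[]. Qed.
Let PG : P `<=` G. Proof. by case: pP => -[]. Qed.
Let PGL : P `<=` GL C N. Proof. by case: sP. Qed.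
Let cG : cayley_group G. Proof. exact: form_group_cayley fG. Qed.

Lemma nilradical_skew y : n y -> skew_mx B y.
Proof. by move=> /nilradical_Lie; apply: form_group_skew fG PG. Qed.

Lemma perp_stableP W g : stablemx W g -> P g -> stablemx (perp W) g.
Proof.
move=> sW Pg; apply: perp_stable_isom => //; first exact: PGL.
by case: fG => _ _ + _; apply; apply: PG.
Qed.

(** t ^ v lowers the P-stable flag formed by the whole space, T^perp, T and 0. *)
Lemma wedge_nilradical T t v : (forall g, P g -> stablemx T g) -> (T <= perp T)%MS ->
  (t <= T)%MS -> (v <= perp T)%MS -> n (wedge t v).
Proof.
move=> sT iT tT vT.
pose V (i : nat) := nth 0 [:: 1%:M; perp T; T] i.
apply: (@chain_algebra_nilradical _ _ V 3 _ _ _ G) => //.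
- by case=> [|[|[|[|i]]]]; rewrite /V /= ?submx1 ?sub0mx.
- move=> g Pg; case=> [|[|[|[|i]]]]; rewrite /V /= ?submx1 ?mul0mx ?sub0mx//.
    by apply: perp_stableP => //; apply: sT.
  exact: sT.
have tp := submx_trans tT iT.
split; first exact: skew_Lie fG (wedge_skew BT eps1 _ _).
case=> [|[|[|i]]]; rewrite /V /= ?nth_nil ?mul0mx ?sub0mx//; apply/row_subP => i;
  rewrite row_mul mulmx_wedge.
- by rewrite addmx_sub ?scalemx_sub ?eqmx_opp ?scalemx_sub.
- have /perpP -> // := row_sub i (perp T).
  by rewrite scale0r sub0r eqmx_opp scalemx_sub.
- have rT := row_sub i T; have /perpP -> // := submx_trans rT iT.
  move/perpP: vT => /(_ _ rT) /(form_sym0 BT) ->.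
  by rewrite mulr0 !scale0r subrr sub0mx.
Qed.

(** K^perp is nonzero since y0 is, so Engel finds a nonzero t in it killed by n; thus t lies in T =
    K meet K^perp, which is P-stable and isotropic. *)
Lemma null_space_isotropic y0 : n y0 -> y0 != 0 ->
  (K <= perp K)%MS /\ exists2 e : 'rV[C]_N, (e <= K)%MS & e != 0.
Proof.
move=> ny0 y00; have eI : engel n by apply: nilradical_engel; apply: Lie_linear.
have Kn y : n y -> stablemx (perp K) y.
  move=> ny; apply: perp_stable_skew; first exact: nilradical_skew.
  by rewrite null_space_mul// sub0mx.
have [|||t [tK t0 tn]] := eI 0 (perp K).
- by move=> y _; rewrite mul0mx sub0mx.
- exact: Kn.
- rewrite lt0mx; apply/eqP => pK.
  have := perpK UB BT K; rewrite pK => /eqmx_sym pK0.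
  suff K1 : (1%:M <= K)%MS.
    case/negP: y00; rewrite -[y0]mul1mx -submx0.
    by apply: submx_trans (submxMr _ K1) _; rewrite null_space_mul// sub0mx.
  rewrite pK0; apply/row_subP => i; apply/perpP => v; rewrite submx0 => /eqP ->.
  by rewrite (form0r BT).
have {}tn y : n y -> t *m y = 0 by move=> /tn; rewrite submx0 => /eqP.
have tK' : (t <= K)%MS by apply/null_spaceP.
rewrite submx0 in t0.
pose T := (K :&: perp K)%MS.
have sT g : P g -> stablemx T g.
  move=> Pg; have sK := null_space_stable sP Pg.
  rewrite sub_capmx (submx_trans (submxMr _ (capmxSl _ _)) sK).
  by rewrite (submx_trans (submxMr _ (capmxSr _ _)))//; apply: perp_stableP.
have iT : (T <= perp T)%MS by apply: submx_trans (capmxSr _ _) (perp_sub _ (capmxSl _ _)).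
have tT : (t <= T)%MS by rewrite sub_capmx tK' tK.
(* For k in K and v in T^perp, t ^ v is in n and kills k; as t is orthogonal to K, this reads (k, v)
   t = 0. So k lies in T^perp^perp = T. *)
have KT : (K <= T)%MS.
  rewrite -(perpK UB BT T); apply/row_subP => i; apply/perpP => v vT.
  have rK := row_sub i K.
  have := (null_spaceP n (row i K)).1 rK _ (wedge_nilradical sT iT tT vT).
  rewrite mulmx_wedge; move/perpP: tK => /(_ _ rK) /(form_sym0 BT) ->.
  rewrite scale0r sub0r => /eqP; rewrite oppr_eq0 scaler_eq0 (negPf t0) orbF mulf_eq0.
  have e0 : eps != 0 by case: eps1 => ->; rewrite ?oppr_eq0 oner_neq0.
  by rewrite (negPf e0) => /eqP.
split; last by exists t.
exact: submx_trans KT (capmxSr _ _).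
Qed.

Lemma mulmx_nilradical_perp y u : n y -> (u *m y <= perp K)%MS.
Proof.
move=> ny; apply/perpP => v vK; rewrite form_skew ?(null_spaceP n v).1//.
  by rewrite (form0r BT) oppr0.
exact: nilradical_skew.
Qed.

Lemma wedge_null k v : (K <= perp K)%MS -> (k <= K)%MS -> (v <= perp K)%MS -> n (wedge k v).
Proof. by apply: wedge_nilradical => g; apply: null_space_stable. Qed.

Hypothesis commn : comm_line n.

Lemma comm_line_multiple x1 y1 x2 y2 : n x1 -> n y1 -> n x2 -> n y2 ->
  x1 *m y1 - y1 *m x1 != 0 ->
  exists c : C, x2 *m y2 - y2 *m x2 = c *: (x1 *m y1 - y1 *m x1).
Proof.
have [z zP] := commn => nx1 ny1 nx2 ny2.
have [a ->] := zP _ _ nx1 ny1; have [b ->] := zP _ _ nx2 ny2 => az0.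
exists (b / a); rewrite scalerA divfK//; apply: contraNneq az0 => ->.
by rewrite scale0r.
Qed.

(* In the orthogonal case, the nilradical acts on e^perp / e by skew maps with values in a line, hence by 0. *)
Lemma null_line_nilradical e y v : (K <= perp K)%MS -> ~~ (perp K <= K)%MS ->
  (e <= K)%MS -> e != 0 -> (forall k, (k <= K)%MS -> exists c, k = c *: e) ->
  n y -> (v <= perp K)%MS -> exists c, v *m y = c *: e.
Proof.
move=> iK nK eK e0 Ke ny vK.
have [u ue] := form_dual UB BT e0.
have nw (a : 'rV[C]_N) : (a <= perp K)%MS -> n (wedge e a) by move=> aK; apply: wedge_null.
have ey : e *m y = 0 by apply: (null_spaceP n e).1 ny.
have ynK (a : 'rV[C]_N) : (a *m y <= perp K)%MS by apply: mulmx_nilradical_perp.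
have comm (a : 'rV[C]_N) b : (a <= perp K)%MS -> n b ->
    wedge e a *m b - b *m wedge e a = wedge e (a *m b).
  move=> aK nb; apply: (comm_wedge_skew BT); first exact: nilradical_skew.
  exact: (null_spaceP n e).1 nb.
case: (pselect (exists c, v *m y = c *: e)) => // ns; exfalso.
set s := v *m y in ns.
have ws : wedge e s != 0.
  by apply/eqP => /(wedge_eq0 ue) sE; apply: ns; exists (eps * form u s).
have sK : ~~ (s <= K)%MS by apply/negP => /Ke[c sE]; apply: ns; exists c.
(* e ^ (a y) and e ^ s are both commutators and the second is nonzero, so the first is a multiple of
   it. *)
have mult (a : 'rV[C]_N) : (a <= perp K)%MS -> exists c d, a *m y = c *: s + d *: e.
  move=> aK; have [c] : exists c, wedge e (a *m y) = c *: wedge e s.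
    rewrite -(comm a)// -(comm v)//; apply: comm_line_multiple; rewrite ?comm//; exact: nw.
  move=> /(congr1 (mulmx u)); rewrite -scalemxAr !mulmx_wedge ue !scale1r => E.
  exists c, (eps * form u (a *m y) - c * (eps * form u s)).
  move: (form u (a *m y)) E => f /eqP; rewrite scalerBr subr_eq => /eqP ->.
  by rewrite scalerA scalerBl addrA addrAC.
case: eps1 => [e1|eN].
  (* With x in K^perp and (x, s) = 1, the relation (x y, x) = 0 puts x y on the line of e; then (a
     y, a) = 0 at a = v + x gives (s, x) = 0. *)
  have [x xK xs] := form_nondeg UB BT sK.
  have ex : form e x = 0 by apply: (form_sym0 BT); move/perpP: xK; apply.
  have sy := nilradical_skew ny.
  have skd (a : 'rV[C]_N) : form (a *m y) a = 0 by apply: (form_skew_diag BT).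
  have [c [d xy]] := mult _ xK.
  have sx : form s x != 0 by rewrite (formC BT) e1 mul1r xs oner_neq0.
  have c0 : c = 0.
    have := skd x; rewrite xy formDl !formZl ex mulr0 addr0 => /eqP.
    by rewrite mulf_eq0 (negPf sx) orbF => /eqP.
  have := skd (v + x); rewrite mulmxDl xy c0 scale0r add0r -/s.
  have ev : form e v = 0 by apply: (form_sym0 BT); move/perpP: vK; apply.
  rewrite formDl !(formDr BT) (skd v) !formZl ex ev.
  by rewrite !mulr0 !addr0 add0r => /eqP; rewrite (negPf sx).
(* In the symplectic case a commutator is a nonzero multiple of e ^ e, so e ^ s is one as well, and
   s is a multiple of e. *)
have [v0 v0K v0n] : exists2 v0 : 'rV[C]_N, (v0 <= perp K)%MS & ~~ (v0 <= K)%MS.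
  by have /row_subPn[i iK'] := nK; exists (row i (perp K)); rewrite ?row_sub.
have [v1 v1K v10] := form_nondeg UB BT v0n.
have wee : wedge e e != 0.
  apply/eqP => /(wedge_eq0 ue); rewrite ue mulr1 eN scaleN1r => /eqP.
  by rewrite -addr_eq0 -mulr2n -scaler_nat scaler_eq0 (negPf e0) orbF pnatr_eq0.
have cw := comm_wedge BT iK eK eK v1K v0K.
have : wedge e v1 *m wedge e v0 - wedge e v0 *m wedge e v1 != 0.
  by rewrite cw v10 mulr1 scaler_eq0 oppr_eq0 negb_or wee eN oppr_eq0 oner_neq0.
move=> /(comm_line_multiple (nw _ v1K) (nw _ v0K) (nw _ vK) ny)[c].
rewrite comm// cw scalerA -/s => /(wedge_multiple ue) sE.
by apply: ns; eexists; exact: sE.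
Qed.

(** K is the line of e, and y sends e^perp into it. For eps = 1 this is the criterion [line_typeP].
    For eps = -1, u y^2 = c e, and (u y^2, u) = - (u y, u y) = 0 forces c = 0 when (u, e) is
    nonzero. *)
Lemma line_nilradical e y : (K <= perp K)%MS -> ~~ (perp K <= K)%MS ->
  (e <= K)%MS -> e != 0 -> (forall k, (k <= K)%MS -> exists c, k = c *: e) ->
  n y -> y *m y = 0 \/ (eps = 1 /\ line_type B eps y).
Proof.
move=> iK nK eK e0 Ke ny; have ey : e *m y = 0 by apply: (null_spaceP n e).1 ny.
have sy := nilradical_skew ny.
have pe v : form v e = 0 -> (v <= perp K)%MS.
  move=> ve; apply/perpP => k /Ke[c ->].
  by rewrite (formZr BT) ve mulr0.
have yl v : (v <= perp K)%MS -> exists c, v *m y = c *: e.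
  by move=> vK; apply: null_line_nilradical.
case: eps1 => [e1|eN]; [right|left].
  split=> //; apply: (line_typeP UB BT e1 sy e0) => //.
    by move/perpP: (submx_trans eK iK); apply.
  by move=> v /pe/yl.
apply: eq_mulrow => u; rewrite mulmx0 mulmxA.
have [c uyy] := yl _ (mulmx_nilradical_perp u ny).
case: (eqVneq (form u e) 0) => [/pe/yl[d ->]|ue]; first by rewrite -scalemxAl ey scaler0.
have := form_skew (u *m y) u sy; rewrite (form_alt0 BT)// oppr0 uyy formZl => /eqP.
rewrite mulf_eq0 => /orP[/eqP ->|/eqP eu]; first by rewrite scale0r.
by case/negP: ue; apply/eqP/(form_sym0 BT).
Qed.

(* In SO_5, when the null space of the nilradical is a maximal isotropic plane K, *)
(* y maps K^perp / K to the line of e = n0 y, and y = e ^ u.                      *)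
Lemma plane_nilradical y : eps = 1 -> N = 5%N -> (K <= perp K)%MS ->
  \rank K = 2%N -> n y -> y *m y = 0 \/ line_type B eps y.
Proof.
move=> e1 N5 iK rK ny; have sy := nilradical_skew ny.
have rpK : \rank (perp K) = 3%N.
  by apply: (@addIn (\rank K)); rewrite rank_perp// rK N5.
have Ky v : (v <= K)%MS -> v *m y = 0 by move=> /(null_spaceP n v).1; apply.
have [n0 n0K n0n] : exists2 n0 : 'rV[C]_N, (n0 <= perp K)%MS & ~~ (n0 <= K)%MS.
  have : ~~ (perp K <= K)%MS.
    by apply/negP => /mxrankS; rewrite rK rpK.
  by move=> /row_subPn[i iK']; exists (row i (perp K)); rewrite ?row_sub.
have pKE v : (v <= perp K)%MS -> exists a w, (w <= K)%MS /\ v = a *: n0 + w.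
  move=> vK; apply: sub_add_rV; apply: submx_trans vK _.
  have sub : (K + n0 <= perp K)%MS by rewrite addsmx_sub iK n0K.
  have := rank_add_rV n0n; rewrite rK => r3.
  by rewrite -(mxrank_leqif_sup sub) eqn_leq mxrankS//= rpK.
have KE v : (v <= perp K)%MS -> form v n0 = 0 -> (v <= K)%MS.
  move=> vK vn0; rewrite -(perpK UB BT K); apply/perpP => w /pKE[a [k [kK ->]]].
  rewrite (formDr BT) (formZr BT) vn0 mulr0 add0r.
  by move/perpP: vK; apply.
set e := n0 *m y.
have ynK v : (v *m y <= perp K)%MS by apply: mulmx_nilradical_perp.
have eK : (e <= K)%MS.
  by apply: KE; [exact: ynK|have := form_skew_diag BT n0 e1 sy].
case: (eqVneq e 0) => e0.
  left; apply: eq_mulrow => u; rewrite mulmx0 mulmxA.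
  have [a [w [wK ->]]] := pKE _ (ynK u).
  by rewrite mulmxDl -scalemxAl -/e e0 scaler0 add0r Ky.
right; apply: (line_typeP UB BT e1 sy e0).
- by move/perpP: (submx_trans eK iK); apply.
- exact: Ky.
move=> v ve; have vyK : (v *m y <= K)%MS.
  apply: KE => //; rewrite form_skew// -/e ve oppr0 //.
case: (boolP (v <= perp K)%MS) => [/pKE[a [w [wK ->]]]|vK].
  by exists a; rewrite mulmxDl -scalemxAl (Ky w)// addr0.
have [k' kK vk'] : exists2 k' : 'rV[C]_N, (k' <= K)%MS & form v k' != 0.
  apply: contrapT => nk; case/negP: vK; apply/perpP => w wK.
  by apply/eqP/negPn/negP => vw; apply: nk; exists w.
have k'e : ~~ (k' <= e)%MS.
  apply: contra vk' => /sub_rVP[a ->].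
  by rewrite (formZr BT) ve mulr0.
have := rank_add_rV k'e.
have -> : \rank e = 1%N by rewrite rank_rV e0.
have sub : (e + k' <= K)%MS by rewrite addsmx_sub eK kK.
move=> r2; have KEk : (K <= e + k')%MS.
  by rewrite -(mxrank_leqif_sup sub) eqn_leq mxrankS//= rK.
have /sub_add_rV[b [w [/sub_rVP[a ->] vyE]]] := submx_trans vyK KEk.
(* K is spanned by e and k', with (v, e) = 0 and (v, k') nonzero, so (v y, v) = 0 removes the k'
   component. *)
have := form_skew_diag BT v e1 sy; rewrite vyE formDl !formZl.
rewrite [form e v](formC BT) ve !mulr0 addr0 => /eqP; rewrite mulf_eq0 => /orP[/eqP b0|k'v].
  by exists a; rewrite b0 scale0r add0r.
by case/negP: vk'; apply/eqP/(form_sym0 BT)/eqP.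
Qed.

(** If K = K^perp, then y maps everything into K^perp and kills it. If K is a line,
    [line_nilradical] applies. Otherwise [comm_wedge] excludes every case except a plane K in
    dimension 5. *)
Theorem form_nilradical y :
  eps = -1 \/ eps = 1 /\ (N = 5%N \/ forall x z, n x -> n z -> x *m z = z *m x) ->
  n y -> y *m y = 0 \/ (eps = 1 /\ line_type B eps y).
Proof.
move=> H ny; case: (eqVneq y 0) => [->|y0]; first by left; rewrite mul0mx.
have [iK [e eK e0]] := null_space_isotropic ny y0.
case: (boolP (perp K <= K)%MS) => [sK|nK].
  left; apply: eq_mulrow => u; rewrite mulmx0 mulmxA.
  apply: (null_spaceP n (u *m y)).1 => //.
  exact: submx_trans (mulmx_nilradical_perp u ny) sK.
have [u ue] := form_dual UB BT e0.
have nw k v : (k <= K)%MS -> (v <= perp K)%MS -> n (wedge k v) by move=> *; apply: wedge_null.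
have [v0 v0K v0n] : exists2 v0 : 'rV[C]_N, (v0 <= perp K)%MS & ~~ (v0 <= K)%MS.
  by have /row_subPn[i iK'] := nK; exists (row i (perp K)); rewrite ?row_sub.
have [v1 v1K v10] := form_nondeg UB BT v0n.
have eps0 : - eps != 0 by case: eps1 => ->; rewrite ?opprK ?oppr_eq0 oner_neq0.
case: (pselect (forall k, (k <= K)%MS -> exists c, k = c *: e)) => [Ke|nKe].
  exact: line_nilradical Ke ny.
case: H => [eN|[e1 H]].
  (* e ^ e is nonzero and proportional to a commutator, so e ^ k is a multiple of it and k is a
     multiple of e. *)
  exfalso; apply: nKe => k kK.
  have wee : wedge e e != 0.
    apply/eqP => /(wedge_eq0 ue); rewrite ue mulr1 eN scaleN1r => /eqP.
    by rewrite -addr_eq0 -mulr2n -scaler_nat scaler_eq0 (negPf e0) orbF pnatr_eq0.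
  have ne := comm_wedge BT iK eK eK v1K v0K.
  have : wedge e v1 *m wedge e v0 - wedge e v0 *m wedge e v1 != 0.
    by rewrite ne v10 mulr1 scaler_eq0 negb_or wee eps0.
  move=> /(comm_line_multiple (nw _ _ eK v1K) (nw _ _ eK v0K) (nw _ _ eK v1K) (nw _ _ kK v0K))[c].
  rewrite ne (comm_wedge BT iK eK kK v1K v0K) v10 mulr1 scalerA [c * _]mulrC -scalerA => E.
  have /(wedge_multiple ue) kE := scalerI eps0 E.
  by eexists; exact: kE.
case: H => [N5|abn].
  have rK : \rank K = 2%N.
    apply/eqP; rewrite eqn_leq; apply/andP; split.
      have : (\rank K + \rank K <= 5)%N.
        apply: leq_trans (eq_leq N5).
        by apply: leq_trans (eq_leq (rank_perp UB K)); rewrite leq_add2r mxrankS.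
      by rewrite addnn => /half_leq; rewrite doubleK.
    have [k kK ke] : exists2 k : 'rV[C]_N, (k <= K)%MS & ~~ (k <= e)%MS.
      apply: contrapT => nk; apply: nKe => k kK; apply: contrapT => nc; apply: nk.
      by exists k => //; apply/negP => /sub_rVP[a kE]; apply: nc; exists a.
    have := rank_add_rV ke; rewrite rank_rV e0 => r2; apply: leq_trans r2 _.
    by apply: mxrankS; rewrite addsmx_sub eK kK.
  by case: (plane_nilradical e1 N5 iK rK ny) => [|?]; [left|right].
(* Vanishing of [e ^ v1, k ^ v0] with (v1, v0) = 1 gives e ^ k = 0. *)
exfalso; apply: nKe => k kK.
have := comm_wedge BT iK eK kK v1K v0K.
rewrite (abn (wedge e v1))//; [|exact: nw|exact: nw].
rewrite subrr v10 mulr1 => /esym/eqP; rewrite scaler_eq0 (negPf eps0) /= => /eqP /(wedge_eq0 ue) kE.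
by eexists; exact: kE.
Qed.

End FormGroups.

(** * From an abelian unipotent radical to a commutative nilradical *)

Section AbelianRadical.

Variables (C : numClosedFieldType) (N : nat).
Implicit Types (g x y : 'M[C]_N) (G P : set 'M[C]_N).

(** P normalizes n, hence stabilizes its Engel flag. The chain algebra of the reversed flag contains
    n, and it is commutative by [chain_algebra_abelian]. *)
Lemma nilradical_abelian G P x y : cayley_group G -> parabolic_subgroup P G ->
  abelian_group (unipotent_radical P) ->
  nilradical (Lie P) x -> nilradical (Lie P) y -> x *m y = y *m x.
Proof.
move=> cG pP abP; have [[sP _ PG] _] := pP; have [PGL _ _ _] := sP.
have [W [W0 W1 WW Wn WE]] := engel_chain (nilradical_engel (Lie_linear P)).
have WP i g : P g -> stablemx (W i) g.
  move=> Pg; elim: i => [|i IH]; first by rewrite W0 mul0mx sub0mx.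
  by rewrite WE; apply: engel_next_stable.
pose V i := W (N - i)%N.
have VS i : (V i.+1 <= V i)%MS.
  rewrite /V; case: (ltnP i N) => [iN|Ni]; first by rewrite -[(N - i)%N]subnSK.
  by rewrite -[i.+1]addn1 subnDA (eqP Ni).
have nV z : nilradical (Lie P) z -> chain_algebra G V z.
  move=> nz; split; first exact: Lie_sub PG _ (nilradical_Lie nz).
  move=> i; rewrite /V addn1; case: (ltnP i N) => [iN|Ni].
    by rewrite -[(N - i)%N]subnSK//; apply: Wn.
  by rewrite (eqP Ni) W0 mul0mx sub0mx.
move=> /nV Vx /nV Vy.
apply: (@chain_algebra_abelian _ _ V N _ _ VS _ cG _ pP) => //.
- by rewrite /V subn0.
- by rewrite /V subnn.
- by move=> g Pg i; apply: WP.
Qed.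

End AbelianRadical.

(** * The nilradical in GL *)

Section GeneralLinear.

Variables (C : numClosedFieldType) (N : nat) (P : set 'M[C]_N).
Hypothesis pP : parabolic_subgroup P (GL C N).
Implicit Types (u v w : 'rV[C]_N) (x y z : 'M[C]_N) (W : 'M[C]_N).

Local Notation n := (nilradical (Lie P)).
Local Notation K := (null_space n).

Let sP : is_subgroup P. Proof. by case: pP => -[]. Qed.
Let PGL : P `<=` GL C N. Proof. by case: sP. Qed.
Let nE : engel n. Proof. exact: nilradical_engel (Lie_linear P). Qed.

Lemma image_space_exists : exists R : 'M[C]_N, forall v, (v <= R)%MS <->
  forall W, (forall y, n y -> (y <= W)%MS) -> (v <= W)%MS.
Proof.
have [|R RE] := @linear_set_mx C N
  [set v | forall W : 'M[C]_N, (forall y, n y -> (y <= W)%MS) -> (v <= W)%MS].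
  split=> [W _|a u v uW vW W nW] /=; first exact: sub0mx.
  by rewrite addmx_sub ?scalemx_sub//; [apply: uW|apply: vW].
by exists R => v; rewrite -RE.
Qed.

Definition image_space := sval (cid image_space_exists).

Lemma image_spaceP v : (v <= image_space)%MS <->
  forall W, (forall y, n y -> (y <= W)%MS) -> (v <= W)%MS.
Proof. by rewrite /image_space; case: cid. Qed.

Lemma image_space_sub y : n y -> (y <= image_space)%MS.
Proof.
move=> ny; apply/row_subP => i; apply/image_spaceP => W /(_ _ ny) yW.
by apply: submx_trans (row_sub _ _) yW.
Qed.

Lemma image_space_min W : (forall y, n y -> (y <= W)%MS) -> (image_space <= W)%MS.
Proof. by move=> nW; apply/row_subP => i; apply: (image_spaceP _).1 nW; apply: row_sub. Qed.

Lemma image_space_stable g : P g -> stablemx image_space g.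
Proof.
move=> Pg; have Ug : g \in unitmx by apply: PGL.
apply/row_subP => i; rewrite row_mul; apply/image_spaceP => W nW.
rewrite -[W](mulmxKV Ug) submxMr//.
have /image_spaceP := row_sub i image_space; apply => y ny.
rewrite -[y](mulmxK Ug) submxMr//.
have -> : y *m g = g *m (invmx g *m y *m invmx (invmx g)).
  by rewrite invmxK !mulmxA mulmxV// mul1mx.
apply: submx_trans (submxMl _ _) _; apply: nW; apply: nilradical_Ad => //.
by case: sP => _ _ _; apply.
Qed.

Lemma image_space_proper u : u != 0 -> ~ (1%:M <= image_space)%MS.
Proof.
move=> u0 R1; have [W [W0 W1 _ Wn _]] := engel_chain nE.
suff H i : (1%:M <= W i)%MS -> False by exact: H W1.
elim: i => [|i IH] Wi.
  case/negP: u0; rewrite -submx0 -W0; apply: submx_trans Wi; exact: submx1.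
apply: IH; apply: submx_trans R1 _; apply: image_space_min => y ny.
rewrite -[y]mul1mx; apply: submx_trans (submxMr _ Wi) _; exact: Wn.
Qed.

Lemma col_separates W v : ~~ (v <= W)%MS -> exists c : 'cV[C]_N, W *m c = 0 /\ v *m c = 1%:M.
Proof.
rewrite submxE; move: (cokermx W) (mulmx_coker W) => M WM /rV0Pn[j vj].
pose a := (v *m M) 0 j; exists (a^-1 *: (M *m delta_mx j 0)).
rewrite -!scalemxAr !mulmxA WM mul0mx scaler0; split=> //.
by rewrite [v *m _ *m _]mx11_scalar -colE mxE -/a scale_scalar_mx mulVf.
Qed.

Lemma chain_nilradical W1 W2 x : (forall g, P g -> stablemx W1 g) ->
  (forall g, P g -> stablemx W2 g) -> (W2 <= W1)%MS ->
  (x <= W1)%MS -> (W1 *m x <= W2)%MS -> W2 *m x = 0 -> n x.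
Proof.
move=> s1 s2 W21 x1 W1x W2x; pose V (i : nat) := nth 0 [:: 1%:M; W1; W2] i.
apply: (@chain_algebra_nilradical _ _ V 3 _ _ _ (GL C N)) => //.
- by case=> [|[|[|[|i]]]]; rewrite /V /= ?submx1 ?sub0mx.
- exact: cayley_group_GL.
- move=> g Pg; case=> [|[|[|[|i]]]]; rewrite /V /= ?submx1 ?mul0mx ?sub0mx//.
    exact: s1.
  exact: s2.
split; first exact: Lie_GL.
by case=> [|[|[|i]]]; rewrite /V /= ?nth_nil ?mul1mx ?mul0mx ?W2x ?sub0mx.
Qed.

(** The claim is that R, the span of all images, lies in K. Rank-one matrices in n, obtained from
    the P-stable spaces R, K and their intersection, test this; t is a nonzero vector of R killed by
    n. *)
Theorem GL_nilradical x y : (forall x z, n x -> n z -> x *m z = z *m x) ->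
  n x -> n y -> x *m y = 0.
Proof.
move=> abn nx ny; case: (eqVneq x 0) => [->|x0]; first by rewrite mul0mx.
set R := image_space.
have sK g : P g -> stablemx K g by apply: null_space_stable.
have sR g : P g -> stablemx R g by apply: image_space_stable.
have Rn0 : ((0 : 'M[C]_N) < R)%MS.
  rewrite lt0mx; apply: contraNneq x0 => R0; rewrite -submx0 -R0.
  exact: image_space_sub.
have [||t [tR t0 tn]] := nE (W' := 0) (W := R) _ _ Rn0.
- by move=> z _; rewrite mul0mx sub0mx.
- by move=> z nz; apply: submx_trans (submxMl _ _) (image_space_sub nz).
rewrite submx0 in t0.
have tK : (t <= K)%MS by apply/null_spaceP => z /tn; rewrite submx0 => /eqP.
pose T := (K :&: R)%MS.
have sT g : P g -> stablemx T g.
  move=> Pg; rewrite sub_capmx (submx_trans (submxMr _ (capmxSl _ _)) (sK _ Pg)).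
  by rewrite (submx_trans (submxMr _ (capmxSr _ _)) (sR _ Pg)).
have tT : (t <= T)%MS by rewrite sub_capmx tK tR.
(* A vector k of K outside T is not killed by c t, where c vanishes on T and k c = 1; but c t
   belongs to n. *)
have KR : (K <= R)%MS.
  apply: submx_trans (capmxSr K R); apply/negPn/negP => /row_subPn[i /col_separates[c [Tc Kc]]].
  have nct : n (c *m t).
    apply: (chain_nilradical sT sT); rewrite ?submx_refl//.
    - by apply: submx_trans (submxMl _ _) tT.
    - by rewrite mulmxA Tc mul0mx sub0mx.
    - by rewrite mulmxA Tc mul0mx.
  have := (null_spaceP n _).1 (row_sub i K) _ nct.
  by rewrite mulmxA Kc mul1mx => /eqP; rewrite (negPf t0).
suff RK : (R <= K)%MS.
  apply: eq_mulrow => u; rewrite mulmx0 mulmxA; apply: (null_spaceP n _).1 => //.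
  by apply: submx_trans RK; apply: submx_trans (submxMl _ _) (image_space_sub nx).
apply/negPn/negP => /row_subPn[i rK]; set r := row i R in rK.
have rR : (r <= R)%MS by apply: row_sub.
have [j /col_separates[c1 [Rc1 jc1]]] : exists j, ~~ (row j (1%:M : 'M[C]_N) <= R)%MS.
  by apply/row_subPn/negP/(image_space_proper t0).
have [c2 [Kc2 rc2]] := col_separates rK.
(* (c1 r)(c2 t) = c1 t is nonzero while (c2 t)(c1 r) = 0, contradicting commutativity. *)
have n1 : n (c1 *m r).
  apply: (chain_nilradical sR sR); rewrite ?submx_refl//.
  - by apply: submx_trans (submxMl _ _) rR.
  - by rewrite mulmxA Rc1 mul0mx sub0mx.
  - by rewrite mulmxA Rc1 mul0mx.
have n2 : n (c2 *m t).
  apply: (chain_nilradical sR sK) => //.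
  - by apply: submx_trans (submxMl _ _) tR.
  - by rewrite mulmxA; apply: submx_trans (submxMl _ _) tK.
  - by rewrite mulmxA Kc2 mul0mx.
have tc1 : t *m c1 = 0.
  by have /submxP[d ->] := tR; rewrite -mulmxA Rc1 mulmx0.
have := abn _ _ n1 n2; rewrite -mulmxA [r *m _]mulmxA rc2 mul1mx.
rewrite -[c2 *m t *m _]mulmxA [t *m _]mulmxA tc1 mul0mx mulmx0.
move=> /(congr1 (mulmx (row j 1%:M))); rewrite mulmxA jc1 mul1mx mulmx0 => /eqP.
by rewrite (negPf t0).
Qed.

(** Maximality makes P the stabilizer of K. If R were not inside K, column vectors c vanishing on K
    would give c w in Lie P for every w, and stability of R would make it the whole space. *)
Theorem maximal_nilradical_abelian x y : maximal_parabolic_subgroup P (GL C N) ->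
  n x -> n y -> x *m y = 0.
Proof.
move=> [_ PnGL maxP] nx ny; case: (eqVneq y 0) => [->|y0]; first by rewrite mulmx0.
have K1 : ~~ (1%:M <= K)%MS.
  apply: contra y0 => K1; rewrite -[y]mul1mx -submx0.
  by apply: submx_trans (submxMr _ K1) _; rewrite null_space_mul// sub0mx.
have [j jK] := row_subPn K1.
have [|||t [_ t0 tn]] := nE (W' := 0) (W := 1%:M).
- by move=> z _; rewrite mul0mx sub0mx.
- by move=> z _; rewrite submx1.
- rewrite lt0mx; apply: contraNneq y0 => one0.
  by rewrite -[y]mul1mx one0 mul0mx.
rewrite submx0 in t0.
have tK : (t <= K)%MS by apply/null_spaceP => z /tn; rewrite submx0 => /eqP.
have PE : P = stabilizer (GL C N) K.
  have sPK : P `<=` stabilizer (GL C N) K.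
    by move=> g Pg; split; [apply: PGL|apply: null_space_stable].
  case: (maxP (stabilizer (GL C N) K)) => // [|E].
    have [[_ cP _] [B bB BP]] := pP; split; last by exists B => // g /BP/sPK.
    split=> [||g []//].
      split=> [g []//||g h [Gg sg] [Gh sh]|g [Gg sg]].
      - by split; [apply: GL1|rewrite mulmx1].
      - by split; [apply: GL_mul|apply: stable_mul].
      - by split; [apply: GL_inv|apply: stablemx_inv].
    pose S : set ('M[C]_N -> C) := [set f | exists k l, f =
      fun g => (K *m g *m cokermx K) k l].
    rewrite (_ : stabilizer _ _ = [set g | GL C N g /\ forall f, S f -> f g = 0]).
      by apply: (zariski_closed_zeros (S := S)) => _ [k [l ->]]; apply: regular_mul3.
    apply/seteqP; split=> g [Gg H]; split=> //.
      by move=> _ [k [l ->]]; move: H; rewrite submxE => /eqP ->; rewrite mxE.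
    rewrite submxE; apply/eqP/matrixP => k l; rewrite [RHS]mxE.
    by apply: (H (fun g => (K *m g *m cokermx K) k l)); exists k, l.
  (* If all of GL stabilized K, so would every matrix, which is impossible for a nonzero proper
     subspace. *)
  have KLie (x1 : 'M[C]_N) : stablemx K x1.
    have := Lie_GL x1; rewrite -{1}E => Sx.
    by apply: Lie_stable Sx => [g [] //|g []].
  have t0' : ~~ (t <= (0 : 'M[C]_N))%MS by rewrite submx0.
  have [c [_ tc]] := col_separates t0'.
  case/negP: jK; rewrite -[row j _]mul1mx -tc -mulmxA.
  by apply: submx_trans (KLie _); apply: submxMr.
suff RK : (image_space <= K)%MS.
  apply: eq_mulrow => u; rewrite mulmx0 mulmxA; apply: (null_spaceP n _).1 => //.
  by apply: submx_trans RK; apply: submx_trans (submxMl _ _) (image_space_sub nx).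
apply/negPn/negP => /row_subPn[i rK].
have [c [Kc rc]] := col_separates rK.
apply: (image_space_proper t0); apply/row_subP => k; set w := row k _.
have Pcw : Lie P (c *m w).
  rewrite PE; apply: Lie_stabilizer; [exact: cayley_group_GL|exact: Lie_GL|].
  by rewrite mulmxA Kc mul0mx sub0mx.
have : stablemx image_space (c *m w).
  by apply: Lie_stable Pcw => // g; apply: image_space_stable.
by move=> /(submx_trans (submxMr _ (row_sub i _))); rewrite mulmxA rc mul1mx.
Qed.

End GeneralLinear.

(** * Commutators in the nilradical of the stabilizer of an isotropic subspace *)

Section Stabilizers.

Variables (C : numClosedFieldType) (N : nat) (B : 'M[C]_N) (eps : C).
Hypotheses (BT : B^T = eps *: B) (eps1 : eps = 1 \/ eps = -1).
Variables (G : set 'M[C]_N) (W : 'M[C]_N).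
Hypotheses (fG : form_group B G) (pP : parabolic_subgroup (stabilizer G W) G).
Hypothesis iW : (W <= perp B W)%MS.
Implicit Types (u v w k e a b s t : 'rV[C]_N) (x y z : 'M[C]_N).

Local Notation P := (stabilizer G W).
Local Notation form := (form B).
Local Notation perp := (perp B).
Local Notation wedge := (wedge B eps).
Local Notation n := (nilradical (Lie P)).
Local Notation K := (null_space n).

Let UB : B \in unitmx. Proof. by case: fG. Qed.
Let sP : is_subgroup P. Proof. by case: pP => -[]. Qed.
Let PG : P `<=` G. Proof. by case: pP => -[]. Qed.
Let PGL : P `<=` GL C N. Proof. by case: sP. Qed.
Let cG : cayley_group G. Proof. exact: form_group_cayley fG. Qed.
Let skew y : n y -> skew_mx B y. Proof. exact: nilradical_skew fG pP y. Qed.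

Let nW y : n y -> stablemx W y.
Proof.
by move=> /nilradical_Lie Py; apply: Lie_stable Py => // g [].
Qed.

Let wedgeP a b : (forall w, (w <= W)%MS -> (w *m wedge a b <= W)%MS) -> Lie P (wedge a b).
Proof.
move=> H; apply: Lie_stabilizer => //; first exact: skew_Lie fG (wedge_skew BT eps1 _ _).
by apply/row_subP => i; rewrite row_mul; apply: H; apply: row_sub.
Qed.

(** Engel gives a nonzero w in W meet K. For k in W, the element k ^ v of Lie P with (v, w) = 1
    sends w to a nonzero multiple of k, and K is stable under Lie P. *)
Lemma stabilizer_null : W != 0 -> forall w y, (w <= W)%MS -> n y -> w *m y = 0.
Proof.
move=> W0 k y kW; suff /null_spaceP : (k <= K)%MS by apply.
have [|||w [wW w0 wn]] := nilradical_engel (Lie_linear P) (W' := 0) (W := W).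
- by move=> z _; rewrite mul0mx sub0mx.
- by move=> z; apply: nW.
- by rewrite lt0mx.
rewrite submx0 in w0; have [v vw] := form_dual UB BT w0.
have Pkv : Lie P (wedge k v).
  apply: wedgeP => s sW; rewrite mulmx_wedge.
  have /perpP -> // := submx_trans sW iW.
  by rewrite scale0r sub0r eqmx_opp scalemx_sub.
have wK : (w <= K)%MS by apply/null_spaceP => z /wn; rewrite submx0 => /eqP.
have := submx_trans (submxMr (wedge k v) wK) (null_space_Lie sP Pkv).
rewrite mulmx_wedge; have /perpP -> // := submx_trans wW iW.
have e0 : eps * form w v != 0.
  rewrite (formC BT) vw mulr1.
  by case: eps1 => ->; rewrite ?mulrNN mulr1 oner_neq0.
rewrite scale0r sub0r eqmx_opp => /(scalemx_sub (eps * form w v)^-1).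
by rewrite scalerA mulVf// scale1r.
Qed.

Lemma stabilizer_image : W != 0 -> forall u y, n y -> (u *m y <= perp W)%MS.
Proof.
move=> W0 u y ny; apply/perpP => v vW; rewrite form_skew ?(stabilizer_null W0 vW)//.
  by rewrite (form0r BT) oppr0.
exact: skew.
Qed.

Lemma lagrangian_nilradical : W != 0 -> (perp W <= W)%MS ->
  forall x y, n x -> n y -> x *m y = 0.
Proof.
move=> W0 pW x y nx ny; apply: eq_mulrow => u; rewrite mulmx0 mulmxA.
by apply: stabilizer_null => //; apply: submx_trans pW; apply: stabilizer_image.
Qed.

(** Engel gives v0 in W^perp outside W that n sends into W. This property spreads to v0 x for x in
    Lie P, in particular for x = b ^ c with b, c in W^perp. *)
Lemma stabilizer_perp : W != 0 -> forall a y, (a <= perp W)%MS -> n y -> (a *m y <= W)%MS.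
Proof.
move=> W0 a y aW ny; case: (boolP (perp W <= W)%MS) => [pW|npW].
  by rewrite (stabilizer_null W0)// ?sub0mx//; apply: submx_trans pW.
have nperp z : n z -> stablemx (perp W) z.
  by move=> nz; apply: perp_stable_skew; [apply: skew|apply: nW].
have [|||v0 [v0W v0n vn]] := nilradical_engel (Lie_linear P) (W' := W) (W := perp W).
- exact: nW.
- exact: nperp.
- by rewrite ltmxE iW.
have vPn x z : Lie P x -> n z -> (v0 *m x *m z <= W)%MS.
  move=> Px nz.
  have [_ _ _ nI] := nilradical_ideal (Lie_linear P).
  have -> : v0 *m x *m z = v0 *m (x *m z - z *m x) + v0 *m z *m x.
    by rewrite mulmxBr !mulmxA subrK.
  rewrite addmx_sub//; first exact/vn/nI.
  apply: submx_trans (submxMr _ (vn _ nz)) _.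
  by apply: Lie_stable Px => // g [].
have wPn b (c : 'rV[C]_N) z : (b <= perp W)%MS -> (c <= perp W)%MS -> n z ->
    (v0 *m wedge b c *m z <= W)%MS.
  move=> /perpP bW /perpP cW; apply: vPn; apply: wedgeP => s sW; rewrite mulmx_wedge.
  rewrite (form_sym0 BT (bW _ sW)) (form_sym0 BT (cW _ sW)).
  by rewrite mulr0 !scale0r subrr sub0mx.
have [x0 x0W x0v] := form_nondeg UB BT v0n.
(* Orthogonal case: modulo W, b y is (v0, b) s with s = x0 y; polarizing (b y, b) = 0 puts s in W.
   Symplectic case: b = c gives 2 (v0, b) b y in W, and adding x0 handles (v0, b) = 0. *)
case: eps1 => [e1|eN].
  have vx0 : form v0 x0 = 1 by rewrite (formC BT) e1 mul1r x0v.
  set s := x0 *m y.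
  have key b : (b <= perp W)%MS -> (b *m y - form v0 b *: s <= W)%MS.
    move=> bW; have := wPn _ _ _ x0W bW ny.
    by rewrite mulmx_wedge vx0 scale1r e1 mul1r mulmxBl -scalemxAl.
  have sW b : (b <= perp W)%MS -> form v0 b * form s b = 0.
    move=> bW; have := form_skew_diag BT b e1 (skew ny).
    rewrite -[b *m y](subrK (form v0 b *: s)) formDl formZl.
    by move/perpP: bW (bW) => bW /key/bW /(form_sym0 BT) ->; rewrite add0r.
  have sb b : (b <= perp W)%MS -> form s b = 0.
    have s0 : form s x0 = 0 by have := sW _ x0W; rewrite vx0 mul1r.
    move=> bW; have := sW _ bW => /eqP; rewrite mulf_eq0 => /orP[/eqP vb|/eqP //].
    have := sW (b + x0) (addmx_sub bW x0W).
    by rewrite !(formDr BT) vb add0r vx0 s0 addr0 mul1r.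
  have sW' : (s <= W)%MS by rewrite -(perpK UB BT W); apply/perpP.
  by have := addmx_sub (key _ aW) (scalemx_sub (form v0 a) sW'); rewrite subrK.
have vx0 : form v0 x0 = -1 by rewrite (formC BT) eN x0v mulr1.
have key b : (b <= perp W)%MS -> form v0 b != 0 -> (b *m y <= W)%MS.
  move=> bW vb; have := wPn _ _ _ bW bW ny.
  rewrite mulmx_wedge -scalerBl eN mulN1r opprK -mulr2n -scalemxAl.
  have f0 : form v0 b *+ 2 != 0 by rewrite mulrn_eq0.
  by move=> /(scalemx_sub (form v0 b *+ 2)^-1); rewrite scalerA mulVf// scale1r.
case: (eqVneq (form v0 a) 0) => [va|]; last exact: key.
have x0y : (x0 *m y <= W)%MS by apply: key => //; rewrite vx0 oppr_eq0 oner_neq0.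
have : ((a + x0) *m y <= W)%MS.
  apply: key; first exact: addmx_sub.
  by rewrite (formDr BT) va add0r vx0 oppr_eq0 oner_neq0.
move=> h; have := addmx_sub h (scalemx_sub (-1) x0y).
by rewrite scaleN1r mulmxDl addrK.
Qed.

Lemma stabilizer_bracket x y : W != 0 -> n x -> n y ->
  [/\ skew_mx B (x *m y - y *m x), forall u, (u *m (x *m y - y *m x) <= W)%MS
    & forall a, (a <= perp W)%MS -> a *m (x *m y - y *m x) = 0].
Proof.
move=> W0 nx ny.
have [nP _ _ nI] := nilradical_ideal (Lie_linear P).
split.
- by apply: skew; apply: nI => //; apply: nP.
- move=> u; rewrite mulmxBr addmx_sub ?eqmx_opp// mulmxA.
    by apply: stabilizer_perp => //; apply: stabilizer_image.
  by apply: stabilizer_perp => //; apply: stabilizer_image.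
- move=> a aW; rewrite mulmxBr !mulmxA.
  by rewrite !(stabilizer_null W0 (stabilizer_perp W0 aW _)) ?subrr.
Qed.

(** By [stabilizer_bracket] a commutator kills e^perp and has values in the line of e, so it is a
    multiple of u -> (u, e) e, which is not skew for eps = 1 unless zero. *)
Lemma line_comm_line : \rank W = 1%N ->
  comm_line n /\ (eps = 1 -> forall x y, n x -> n y -> x *m y = y *m x).
Proof.
move=> rW; have W0 : W != 0 by rewrite -mxrank_eq0 rW.
have /rowV0Pn[e eW e0] := W0.
have We : (W <= e)%MS.
  by rewrite -(mxrank_leqif_sup eW) rW rank_rV e0.
have [u0 u0e] := form_dual UB BT e0.
have key x y : n x -> n y -> exists2 c, x *m y - y *m x = c *: (B *m e^T *m e)
    & u0 *m (x *m y - y *m x) = c *: e.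
  move=> nx ny; have [_ zW z0] := stabilizer_bracket W0 nx ny.
  set z := x *m y - y *m x in zW z0 *.
  have /sub_rVP[c zc] := submx_trans (zW u0) We; exists c => //.
  apply: eq_mulrow => u; rewrite -scalemxAr !mulmxA formE mul_scalar_mx.
  have : (u - form u e *: u0 <= perp W)%MS.
    apply/perpP => w wW; have /sub_rVP[b ->] := submx_trans wW We.
    by rewrite (formZr BT) formDl formNl formZl u0e mulr1 subrr mulr0.
  move=> /z0 /eqP; rewrite mulmxBl subr_eq0 -scalemxAl zc => /eqP ->.
  by rewrite !scalerA mulrC.
split; first by exists (B *m e^T *m e) => x y nx ny; have [c ->] := key x y nx ny; exists c.
move=> e1 x y nx ny; have [c zE uz] := key x y nx ny.
have [sz _ _] := stabilizer_bracket W0 nx ny.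
have := form_skew_diag BT u0 e1 sz; rewrite uz formZl (formC BT) e1 mul1r u0e mulr1 => c0.
by apply/eqP; rewrite -subr_eq0 zE c0 scale0r.
Qed.

(** Commutators correspond to the exterior square of W, which is the line of a ^ b for a plane; u
    and v form a dual basis. *)
Lemma plane_comm_line : eps = 1 -> \rank W = 2%N -> comm_line n.
Proof.
move=> e1 rW; have W0 : W != 0 by rewrite -mxrank_eq0 rW.
have /rowV0Pn[a aW a0] := W0.
have [b [bW ba]] : exists b, (b <= W)%MS /\ ~~ (b <= a)%MS.
  have /row_subPn[i iW'] : ~~ (W <= a)%MS.
    by apply/negP => /mxrankS; rewrite rW rank_rV a0.
  by exists (row i W); rewrite row_sub iW'.
have WE w : (w <= W)%MS -> exists c d, w = c *: b + d *: a.
  have sub : (a + b <= W)%MS by rewrite addsmx_sub aW bW.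
  have := rank_add_rV ba; rewrite rank_rV a0 => r2.
  have Wab : (W <= a + b)%MS by rewrite -(mxrank_leqif_sup sub) eqn_leq mxrankS//= rW.
  by move=> /submx_trans/(_ Wab)/sub_add_rV[c [_ [/sub_rVP[d ->] ->]]]; exists c, d.
have ab : ~~ (a <= b)%MS.
  apply: contra ba => /sub_rVP[c ac]; rewrite ac.
  have c0 : c != 0 by apply: contraNneq a0 => c0; rewrite ac c0 scale0r.
  by have := scalemx_sub c^-1 (submx_refl (c *: b)); rewrite scalerA mulVf// scale1r.
have [v vb va] : exists2 v, form v b = 0 & form v a = 1.
  have : ~~ (a <= <<b>>)%MS by rewrite genmxE.
  move=> /(form_nondeg UB BT)[v vb va]; exists v => //.
  by move/perpP: vb; apply; rewrite genmxE.
have [u ua ub] : exists2 u, form u a = 0 & form u b = 1.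
  have : ~~ (b <= <<a>>)%MS by rewrite genmxE.
  move=> /(form_nondeg UB BT)[u ua ub]; exists u => //.
  by move/perpP: ua; apply; rewrite genmxE.
have sym s t : form s t = form t s by rewrite (formC BT) e1 mul1r.
exists (wedge a b) => x y nx ny; have [sz zW z0] := stabilizer_bracket W0 nx ny.
set z := x *m y - y *m x in sz zW z0 *.
have [c [d vz]] := WE _ (zW v); have [c' [d' uz]] := WE _ (zW u).
have d0 : d = 0.
  have := form_skew_diag BT v e1 sz; rewrite vz formDl !formZl sym vb (sym a) va.
  by rewrite mulr0 add0r mulr1.
have c'0 : c' = 0.
  have := form_skew_diag BT u e1 sz; rewrite uz formDl !formZl sym ub (sym a) ua.
  by rewrite mulr0 addr0 mulr1.
have cd : d' = - c.
  have := form_skew v u sz; rewrite vz uz d0 c'0 !scale0r addr0 add0r formZl (formZr BT).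
  by rewrite va (sym b) ub !mulr1 => ->; rewrite opprK.
exists c; apply: eq_mulrow => w; rewrite -scalemxAr mulmx_wedge e1 mul1r.
have : (w - form w a *: v - form w b *: u <= perp W)%MS.
  apply/perpP => _ /WE[i [j ->]].
  rewrite (formDr BT) !(formZr BT) !formDl !formNl !formZl va vb ua ub.
  by rewrite !mulr0 !mulr1 !subr0 !subrr !mulr0 addr0.
move=> /z0; rewrite !mulmxBl -!scalemxAl vz uz d0 c'0 cd !scale0r addr0 add0r => /eqP.
rewrite subr_eq0 subr_eq => /eqP ->.
by rewrite scaleNr scalerN scalerBr !scalerA addrC mulrC [form w b * c]mulrC.
Qed.

(** If W had rank at most 1, W^perp would contain two vectors independent modulo W, and some
    combination of them would be isotropic and enlarge W. *)
Lemma max_isotropic_plane : eps = 1 -> N = 5%N ->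
  (forall W' : 'M[C]_N, (W' <= perp W')%MS -> (W <= W')%MS -> (W' <= W)%MS) ->
  \rank W = 2%N.
Proof.
move=> e1 N5 maxW; have sym s t : form s t = form t s by rewrite (formC BT) e1 mul1r.
have rp : (\rank (perp W) + \rank W = 5)%N by rewrite rank_perp// N5.
have r2 : (\rank W <= 2)%N.
  have : (\rank W + \rank W <= 5)%N by rewrite -rp leq_add2r mxrankS.
  by rewrite addnn => /half_leq; rewrite doubleK.
apply/eqP; rewrite eqn_leq r2 /= ltnNge; apply/negP => r1.
have noiso v : (v <= perp W)%MS -> form v v = 0 -> (v <= W)%MS.
  move=> vW vv; apply: submx_trans (addsmxSr W v) _; apply: maxW (addsmxSl _ _).
  have pP' w : (w <= W + v)%MS -> form v w = 0 /\ forall s, (s <= W)%MS -> form s w = 0.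
    move=> /sub_add_rV[c [s [sW ->]]]; split=> [|t tW].
      by rewrite (formDr BT) (formZr BT) vv mulr0 add0r; move/perpP: vW; apply.
    rewrite (formDr BT) (formZr BT) [form t v]sym.
    move/perpP: vW => ->//; rewrite mulr0 add0r.
    by have /perpP := submx_trans tW iW; apply.
  rewrite addsmx_sub; apply/andP; split; last by apply/perpP => w /pP'[].
  by apply/row_subP => i; apply/perpP => w /pP'[_]; apply; apply: row_sub.
have rp4 : (3 < \rank (perp W))%N.
  by rewrite -(leq_add2r (\rank W)) rp; case: (\rank W) r1 => [|[]].
have [a [aW na]] : exists a, (a <= perp W)%MS /\ ~~ (a <= W)%MS.
  have /row_subPn[i iW'] : ~~ (perp W <= W)%MS.
    by apply/negP => /mxrankS /(leq_trans rp4); rewrite ltnNge (leq_trans r1).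
  by exists (row i (perp W)); rewrite row_sub iW'.
have [b [bW nb]] : exists b, (b <= perp W)%MS /\ ~~ (b <= W + a)%MS.
  have /row_subPn[i iW'] : ~~ (perp W <= W + a)%MS.
    apply/negP => /mxrankS /(leq_trans rp4); rewrite ltnNge; case/negP.
    have := mxrank_adds_leqif W a; move=> /leqifP.
    move=> _; apply: leq_trans (mxrank_adds_leqif W a).1 _.
    by apply: leq_trans (leq_add r1 (rank_leq_row a)) _.
  by exists (row i (perp W)); rewrite row_sub iW'.
have nbW : ~~ (b <= W)%MS by apply: contra nb => /submx_trans; apply; apply: addsmxSl.
case: (eqVneq (form b b) 0) => [bb|bb]; first by case/negP: nbW; apply: noiso.
(* t is a root of the quadratic equation (a + t b, a + t b) = 0. *)
pose D := sqrtC (form a b ^+ 2 - form a a * form b b).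
pose t := (D - form a b) / form b b.
have tE : form (a + t *: b) (a + t *: b) = 0.
  rewrite formDl formZl !(formDr BT) !(formZr BT) [form b a]sym.
  have -> : form a a + t * form a b + t * (form a b + t * form b b) =
      (D ^+ 2 - (form a b ^+ 2 - form a a * form b b)) / form b b.
    by rewrite /t; field.
  by rewrite sqrtCK subrr mul0r.
case/negP: nb.
have atb : ((a + t *: b)%R <= W)%MS.
  by apply: noiso; [rewrite addmx_sub ?scalemx_sub|exact: tE].
case: (eqVneq t 0) => t0; first by case/negP: na; move: atb; rewrite t0 scale0r addr0.
have -> : b = t^-1 *: (a + t *: b - a).
  by rewrite addrC addKr scalerA mulVf// scale1r.
rewrite scalemx_sub// addmx_sub//; first exact: submx_trans atb (addsmxSl _ _).
by rewrite eqmx_opp addsmxSr.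
Qed.

End Stabilizers.

(** * Words in two noncommuting elements *)

Section NilpotentDifference.

Variable R : pzRingType.
Implicit Types (x z : R).

(** The longest word avoiding xxx, zz and xzx is zxxz. *)
Lemma nil_sum5 x z : x * (x * x) = 0 -> z * z = 0 -> x * (z * x) = 0 -> (x + z) ^+ 5 = 0.
Proof.
move=> x3 z2 xzx.
have x3' w : x * (x * (x * w)) = 0 by rewrite !mulrA -[x * x * x]mulrA x3 mul0r.
have z2' w : z * (z * w) = 0 by rewrite mulrA z2 mul0r.
have xzx' w : x * (z * (x * w)) = 0 by rewrite !mulrA -[x * z * x]mulrA xzx mul0r.
pose rules := (x3, x3', z2, z2', xzx, xzx', mulr0, addr0, add0r).
by rewrite !exprS expr0 mulr1; do 5!rewrite ?(mulrDl, mulrDr) -?mulrA ?rules.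
Qed.

(** Inner blocks have length exactly 2, and three consecutive double blocks are forbidden, so the
    longest words are xzzxxz and zxxzzx. *)
Lemma nil_sum7 x z : x * (x * x) = 0 -> z * (z * z) = 0 ->
  x * (z * x) = 0 -> z * (x * z) = 0 ->
  x * (x * (z * (z * (x * x)))) = 0 -> z * (z * (x * (x * (z * z)))) = 0 ->
  (x + z) ^+ 7 = 0.
Proof.
move=> x3 z3 xzx zxz xzx2 zxz2.
have x3' w : x * (x * (x * w)) = 0 by rewrite !mulrA -[x * x * x]mulrA x3 mul0r.
have z3' w : z * (z * (z * w)) = 0 by rewrite !mulrA -[z * z * z]mulrA z3 mul0r.
have xzx' w : x * (z * (x * w)) = 0 by rewrite !mulrA -[x * z * x]mulrA xzx mul0r.
have zxz' w : z * (x * (z * w)) = 0 by rewrite !mulrA -[z * x * z]mulrA zxz mul0r.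
have xzx2' w : x * (x * (z * (z * (x * (x * w))))) = 0.
  by have := congr1 (fun a => a * w) xzx2; rewrite -!mulrA mul0r.
have zxz2' w : z * (z * (x * (x * (z * (z * w))))) = 0.
  by have := congr1 (fun a => a * w) zxz2; rewrite -!mulrA mul0r.
pose rules := (x3, x3', z3, z3', xzx, xzx', zxz, zxz', xzx2, xzx2', zxz2, zxz2',
  mulr0, addr0, add0r).
by rewrite !exprS expr0 mulr1; do 7!rewrite ?(mulrDl, mulrDr) -?mulrA ?rules.
Qed.

End NilpotentDifference.

(** * Traces, sandwich identities and nilpotency of differences *)

Section LineType.

Variables (C : numClosedFieldType) (N : nat).
Implicit Types (x y z M g : 'M[C]_N) (G P Q : set 'M[C]_N).

(** det(1 + t x) has no root in t, so it is constant over an algebraically closed field; its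
    derivative at 0 is the trace. *)
Lemma nilpotent_trace x : nilpotent_mx x -> \tr x = 0.
Proof.
move=> nx; have [q q0 qE] := det_line_poly x.
have qn0 t : q.[t] != 0.
  by rewrite qE -unitmx_det; apply/nilpotent_unitD/nilpotentZ.
have /eqP/size_poly1P[c _ qc] : size q = 1%N.
  by apply/eqP/negPn/negP => /closed_rootP[t]; rewrite rootE (negPf (qn0 t)).
have one0 : (1 : {poly C}).[0] != 0 by rewrite hornerC oner_neq0.
have [] // := germ_uniq one0 _ (germ_det (germ_mx_line 1%:M x)) (germ_cst c).
by move=> t _; rewrite -qE qc hornerC.
Qed.

Lemma nilpotentXS x k : nilpotent_mx x -> nilpotent_mx (x ^+ k.+1).
Proof. by move=> [m xm]; exists m; rewrite -exprM mulnC exprM xm exprS mul0r. Qed.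

Lemma nilpotent_sqr x : nilpotent_mx (x *m x) -> nilpotent_mx x.
Proof. by move=> [k xk]; exists (2 * k)%N; rewrite exprM expr2 -mulmxE. Qed.

Variables (B : 'M[C]_N).
Hypotheses (UB : B \in unitmx) (BT : B^T = (1 : C) *: B).
Implicit Types (u v w e : 'rV[C]_N).

Local Notation form := (form B).
Local Notation wedge := (wedge B 1).
Local Notation line_type := (line_type B 1).

Let symC u v : form u v = form v u.
Proof. by rewrite (formC BT) mul1r. Qed.

Lemma line_type_conj g x : g \in unitmx -> g *m B *m g^T = B -> line_type x ->
  line_type (g *m x *m invmx g).
Proof.
move=> Ug gB [e [u [ee eu ->]]]; exists (e *m invmx g), (u *m invmx g).
have f v w : form v (w *m invmx g) = form (v *m g) w.
  by rewrite -[in RHS](mulmxKV Ug w) form_isom.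
split; [by rewrite f mulmxKV|by rewrite f mulmxKV|].
apply: eq_mulrow => v; rewrite !mulmxA !mulmx_wedge !f mulmxBl -!scalemxAl.
by [].
Qed.

(** Skewness gives (e M, e) = (u M, u) = 0; the only surviving pairing is (u M, e) = - (e M, u),
    half the trace. *)
Lemma line_type_sandwich x M : line_type x -> skew_mx B M ->
  x *m M *m x = (2^-1 * \tr (x *m M)) *: x.
Proof.
move=> [e [u [ee eu ->]]] sM.
have eMe : form (e *m M) e = 0 by exact: (form_skew_diag BT _ erefl sM).
have uMu : form (u *m M) u = 0 by exact: (form_skew_diag BT _ erefl sM).
have eMu : form (e *m M) u = - form (u *m M) e by rewrite form_skew// symC.
set m := form (u *m M) e in eMu *.
have trE : \tr (wedge e u *m M) = m + m.
  rewrite /wedge scale1r mulmxBl raddfB /=.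
  have tr1 a b : \tr (B *m a^T *m b *m M) = form (b *m M) a.
    by rewrite -[_ *m b *m M]mulmxA mxtrace_mulC mulmxA formE mxtrace_scalar mulr1n.
  by rewrite !tr1 eMu opprK.
rewrite trE -mulr2n -[m *+ 2]mulr_natl mulKf ?pnatr_eq0//.
apply: eq_mulrow => v; rewrite !mulmxA -scalemxAr [v *m wedge e u]mulmx_wedge mul1r.
rewrite !mulmxBl -!scalemxAl !mulmx_wedge !mul1r eMe uMu eMu -/m.
move: (form v e) (form v u) => a b.
by apply/rowP => j; rewrite !mxE; ring.
Qed.

Lemma line_type_sqr x : line_type x -> exists e q, [/\ form e e = 0, e *m x = 0
  & x *m x = q *: (B *m e^T *m e)].
Proof.
move=> [e [u [ee eu ->]]]; exists e, (- form u u).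
have ex : e *m wedge e u = 0 by rewrite mulmx_wedge ee eu mulr0 !scale0r subrr.
split=> //; apply: eq_mulrow => v.
rewrite -scalemxAr !mulmxA formE mul_scalar_mx [v *m wedge e u]mulmx_wedge.
rewrite mulmxBl -!scalemxAl ex scaler0 subr0 mulmx_wedge [form u e]symC eu.
rewrite scale0r sub0r mul1r scalerN !scalerA -scaleNr.
by rewrite mulNr mulrC.
Qed.

Lemma line_type_cube x : line_type x -> x *m (x *m x) = 0.
Proof.
move=> /line_type_sqr[e [q [_ ex xx]]].
by rewrite mulmxA xx -scalemxAl -mulmxA ex mulmx0 scaler0.
Qed.

Lemma line_type_sqr_sandwich x M : line_type x ->
  x *m x *m M *m (x *m x) = \tr (x *m x *m M) *: (x *m x).
Proof.
move=> /line_type_sqr[e [q [_ _ ->]]].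
have trE : \tr (B *m e^T *m e *m M) = form (e *m M) e.
  by rewrite -[_ *m e *m M]mulmxA mxtrace_mulC mulmxA formE mxtrace_scalar mulr1n.
have E : B *m e^T *m e *m M *m (B *m e^T *m e) = form (e *m M) e *: (B *m e^T *m e).
  apply: eq_mulrow => v; rewrite -scalemxAr !mulmxA [v *m B *m e^T]formE mul_scalar_mx -!scalemxAl.
  by rewrite formE mul_scalar_mx !scalerA mulrC.
rewrite -!scalemxAl -!scalemxAr E mxtraceZ trE !scalerA.
by congr (_ *: _); ring.
Qed.

(** The trace of (x + z)^2 reduces to 2 tr(x z), so tr(x z) = 0 and the sandwich identity yields x z
    x = 0. *)
Lemma nilpotent_sum_line x z : skew_mx B z -> line_type x -> nilpotent_mx z ->
  nilpotent_mx (x + z) -> \tr (z *m z) = 0 -> x *m (z *m x) = 0 /\ \tr (x *m z) = 0.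
Proof.
move=> sz lx nz nxz trzz.
have trxx : \tr (x *m x) = 0.
  apply: (@nilpotent_trace (x *m x)); exists 2%N.
  by rewrite expr2 -mulmxE -mulmxA line_type_cube// mulmx0.
have := nilpotent_trace (nilpotentXS 1 nxz).
rewrite expr2 -mulmxE mulmxDl !mulmxDr !mxtraceD trxx trzz add0r addr0 [\tr (z *m x)]mxtrace_mulC.
rewrite -mulr2n => /eqP; rewrite mulrn_eq0 /= => /eqP tr0; split=> //.
by rewrite mulmxA line_type_sandwich// tr0 mulr0 scale0r.
Qed.

Definition good x := x *m x = 0 \/ line_type x.

Lemma good_nilpotent x : good x -> nilpotent_mx x.
Proof.
move=> [xx|/line_type_cube x3]; first by exists 2%N; rewrite expr2 -mulmxE.
by exists 3%N; rewrite !exprS expr0 mulr1 -mulmxE.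
Qed.

Lemma sqr0_difference x z : x *m x = 0 -> z *m z = 0 -> nilpotent_mx (x + z) ->
  nilpotent_mx (x - z).
Proof.
move=> xx zz nxz; apply: nilpotent_sqr.
have -> : (x - z) *m (x - z) = - ((x + z) ^+ 2).
  rewrite expr2 -mulmxE !mulmxDl !mulmxDr !mulmxN !mulNmx xx zz opprK.
  by rewrite !add0r !addr0 opprD addrC.
by apply/nilpotentN/nilpotentXS.
Qed.

Lemma good_difference x z : skew_mx B x -> skew_mx B z -> good x -> good z ->
  nilpotent_mx (x + z) -> nilpotent_mx (x - z).
Proof.
move=> sx sz gx gz nxz; have nx := good_nilpotent gx; have nz := good_nilpotent gz.
have nzx : nilpotent_mx (z + x) by rewrite addrC.
have trsq y : good y -> \tr (y *m y) = 0.
  by move=> /good_nilpotent/(nilpotentXS 1)/nilpotent_trace; rewrite expr2 -mulmxE.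
have key5 y (w : 'M[C]_N) : skew_mx B w -> line_type y -> w *m w = 0 -> nilpotent_mx (y + w) ->
    nilpotent_mx (y - w).
  move=> sw ly ww nyw; have nw : nilpotent_mx w by exists 2%N; rewrite expr2 -mulmxE.
  have [ywy _] := nilpotent_sum_line sw ly nw nyw (etrans (congr1 mxtrace ww) (mxtrace0 _ _)).
  exists 5%N; apply: nil_sum5; rewrite -?mulmxE ?mulNmx ?mulmxN ?ywy ?ww ?oppr0//.
  exact: line_type_cube.
case: gx => [xx|lx]; case: gz => [zz|lz].
- exact: sqr0_difference.
- by rewrite -opprB; apply/nilpotentN/key5.
- exact: key5.
have [xzx trxz] := nilpotent_sum_line sz lx nz nxz (trsq _ (or_intror lz)).
have [zxz _] := nilpotent_sum_line sx lz nx nzx (trsq _ (or_intror lx)).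
have [x3 z3] := (line_type_cube lx, line_type_cube lz).
(* Once words with x^3, z^3, xzx or zxz are removed, tr (x + z)^4 is the sum over the four rotations
   of xxzz, that is 4 tr(x^2 z^2). *)
have tr4 : \tr (x *m (x *m (z *m z))) = 0.
  have E : (x + z) ^+ 2 = x *m x + x *m z + z *m x + z *m z.
    by rewrite expr2 -mulmxE mulmxDl !mulmxDr !addrA.
  have := nilpotent_trace (nilpotentXS 3 nxz); rewrite (exprM _ 2 2) E expr2 -mulmxE.
  have x3' (w : 'M[C]_N) : x *m (x *m (x *m w)) = 0 by rewrite !mulmxA -[x *m x *m x]mulmxA x3 mul0mx.
  have z3' (w : 'M[C]_N) : z *m (z *m (z *m w)) = 0 by rewrite !mulmxA -[z *m z *m z]mulmxA z3 mul0mx.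
  have xzx' (w : 'M[C]_N) : x *m (z *m (x *m w)) = 0 by rewrite !mulmxA -[x *m z *m x]mulmxA xzx mul0mx.
  have zxz' (w : 'M[C]_N) : z *m (x *m (z *m w)) = 0 by rewrite !mulmxA -[z *m x *m z]mulmxA zxz mul0mx.
  rewrite !mulmxDl !mulmxDr -!mulmxA.
  rewrite !(x3, x3', z3, z3', xzx, xzx', zxz, zxz', mulmx0, addr0, add0r) !mxtraceD.
  have c1 : \tr (z *m (z *m (x *m x))) = \tr (x *m (x *m (z *m z))).
    by rewrite mulmxA mxtrace_mulC -mulmxA.
  have c2 : \tr (x *m (z *m (z *m x))) = \tr (x *m (x *m (z *m z))).
    by rewrite mxtrace_mulC -!mulmxA c1.
  have c3 : \tr (z *m (x *m (x *m z))) = \tr (x *m (x *m (z *m z))).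
    by rewrite mxtrace_mulC -!mulmxA.
  rewrite c1 c2 c3 => H.
  have : \tr (x *m (x *m (z *m z))) *+ 4 = 0 by rewrite -[RHS]H !mulrS mulr0n addr0 !addrA.
  by move/eqP; rewrite mulrn_eq0 /= => /eqP.
have xzx2 : x *m (x *m (z *m (z *m (x *m x)))) = 0.
  have := line_type_sqr_sandwich (z *m z) lx; rewrite -[x *m x *m (z *m z)]mulmxA tr4 scale0r.
  by rewrite -!mulmxA.
have zxz2 : z *m (z *m (x *m (x *m (z *m z)))) = 0.
  have := line_type_sqr_sandwich (x *m x) lz; rewrite mxtrace_mulC -[x *m x *m (z *m z)]mulmxA tr4.
  by rewrite scale0r -!mulmxA.
exists 7%N; apply: nil_sum7;
  by rewrite -?mulmxE ?(mulNmx, mulmxN) ?(x3, z3, xzx, zxz, xzx2, zxz2) ?oppr0.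
Qed.

End LineType.

(** * From nilradicals to the conormal variety *)

Section Conormal.

Variables (C : numClosedFieldType) (N : nat).
Implicit Types (g x y z : 'M[C]_N).
Variables (G : set 'M[C]_N) (theta : regular_map C N) (P Q : set 'M[C]_N).
Hypotheses (cG : cayley_group G) (inv_theta : involution G theta).
Hypothesis pP : parabolic_subgroup P G.

Local Notation th := (eval_map theta).
Local Notation dth := (differential theta).
Local Notation n := (nilradical (Lie P)).
Local Notation thn := (nilradical (Lie (th @` P))).

Let GG : closed_subgroup G (GL C N). Proof. by case: cG. Qed.
Let GGL : G `<=` GL C N. Proof. by case: GG => -[]. Qed.
Let PG : P `<=` G. Proof. by case: pP => -[]. Qed.
Let thPG : th @` P `<=` G. Proof. exact: (image_theta_sub inv_theta PG). Qed.
Let nG y : n y -> Lie G y. Proof. by move=> /nilradical_Lie; apply: Lie_sub. Qed.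
Let thnG y : thn y -> Lie G y. Proof. by move=> /nilradical_Lie; apply: Lie_sub. Qed.

Lemma dtheta_nilradicalV y : thn y -> n (dth y).
Proof.
by move=> /(dtheta_nilradical cG inv_theta thPG); rewrite (image_thetaK inv_theta PG).
Qed.

Lemma commutator_theta x y : thn x -> thn y ->
  x *m y - y *m x = dth (dth x *m dth y - dth y *m dth x).
Proof.
move=> nx ny; have [Gx Gy] := (nG (dtheta_nilradicalV nx), nG (dtheta_nilradicalV ny)).
by rewrite (dtheta_bracket GG inv_theta)// !(dthetaK GG inv_theta)//; apply: thnG.
Qed.

Lemma comm_line_theta : comm_line n -> comm_line thn.
Proof.
move=> [z zP]; exists (dth z) => x y nx ny.
have [c E] := zP _ _ (dtheta_nilradicalV nx) (dtheta_nilradicalV ny).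
by exists c; rewrite commutator_theta// E dthetaZ.
Qed.

Lemma abelian_theta : (forall x y, n x -> n y -> x *m y = y *m x) ->
  forall x y, thn x -> thn y -> x *m y = y *m x.
Proof.
move=> abn x y nx ny; apply/eqP; rewrite -subr_eq0 commutator_theta//.
by rewrite abn ?subrr ?dtheta0//; apply: dtheta_nilradicalV.
Qed.

(** With y = g y0 g^-1 and y0 in n, dtheta(y) is the conjugate by theta(g) of dtheta(y0), which lies
    in the nilradical of Lie theta(P); so y and dtheta(y) are both good, and their sum is
    nilpotent. *)
Lemma conormal_nilpotent (good : 'M[C]_N -> Prop) :
  (forall g x, G g -> good x -> good (g *m x *m invmx g)) ->
  (forall y, n y -> good y) -> (forall y, thn y -> good y) ->
  (forall x z, Lie G x -> Lie G z -> good x -> good z -> nilpotent_mx (x + z) ->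
    nilpotent_mx (x - z)) ->
  phi_s theta @` conormal_variety G theta P Q `<=` nilpotent_antifixed G theta.
Proof.
move=> goodG goodn goodthn good_diff _ [[[y q1] p1] [Gy _ [g Gg p1E] ny nq] <-].
have Ug : g \in unitmx by apply: GGL.
have nyg : n (invmx g *m y *m g).
  rewrite -{2}[g]invmxK; move: ny; rewrite p1E; apply: nilradical_conj.
  - by rewrite unitmx_inv.
  - by move=> _ [x Px <-]; rewrite !mulmxA mulVmx// mul1mx invmxK mulmxKV.
  - by move=> x Px; exists x => //; rewrite invmxK.
set y0 := invmx g *m y *m g in nyg.
have yE : y = g *m y0 *m invmx g.
  by rewrite /y0 !mulmxA mulmxV// mul1mx mulmxK.
have goody : good y by rewrite yE; apply: goodG => //; apply: goodn.
have Gthg : G (th g) by case: inv_theta => + _ _; apply.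
have goodthy : good (dth y).
  rewrite yE (dtheta_conj GG inv_theta Gg (nG nyg)); apply: goodG => //.
  by apply/goodthn/(dtheta_nilradical cG inv_theta PG).
have Gthy : Lie G (dth y) by apply: (Lie_thetaG GG inv_theta).
have two0 : (2 : C) != 0 by rewrite pnatr_eq0.
have nsum : nilpotent_mx (y + dth y).
  have := nilpotentZ 2 (nilradical_nilpotent nq).
  by rewrite /theta_part scalerA mulfV// scale1r.
split; last exact/nilpotentZ/good_diff.
split; rewrite /phi_s /antitheta_part /=.
  apply: (linear_setZ _ (Lie_linear G)); exact: (linear_setB (Lie_linear G)).
by rewrite dthetaZ dthetaB (dthetaK GG inv_theta Gy) -scalerN opprB.
Qed.

End Conormal.

(** * The conclusion for GL, Sp and SO under commutator hypotheses *)

Section ClassicalCases.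

Variables (C : numClosedFieldType) (N : nat).
Implicit Types (g x y z B W : 'M[C]_N).
Variables (G : set 'M[C]_N) (theta : regular_map C N) (P Q : set 'M[C]_N).
Hypotheses (inv_theta : involution G theta) (pP : parabolic_subgroup P G).

Local Notation n := (nilradical (Lie P)).
Local Notation conclusion :=
  (phi_s theta @` conormal_variety G theta P Q `<=` nilpotent_antifixed G theta).

Let conj_sqr0 g x : g \in unitmx -> x *m x = 0 ->
  (g *m x *m invmx g) *m (g *m x *m invmx g) = 0.
Proof.
move=> Ug xx; rewrite !mulmxA mulmxKV//.
by rewrite -[g *m x *m x]mulmxA xx mulmx0 mul0mx.
Qed.

Lemma conormal_GL : G = GL C N -> (forall x y, n x -> n y -> x *m y = y *m x) -> conclusion.
Proof.
move=> GE abn; have cG : cayley_group G by rewrite GE; apply: cayley_group_GL.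
have pthP := image_theta_parabolic (let: And4 h _ _ _ := cG in h) inv_theta pP.
have abthn := abelian_theta cG inv_theta pP abn.
apply: (@conormal_nilpotent _ _ _ _ _ _ cG inv_theta pP (fun x => x *m x = 0)).
- by move=> g x Gg; apply: conj_sqr0; rewrite GE in Gg.
- by have pP' := pP; rewrite GE in pP' => y ny; apply: (GL_nilradical pP').
- by rewrite GE in pthP => y ny; apply: (GL_nilradical pthP).
- by move=> x z _ _; apply: sqr0_difference.
Qed.

Lemma conormal_Sp B : nondegenerate_alternating B -> form_group B G -> comm_line n ->
  conclusion.
Proof.
move=> [BT UB] fG cn; have cG := form_group_cayley fG.
have pthP := image_theta_parabolic (let: And4 h _ _ _ := cG in h) inv_theta pP.
have cthn := comm_line_theta cG inv_theta pP cn.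
have BT' : B^T = -1 *: B by rewrite scaleN1r.
have N1 : (-1 : C) = 1 \/ -1 = -1 :> C by right.
have N1n : (-1 : C) <> 1.
  by move=> /eqP; rewrite eq_sym -addr_eq0 -mulr2n pnatr_eq0.
apply: (@conormal_nilpotent _ _ _ _ _ _ cG inv_theta pP (fun x => x *m x = 0)).
- move=> g x Gg; apply: conj_sqr0.
  by case: cG => [[[GGL _ _ _] _ _] _ _ _]; apply: GGL.
- by move=> y ny; case: (form_nilradical BT' N1 fG pP cn (or_introl erefl) ny) => // -[].
- by move=> y ny; case: (form_nilradical BT' N1 fG pthP cthn (or_introl erefl) ny) => // -[].
- by move=> x z _ _; apply: sqr0_difference.
Qed.

Lemma conormal_SO B : nondegenerate_symmetric B -> form_group B G -> comm_line n ->
  N = 5%N \/ (forall x y, n x -> n y -> x *m y = y *m x) -> conclusion.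
Proof.
move=> [BT UB] fG cn abn; have cG := form_group_cayley fG.
have pthP := image_theta_parabolic (let: And4 h _ _ _ := cG in h) inv_theta pP.
have cthn := comm_line_theta cG inv_theta pP cn.
have BT' : B^T = (1 : C) *: B by rewrite scale1r.
have e1 : (1 : C) = 1 \/ 1 = -1 :> C by left.
have sk x : Lie G x -> skew_mx B x by apply: (form_group_skew fG).
apply: (@conormal_nilpotent _ _ _ _ _ _ cG inv_theta pP (good B)).
- move=> g x Gg; have Ug : g \in unitmx.
    by case: cG => [[[GGL _ _ _] _ _] _ _ _]; apply: GGL.
  case=> [xx|lx]; [left; exact: conj_sqr0|right; apply: line_type_conj => //].
  by case: fG => _ _ + _; apply.
- move=> y ny; case: (form_nilradical BT' e1 fG pP cn _ ny) => [|h|[_ h]]; [|by left|by right].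
  by right.
- move=> y ny; case: (form_nilradical BT' e1 fG pthP cthn _ ny) => [|h|[_ h]]; [|by left|by right].
  right; split=> //; case: abn => [N5|abn]; [by left|right].
  exact: abelian_theta cG inv_theta pP abn.
- by move=> x z /sk sx /sk sz; apply: good_difference.
Qed.

End ClassicalCases.

(** * Isotropic subspaces and the listed situations *)

Section IsotropicStabilizers.

Variables (C : numClosedFieldType) (N : nat) (B W : 'M[C]_N).

Lemma isotropic_perp : isotropic B W -> (W <= perp B W)%MS.
Proof. by move=> iW; apply/sub_kermxP; rewrite mulmxA. Qed.

Lemma perp_isotropic : (W <= perp B W)%MS -> isotropic B W.
Proof. by move=> /sub_kermxP; rewrite mulmxA. Qed.

Lemma lagrangian_perp : B \in unitmx -> lagrangian B W -> (perp B W <= W)%MS.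
Proof.
move=> UB [/isotropic_perp iW rW].
rewrite -(mxrank_leqif_sup iW); apply/eqP; apply: (@addIn (\rank W)).
by rewrite rank_perp// addnn -mul2n.
Qed.

Lemma mx_empty (x y : 'M[C]_N) : N = 0%N -> x = y.
Proof.
move=> N0; apply/matrixP => i; have : (i < 0)%N by apply: leq_trans (ltn_ord i) (eq_leq N0).
by [].
Qed.

End IsotropicStabilizers.

Theorem proposition10p3 (R : realType) (N : nat) (G : set 'M[R[i]]_N)
    (theta : regular_map R[i] N) (P Q : set 'M[R[i]]_N) :
  connected_reductive G ->
  involution G theta ->
  zariski_connected (fixed_subgroup G theta) ->
  parabolic_subgroup P G ->
  parabolic_subgroup Q (fixed_subgroup G theta) ->
  [/\ (* GL_n *)
      G = GL R[i] N -> maximal_parabolic_subgroup P G ->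
        phi_s theta @` conormal_variety G theta P Q
          `<=` nilpotent_antifixed G theta,
      (* Sp_2n *)
      forall B : 'M[R[i]]_N, nondegenerate_alternating B -> G = Sp B ->
        (exists2 W : 'M[R[i]]_N, lagrangian B W \/ is_line W
           & P = stabilizer G W) ->
        phi_s theta @` conormal_variety G theta P Q
          `<=` nilpotent_antifixed G theta,
      (* SO_n *)
      forall B : 'M[R[i]]_N, nondegenerate_symmetric B -> G = SO B ->
        (exists2 W : 'M[R[i]]_N,
             [\/ isotropic B W /\ is_line W, lagrangian B W
               | N = 5%N /\ maximal_isotropic B W]
           & P = stabilizer G W) ->
        phi_s theta @` conormal_variety G theta P Q
          `<=` nilpotent_antifixed G theta
    & (* classical G, abelian unipotent radical *)
      classical_group G -> abelian_group (unipotent_radical P) ->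
        phi_s theta @` conormal_variety G theta P Q
          `<=` nilpotent_antifixed G theta].
Proof.
move=> [cG _ _] inv _ pP _; split.
- move=> GE maxP; apply: conormal_GL => // x y nx ny.
  rewrite GE in pP maxP.
  by rewrite !(maximal_nilradical_abelian pP maxP).
- move=> B aB GE [W WP PE].
  have fG : form_group B G by rewrite GE; apply: form_group_Sp; rewrite -?GE.
  apply: (conormal_Sp inv pP aB fG).
  have [BT UB] := aB.
  have BT' : B^T = -1 *: B by rewrite scaleN1r.
  have N1 : (-1 : R[i]) = 1 \/ -1 = -1 :> R[i] by right.
  rewrite PE in pP *.
  case: WP => [lW|rW].
    (* A zero Lagrangian subspace occurs only for N = 0, where all matrices are equal. *)
    case: (eqVneq W 0) => [W0|W0].
      exists 0 => x y _ _; exists 0; apply: mx_empty.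
      by have [_ <-] := lW; rewrite W0 mxrank0.
    exists 0 => x y nx ny; exists 0; rewrite scale0r.
    have iW := isotropic_perp lW.1; have pW := lagrangian_perp UB lW.
    by rewrite !(lagrangian_nilradical BT' N1 fG pP iW W0 pW) ?subrr.
  (* Every line is isotropic for an alternating form. *)
  have iW : (W <= perp B W)%MS.
    apply/row_subP => i; apply/perpP => v vW; apply: (form_sym0 BT').
    have [e We] : exists e : 'rV[R[i]]_N, (W <= e)%MS.
      exists (castmx (rW, erefl N) (row_base W)).
      by rewrite (eqmx_cast _ (rW, erefl N)) eq_row_base.
    have /sub_rVP[a ->] := submx_trans vW We.
    have /sub_rVP[b ->] := submx_trans (row_sub i W) We.
    by rewrite formZl (formZr BT') (form_alt0 BT')// !mulr0.
  exact: (line_comm_line BT' N1 fG pP iW rW).1.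
- move=> B sB GE [W WP PE].
  have fG : form_group B G by rewrite GE; apply: form_group_SO; rewrite -?GE.
  have [BT UB] := sB.
  have BT' : B^T = (1 : R[i]) *: B by rewrite scale1r.
  have e1 : (1 : R[i]) = 1 \/ 1 = -1 :> R[i] by left.
  rewrite PE in pP *.
  case: WP => [[iso rW]|lW|[N5 [iso maxW]]].
  + have [cn abn] := line_comm_line BT' e1 fG pP (isotropic_perp iso) rW.
    by apply: (conormal_SO inv pP sB fG cn); right; apply: abn.
  + have abn x y : nilradical (Lie (stabilizer G W)) x ->
        nilradical (Lie (stabilizer G W)) y -> x *m y = y *m x.
      move=> nx ny; case: (eqVneq W 0) => [W0|W0].
        by apply: mx_empty; have [_ <-] := lW; rewrite W0 mxrank0.
      have iW := isotropic_perp lW.1; have pW := lagrangian_perp UB lW.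
      by rewrite !(lagrangian_nilradical BT' e1 fG pP iW W0 pW).
    apply: (conormal_SO inv pP sB fG); last by right.
    by exists 0 => x y nx ny; exists 0; rewrite (abn x y)// subrr scaler0.
  + apply: (conormal_SO inv pP sB fG); last by left.
    have iW := isotropic_perp iso.
    apply: (plane_comm_line BT' e1 fG pP iW) => //.
    apply: (max_isotropic_plane BT' fG iW) => // W' iW'; apply: maxW.
    exact: perp_isotropic.
- have cn : (forall x y, nilradical (Lie P) x -> nilradical (Lie P) y -> x *m y = y *m x) ->
      comm_line (nilradical (Lie P)).
    by move=> abn; exists 0 => x y nx ny; exists 0; rewrite (abn x y)// subrr scaler0.
  have ab (cayG : cayley_group G) : abelian_group (unipotent_radical P) -> forall x y,
      nilradical (Lie P) x -> nilradical (Lie P) y -> x *m y = y *m x.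
    by move=> abP x y; apply: nilradical_abelian cayG pP abP.
  case=> [GE|[B aB GE]|[B sB GE]] abP.
  + apply: conormal_GL => //; apply: ab => //.
    by rewrite GE; apply: cayley_group_GL.
  + have fG : form_group B G by rewrite GE; apply: form_group_Sp; rewrite -?GE.
    by apply: (conormal_Sp inv pP aB fG); apply/cn/ab => //; apply: form_group_cayley fG.
  + have fG : form_group B G by rewrite GE; apply: form_group_SO; rewrite -?GE.
    have abn := ab (form_group_cayley fG) abP.
    by apply: (conormal_SO inv pP sB fG); [apply: cn|right].
Qed.
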